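(* Let $(G,\mathcal{G},\sigma)$ be a right-invariant magnetic system on a regular Lie group $G$ with Lie algebra $\mathfrak g$, and assume that the adjoint $\mathrm{ad}^T$ of $\mathrm{ad}$ with respect to the inner product on $\mathfrak g$ exists. Regard $\sigma$ also as a Lie algebra 2-cocycle on $\mathfrak g$, and suppose that there is a one-dimensional central extension $\hat G$ of $G$ with Lie algebra $\hat{\mathfrak g}=\mathfrak g\rtimes_\sigma\mathbb{R}$, equipped with the right-invariant Riemannian metric $\hat{\mathcal{G}}$ given at the identity by $\hat{\mathcal{G}}_{(\mathrm{id},0)}((u,a),(v,b))=\mathcal{G}_{\mathrm{id}}(u,v)+ab$. Let $\hat\gamma$ be a smooth curve in $\hat G$ with projection $\gamma$ to $G$ and Eulerian velocity $(u,a)$, where $u=\dot\gamma\circ\gamma^{-1}$ is a curve in $\mathfrak g$ and $a$ a real-valued function of time. Then $\hat\gamma$ is a geodesic of $(\hat G,\hat{\mathcal{G}})$ if and only if $a$ is constant and $\gamma$ is a magnetic geodesic of strength $a$ of $(G,\mathcal{G},\sigma)$.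
   Context: A right-invariant magnetic system $(G,\mathcal{G},\sigma)$ consists of a regular Lie group $G$ (in the sense of Kriegl--Michor, possibly infinite-dimensional), a right-invariant Riemannian metric $\mathcal{G}$ induced by an inner product $\langle\cdot,\cdot\rangle_{\mathfrak g}$ on $\mathfrak g=T_{\mathrm{id}}G$, and a right-invariant closed two-form $\sigma$. Lie brackets on $\mathfrak g$ and $\hat{\mathfrak g}$ are defined via right-invariant vector fields; $\mathrm{ad}_u(v)=[u,v]$, and $\mathrm{ad}^T$ is defined by $\langle\mathrm{ad}^T_u(v),w\rangle_{\mathfrak g}=\langle v,[u,w]\rangle_{\mathfrak g}$. The Lie algebra $\hat{\mathfrak g}=\mathfrak g\rtimes_\sigma\mathbb{R}$ is the vector space $\mathfrak g\oplus\mathbb{R}$ with bracket $[(u,a),(v,b)]=([u,v],\sigma(u,v))$, where $\sigma(u,v)=\sigma_{\mathrm{id}}(u,v)$. The Eulerian velocity of a curve is its velocity right-translated to the identity. The Lorentz force $Y:TG\to TG$ is defined by $\mathcal{G}_q(Y_qu,v)=\sigma_q(u,v)$ (its existence, and that of the Levi-Civita connection $\nabla$ of $\mathcal G$, is part of the setting). A curve $\gamma$ in $G$ is a magnetic geodesic of strength $s\in\mathbb{R}$ if $\nabla_{\dot\gamma}\dot\gamma=s\,Y_\gamma\dot\gamma$. *)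

(* Defs.v *)
(* Convenient calculus, manifolds and regular Lie groups in the sense of
   A. Kriegl and P. Michor, "The Convenient Setting of Global Analysis" (KM),
   in MathComp-Analysis; model spaces are locally convex spaces (tvsType). *)
From mathcomp Require Import all_boot all_order all_algebra.
From mathcomp Require Import boolp classical_sets functions set_interval reals.
From mathcomp Require Import topology normedtype.

Set Implicit Arguments.
Unset Strict Implicit.
Unset Printing Implicit Defensive.

Import Order.TTheory GRing.Theory Num.Theory.
Import numFieldNormedType.Exports.

Local Open Scope classical_set_scope.
Local Open Scope ring_scope.

Section ConvenientCalculus.
Context {R : realType}.
Implicit Types E F : tvsType R.

Definition diff_quotient E (c : R -> E) (t : R) : R -> E :=
  fun h => h^-1 *: (c (h + t) - c t).

(* The library's derivable and derive1 are restricted to normed codomains. *)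
Definition is_cderive E (c : R -> E) (t : R) (v : E) : Prop :=
  diff_quotient c t h @[h --> 0^'] --> v.

Definition cderive E (c : R -> E) (t : R) : E :=
  xget 0 [set v | is_cderive c t v].

(* Only meaningful for J open: the iterated derivatives are then determined at
   the points of J by the values of c on J. *)
Definition smooth_curve_on E (J : set R) (c : R -> E) : Prop :=
  forall (n : nat) (t : R), J t ->
    exists v, is_cderive (iter n (@cderive E) c) t v.

Definition smooth_curve E (c : R -> E) : Prop := smooth_curve_on setT c.

(* KM 2.14: c^oo-completeness, in the form "every smooth curve has an
   antiderivative". *)
Definition convenient E : Prop :=
  hausdorff_space E /\
  forall c : R -> E, smooth_curve c ->
    exists2 b : R -> E, smooth_curve b & forall t, cderive b t = c t.

Definition cinf_open E (U : set E) : Prop :=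
  forall c : R -> E, smooth_curve c -> open (c @^-1` U).

(* KM 3.11: a map is smooth iff it sends smooth curves to smooth curves. *)
Definition smooth_map_on E F (U : set E) (f : E -> F) : Prop :=
  forall c : R -> E, smooth_curve c -> (forall t, U (c t)) ->
    smooth_curve (fun t => f (c t)).

Definition smooth_family2 E (X : R -> R -> E) : Prop :=
  forall a b : R -> R^o, smooth_curve a -> smooth_curve b ->
    smooth_curve (fun t => X (a t) (b t)).

Definition dirderive E F (f : E -> F) (x v : E) : F :=
  cderive (fun h => f (x + h *: v)) 0.

End ConvenientCalculus.

(* One preferred chart around every point: chart p has domain dom p, coordinate
   map co p (meaningful on dom p) and inverse pt p (meaningful on the image of
   dom p). *)
Record atlas (R : realType) (E : tvsType R) (T : Type) := Atlas {
  dom : T -> set T;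
  co : T -> T -> E;
  pt : T -> E -> T }.

Definition chart_img (R : realType) (E : tvsType R) (T : Type)
    (A : atlas E T) (p : T) : set E := co A p @` dom A p.

Section Curves.
Context {R : realType} {E : tvsType R} {T : Type} (A : atlas E T).

Definition msmooth_curve_on (J : set R) (c : R -> T) : Prop :=
  forall (p : T) (t : R), J t -> dom A p (c t) ->
    exists V : set R, [/\ open V, V t, V `<=` c @^-1` dom A p &
      smooth_curve_on V (fun s => co A p (c s))].

Definition msmooth_curve (c : R -> T) : Prop := msmooth_curve_on setT c.

(* Topology of a manifold (KM 27.4): final for the smooth curves. *)
Definition mopen (U : set T) : Prop :=
  forall c : R -> T, msmooth_curve c -> open (c @^-1` U).

End Curves.

(* KM 27.1 and 27.4; the case q = p of [co_open] says that charts have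
   c^oo-open images, and [separated] is "smoothly Hausdorff". *)
Record manifold (R : realType) (E : tvsType R) (T : Type) := Manifold {
  matlas :> atlas E T;
  model_convenient : convenient E;
  dom_refl : forall p, dom matlas p p;
  coK : forall p q, dom matlas p q -> pt matlas p (co matlas p q) = q;
  co_open : forall p q,
    cinf_open (co matlas p @` (dom matlas p `&` dom matlas q));
  transition_smooth : forall p q,
    smooth_map_on (co matlas p @` (dom matlas p `&` dom matlas q))
      (fun y => co matlas q (pt matlas p y));
  separated : forall p q, p <> q -> exists f : T -> R^o,
    (forall c, msmooth_curve matlas c -> smooth_curve (fun t => f (c t))) /\
    f p <> f q }.

(* Maps between manifolds are smooth iff they send smooth curves to smooth
   curves (KM 27.2). *)
Definition msmooth_on (R : realType) (E F : tvsType R) (S T : Type)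
    (M : atlas E S) (N : atlas F T) (U : set S) (f : S -> T) : Prop :=
  forall c : R -> S, msmooth_curve M c -> (forall t, U (c t)) ->
    msmooth_curve N (fun t => f (c t)).

Definition msmooth (R : realType) (E F : tvsType R) (S T : Type)
    (M : atlas E S) (N : atlas F T) (f : S -> T) : Prop :=
  msmooth_on M N setT f.

(* The kinematic tangent space at p is the model space E: a tangent vector is
   represented by its coordinates in the preferred chart at p. Vector fields,
   endomorphism fields and covariant 2-tensors on a manifold with point type T
   thus have types T -> E, T -> E -> E and T -> E -> E -> R. *)

Section Tangent.
Context {R : realType} {E F : tvsType R} {S T : Type}.
Variables (M : atlas E S) (N : atlas F T).

Definition velocity (c : R -> S) (t : R) : E :=
  cderive (fun s => co M (c t) (c s)) t.

Definition tangent_map (f : S -> T) (p : S) (v : E) : F :=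
  cderive (fun h => co N (f p) (f (pt M p (co M p p + h *: v)))) 0.

(* A tangent vector at x, from coordinates in chart p to coordinates in
   chart q. *)
Definition coord_change (p q x : S) (v : E) : E :=
  cderive (fun h => co M q (pt M p (co M p x + h *: v))) 0.

End Tangent.

Section Tensors.
Context {R : realType} {E : tvsType R} {T : Type} (M : atlas E T).

Definition loc_field (X : T -> E) (p : T) (y : E) : E :=
  let q := pt M p y in coord_change M q p q (X q).

Definition loc_tensor (w : T -> E -> E -> R) (p : T) (y u v : E) : R^o :=
  let q := pt M p y in w q (coord_change M p q q u) (coord_change M p q q v).

(* KM 32.5 *)
Definition lie_bracket (X Y : T -> E) (p : T) : E :=
  dirderive (loc_field Y p) (co M p p) (X p)
  - dirderive (loc_field X p) (co M p p) (Y p).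

Definition is_tensor (w : T -> E -> E -> R) : Prop :=
  [/\ forall p v, scalar (w p ^~ v), forall p u, scalar (w p u) &
      forall (p : T) (c u v : R -> E),
        smooth_curve c -> (forall t, chart_img M p (c t)) ->
        smooth_curve u -> smooth_curve v ->
        smooth_curve (fun t => loc_tensor w p (c t) (u t) (v t))].

(* Weak Riemannian metrics are allowed, as usual in infinite dimension. *)
Definition riemannian_metric (g : T -> E -> E -> R) : Prop :=
  [/\ is_tensor g, forall p u v, g p u v = g p v u &
      forall p u, u != 0 -> 0 < g p u u].

Definition two_form (w : T -> E -> E -> R) : Prop :=
  is_tensor w /\ forall p u, w p u u = 0.

Definition closed_two_form (w : T -> E -> E -> R) : Prop :=
  two_form w /\
  forall p x y z,
    dirderive (fun e => loc_tensor w p e y z) (co M p p) x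
    - dirderive (fun e => loc_tensor w p e x z) (co M p p) y
    + dirderive (fun e => loc_tensor w p e x y) (co M p p) z = 0.

(* A linear connection on the tangent bundle is given by its Christoffel
   symbols in the charts: in chart p, nabla_X Y = dY.X + Gam p y X Y. *)
Definition is_connection (Gam : T -> E -> E -> E -> E) : Prop :=
  [/\ forall p y v, chart_img M p y -> linear (Gam p y ^~ v),
      forall p y u, chart_img M p y -> linear (Gam p y u),
      forall (p : T) (c u v : R -> E),
        smooth_curve c -> (forall t, chart_img M p (c t)) ->
        smooth_curve u -> smooth_curve v ->
        smooth_curve (fun t => Gam p (c t) (u t) (v t)) &
      forall p q y u v, (co M p @` (dom M p `&` dom M q)) y ->
        let phi z := co M q (pt M p z) in
        dirderive phi y (Gam p y u v) =
          dirderive (fun z => dirderive phi z v) y u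
          + Gam q (phi y) (dirderive phi y u) (dirderive phi y v)].

Definition levi_civita (g : T -> E -> E -> R) (Gam : T -> E -> E -> E -> E) :
    Prop :=
  [/\ is_connection Gam,
      forall p y u v, chart_img M p y -> Gam p y u v = Gam p y v u &
      forall p y x u v, chart_img M p y ->
        dirderive (fun e => loc_tensor g p e u v) y x =
          loc_tensor g p y (Gam p y x u) v + loc_tensor g p y u (Gam p y x v)].

(* nabla_{c'} c' at time t *)
Definition covariant_acceleration (Gam : T -> E -> E -> E -> E)
    (c : R -> T) (t : R) : E :=
  let p := c t in
  iter 2 (@cderive R E) (fun s => co M p (c s)) t
  + Gam p (co M p p) (velocity M c t) (velocity M c t).

Definition geodesic (Gam : T -> E -> E -> E -> E) (J : set R) (c : R -> T) :
    Prop :=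
  msmooth_curve_on M J c /\
  forall t, J t -> covariant_acceleration Gam c t = 0.

Definition lorentz_force (g w : T -> E -> E -> R) (Y : T -> E -> E) : Prop :=
  forall q u v, g q (Y q u) v = w q u v.

Definition magnetic_geodesic (Gam : T -> E -> E -> E -> E) (Y : T -> E -> E)
    (s : R) (J : set R) (c : R -> T) : Prop :=
  msmooth_curve_on M J c /\
  forall t, J t ->
    covariant_acceleration Gam c t = s *: Y (c t) (velocity M c t).

End Tensors.

(* KM 36.1 *)
Record lie_group (R : realType) (E : tvsType R) := LieGroup {
  lg_group :> groupType;
  lg_mfd :> manifold E lg_group;
  mul_smooth : forall a b : R -> lg_group,
    msmooth_curve lg_mfd a -> msmooth_curve lg_mfd b ->
    msmooth_curve lg_mfd (fun t => (a t * b t)%g);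
  inv_smooth : msmooth lg_mfd lg_mfd (fun x => (x^-1)%g) }.

Section LieGroups.
Context {R : realType} {E : tvsType R} (G : lie_group E).

(* T_h of the right translation by g *)
Definition trtrans (g h : G) (v : E) : E :=
  tangent_map G G (fun x : G => (x * g)%g) h v.

Definition rinv_field (u : E) : G -> E := fun g => trtrans g 1%g u.

Definition bracket (u v : E) : E :=
  lie_bracket G (rinv_field u) (rinv_field v) 1%g.

Definition eulerian_velocity (c : R -> G) (t : R) : E :=
  trtrans (c t)^-1%g (c t) (velocity G c t).

Definition right_invariant (w : G -> E -> E -> R) : Prop :=
  forall (g h : G) (u v : E),
    w (h * g)%g (trtrans g h u) (trtrans g h v) = w h u v.

(* KM 38.4. Smoothness of evol : C^oo(R, g) -> G is expressed through the
   exponential law C^oo(R, C^oo(R, g)) = C^oo(R x R, g). *)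
Definition regular : Prop :=
  exists Evol : (R -> E) -> R -> G,
    (forall X : R -> E, smooth_curve X ->
       [/\ msmooth_curve G (Evol X), Evol X 0 = 1%g &
           forall t, velocity G (Evol X) t = rinv_field (X t) (Evol X t)]) /\
    (forall X : R -> R -> E, smooth_family2 X ->
       msmooth_curve G (fun s => Evol (X s) 1)).

Definition ad_transpose_exists (g : G -> E -> E -> R) : Prop :=
  exists adT : E -> E -> E,
    forall u v w, g 1%g (adT u v) w = g 1%g v (bracket u w).

(* Gam is the Levi-Civita connection and Y the Lorentz force of the system. *)
Definition right_invariant_magnetic_system (g w : G -> E -> E -> R)
    (Gam : G -> E -> E -> E -> E) (Y : G -> E -> E) : Prop :=
  [/\ regular,
      riemannian_metric G g /\ right_invariant g,
      closed_two_form G w /\ right_invariant w,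
      levi_civita G g Gam &
      lorentz_force g w Y].

End LieGroups.

(* 1 -> Z -> H -> G -> 1 is an exact sequence of Lie groups with iota initial
   and central, and with smooth local sections of pi (i.e., H is a principal
   Z-bundle over G); Z is modelled on R. *)
Definition central_extension1 (R : realType) (E F : tvsType R)
    (Z : lie_group R^o) (H : lie_group F) (G : lie_group E)
    (iota : Z -> H) (pi : H -> G) : Prop :=
  [/\ {morph iota : x y / (x * y)%g} /\ {morph pi : x y / (x * y)%g},
      msmooth Z H iota /\ msmooth H G pi,
      injective iota /\
        (forall c : R -> Z,
           msmooth_curve H (fun t => iota (c t)) -> msmooth_curve Z c),
      (forall h : H, pi h = 1%g <-> exists z, h = iota z) /\
        (forall z h, (iota z * h = h * iota z)%g) &
      (forall g : G, exists h, pi h = g) /\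
        exists (U : set G) (s : G -> H),
          [/\ mopen G U, U 1%g, msmooth_on G H U s &
              forall g, U g -> pi (s g) = g]].

(* Phi identifies the Lie algebra g x|_sigma R with that of H (as convenient
   Lie algebras), in such a way that T pi becomes the projection onto g. *)
Definition lie_algebra_semidirect (R : realType) (E F : tvsType R)
    (H : lie_group F) (G : lie_group E) (pi : H -> G)
    (sigma : G -> E -> E -> R) (Phi : E * R^o -> F) : Prop :=
  [/\ linear Phi /\ bijective Phi,
      forall (u : R -> E) (a : R -> R^o),
        smooth_curve (fun t => Phi (u t, a t)) <->
        smooth_curve u /\ smooth_curve a,
      forall u v a b,
        bracket H (Phi (u, a)) (Phi (v, b)) =
        Phi (bracket G u v, sigma 1%g u v) &
      forall u a, tangent_map H G pi 1%g (Phi (u, a)) = u].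

(* Main.v *)
(* The weak form of the Euler-Arnold equation for a right-invariant metric g on a Lie group says
   that a curve c with Eulerian velocity u satisfies, for every w in the Lie algebra,
     g(nabla_c' c', X_w) = g(u', w) - g(u, [u, w]),
   X_w being the right-invariant field of w. It is the first variation of the energy of c along
   c_e = h(e) c, where h passes through 1 with velocity w: right invariance turns g(c', X_w) into
   g(u, w) and g(c_e', c_e') into g(u_e, u_e), and du_e/de = [u, w] at e = 0. On the extension, with
   u replaced by (u, a) and w by (w, b), the right-hand side becomes
     g(u', w) + a' b - g(u, [u, w]) - a sigma(u, w),
   and sigma(u, w) = g(Y c', X_w). It vanishes for all (w, b) iff a' = 0 and the magnetic geodesic
   equation of strength a holds.

   The calculus behind this is that of maps which preserve smooth curves: two-parameter families of
   this kind have partial derivatives of the same kind, which commute and satisfy the chain rule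
   (Boman's theorem). This follows from the special curve lemma, which bounds directional
   derivatives locally, and from finite differences. *)

Require Import Defs.
From mathcomp Require Import all_boot all_order all_algebra.
From mathcomp Require Import boolp classical_sets functions set_interval reals.
From mathcomp Require Import topology normedtype interval_inference convex.
From mathcomp Require Import sequences derive exp realfun.
From mathcomp Require Import ring lra.

Set Implicit Arguments.
Unset Strict Implicit.
Unset Printing Implicit Defensive.

Import Order.TTheory GRing.Theory Num.Theory.
Import numFieldNormedType.Exports.

Local Open Scope classical_set_scope.
Local Open Scope ring_scope.

(** * Identities in modules *)

(** Three features of the setting shape the proof. The metric may be weak, so a linear form on the
    Lie algebra need not be represented by a vector; both equations of motion are therefore compared
    after pairing with all right-invariant fields, and positivity turns vanishing pairings into
    vanishing vectors. Smoothness is tested along curves only, and c^oo-open sets need not be open;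
    so joint continuity of a two-parameter family, and openness in the plane of the set where it
    stays in a chart, are not given and have to be extracted from special curves. Finally, the
    lifted curve is smooth on [J] only and computations take place in one chart, whereas the
    calculus speaks of globally defined curves; curves are therefore reparametrized by cutoffs that
    are the identity near the time of interest and stay in the required open set, and all compared
    quantities depend on germs only. *)

Section LmodIdentities.
Context {R : comPzRingType} {V : lmodType R}.

Inductive lexp : Type :=
  | LAtom of nat | LZero | LAdd of lexp & lexp | LOpp of lexp | LScale of R & lexp.

Fixpoint leval (env : seq V) (e : lexp) : V :=
  match e with
  | LAtom i => nth 0 env i
  | LZero => 0
  | LAdd e1 e2 => leval env e1 + leval env e2
  | LOpp e => - leval env e
  | LScale a e => a *: leval env e
  end.

Fixpoint lcoef (e : lexp) (i : nat) : R :=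
  match e with
  | LAtom j => if Nat.eqb j i then 1 else 0
  | LZero => 0
  | LAdd e1 e2 => lcoef e1 i + lcoef e2 i
  | LOpp e => - lcoef e i
  | LScale a e => a * lcoef e i
  end.

(** A conjunction over the indices, with atoms compared by [Nat.eqb]: on concrete expressions [cbn]
    reduces it to finitely many identities between scalars. *)
Fixpoint same_lcoefs (e1 e2 : lexp) (n : nat) : Prop :=
  match n with
  | 0%N => True
  | n'.+1 => lcoef e1 n' = lcoef e2 n' /\ same_lcoefs e1 e2 n'
  end.

Lemma leval_lcoef env e :
  leval env e = \sum_(i < size env) lcoef e i *: nth 0 env i.
Proof.
elim: e => [j| |e1 IH1 e2 IH2|e IH|a e IH] /=; rewrite ?IH1 ?IH2 ?IH.
- have [ji|ij] := ltnP j (size env); last first.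
    rewrite nth_default // big1 // => i _.
    case: (PeanoNat.Nat.eqb_spec j i) => [ij'|]; last by rewrite scale0r.
    by move: (ltn_ord i); rewrite -ij' ltnNge ij.
  rewrite (bigD1 (Ordinal ji)) //= PeanoNat.Nat.eqb_refl scale1r big1 ?addr0 // => i.
  case: (PeanoNat.Nat.eqb_spec j i) => [ij'|]; last by rewrite scale0r.
  by case/eqP; exact: val_inj.
- by rewrite big1 // => i _; rewrite scale0r.
- by rewrite -big_split; apply: eq_bigr => i _; rewrite scalerDl.
- by rewrite -sumrN; apply: eq_bigr => i _; rewrite scaleNr.
- by rewrite scaler_sumr; apply: eq_bigr => i _; rewrite scalerA.
Qed.

Lemma leval_eq env e1 e2 : same_lcoefs e1 e2 (size env) -> leval env e1 = leval env e2.
Proof.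
move=> h; rewrite !leval_lcoef; apply: eq_bigr => i _; congr (_ *: _).
elim: (size env) h i => [_ []//|n IH /= [hn h] i].
have [in_|] := ltnP i n; first exact: (IH h (Ordinal in_)).
by move=> ni; have -> : i = n :> nat by apply/eqP; rewrite eqn_leq ni -ltnS ltn_ord.
Qed.

End LmodIdentities.

Ltac lmod_index x env :=
  lazymatch env with
  | x :: _ => constr:(0%N)
  | _ :: ?env' => let n := lmod_index x env' in constr:(S n)
  end.

Ltac lmod_atoms t env :=
  lazymatch t with
  | 0 => env
  | ?a + ?b => let env1 := lmod_atoms a env in lmod_atoms b env1
  | - ?a => lmod_atoms a env
  | ?r *: ?a => lmod_atoms a env
  | ?x => lazymatch env with
          | context [x :: _] => env
          | _ => constr:(x :: env)
          end
  end.

Ltac lmod_reify R t env :=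
  lazymatch t with
  | 0 => constr:(@LZero R)
  | ?a + ?b => let e1 := lmod_reify R a env in let e2 := lmod_reify R b env in
      constr:(@LAdd R e1 e2)
  | - ?a => let e := lmod_reify R a env in constr:(@LOpp R e)
  | ?r *: ?a => let e := lmod_reify R a env in constr:(@LScale R r e)
  | ?x => let n := lmod_index x env in constr:(@LAtom R n)
  end.

(* Proves an identity between module elements by comparing the coefficients of its atoms with
   [ring]; coefficient identities that need [field] are left to the user. *)
Ltac lmod_coefs R V :=
  lazymatch goal with
  | |- ?l = ?r =>
    let T := constr:(GRing.Lmodule.sort V) in
    let env1 := lmod_atoms l (@nil T) in
    let env := lmod_atoms r env1 in
    let e1 := lmod_reify R l env in
    let e2 := lmod_reify R r env in
    refine (@leval_eq R V env e1 e2 _);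
    cbn [same_lcoefs lcoef size Nat.eqb]; repeat (split; [try ring|]); try exact I
  end.

(** * Continuous seminorms *)

Section Seminorms.
Context {R : realType} {E : tvsType R}.

Definition cseminorm (p : E -> R) : Prop :=
  [/\ forall x y, p (x + y) <= p x + p y,
      forall a x, p (a *: x) = `|a| * p x &
      forall e, 0 < e -> \forall x \near (0 : E), p x < e].

(** A convex basic neighbourhood is intersected with its reflection; convexity makes its gauge
    subadditive, symmetry makes it even. *)
Lemma convex_nbhs0 (U : set E) : nbhs (0 : E) U ->
  exists B : set E, [/\ nbhs (0 : E) B, B `<=` U, (forall x, B x -> B (- x)) &
    forall x y t, B x -> B y -> 0 <= t <= 1 -> B (t *: x + (1 - t) *: y)].
Proof.
move=> U0; have [C Cconv [Copen /(_ 0 U U0) [B0 [CB0 B00] B0U]]] :=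
  @locally_convex R E.
have B0nbhs : nbhs (0 : E) B0 by apply: open_nbhs_nbhs; split => //; exact: Copen.
have conv x y t : B0 x -> B0 y -> 0 <= t <= 1 -> B0 (t *: x + (1 - t) *: y).
  move=> Bx By t01; have /set_mem := Cconv _ (mem_set CB0) x y (Itv01 (andP t01).1 (andP t01).2)
    (mem_set Bx) (mem_set By).
  by [].
exists (B0 `&` [set x | B0 (- x)]); split.
- apply: filterI => //; have := nbhs0N B0nbhs.
  by apply: filterS => x [y By <-] /=; rewrite opprK.
- by move=> x [/B0U].
- by move=> x [? ?]; split; rewrite /= ?opprK.
- move=> x y t [Bx Bx'] [By By'] t01; split; first exact: conv.
  by rewrite /= opprD -!scalerN; exact: conv.
Qed.

Section Gauge.
Variables (B : set E).
Hypotheses (B0 : nbhs (0 : E) B) (BN : forall x, B x -> B (- x)).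
Hypothesis Bconv :
  forall x y t, B x -> B y -> 0 <= t <= 1 -> B (t *: x + (1 - t) *: y).

Let radii (x : E) : set R := [set r | 0 < r /\ B (r^-1 *: x)].
(** The Minkowski functional of [B]. *)
Definition gauge (x : E) : R := inf (radii x).

Let B00 : B 0. Proof. exact: nbhs_singleton. Qed.

Let radii_neq0 x : radii x !=set0.
Proof.
have := @scale_continuous R E (0, x) B; rewrite /= scale0r => /(_ B0).
move=> [[A1 A2] /= [/nbhs_ballP[e /= e0 HA1] /nbhs_singleton HA2] H].
exists (e/2)^-1; split; first by rewrite invr_gt0 divr_gt0.
rewrite invrK; apply: (H (e / 2, x)); split=> //; apply: HA1;
  rewrite /= -ball_normE /= sub0r normrN ger0_norm; last exact/ltW/divr_gt0.
by rewrite ltr_pdivrMr // mulrDr mulr1 ltrDl.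
Qed.

Let radii_lb x : has_lbound (radii x).
Proof. by exists 0 => r [/ltW]. Qed.

Let radii_up x r s : radii x r -> r <= s -> radii x s.
Proof.
move=> [r0 Br] rs; have s0 := lt_le_trans r0 rs; split=> //.
have -> : s^-1 *: x = (r / s) *: (r^-1 *: x) + (1 - r / s) *: 0.
  by rewrite scaler0 addr0 scalerA; congr (_ *: _); field; rewrite !gt_eqF.
apply: Bconv => //; rewrite divr_ge0 ?(ltW r0) ?(ltW s0) //=.
by rewrite ler_pdivrMr ?mul1r.
Qed.

Let gauge_lt x r : gauge x < r -> radii x r.
Proof.
by move=> h; have [s rs sr] := inf_lt (radii_neq0 x) h; apply: radii_up rs (ltW sr).
Qed.

Let gauge_le x r : radii x r -> gauge x <= r.
Proof. by move=> h; exact: ge_inf. Qed.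

Lemma gauge_lt1 x : gauge x < 1 -> B x.
Proof. by move=> /gauge_lt [_]; rewrite invr1 scale1r. Qed.

Let gauge_ge0 x : 0 <= gauge x.
Proof. by apply: lb_le_inf => // r [/ltW]. Qed.

Let gaugeD x y : gauge (x + y) <= gauge x + gauge y.
Proof.
apply/ler_addgt0Pr => e e0.
have e2 : 0 < e / 2 by rewrite divr_gt0.
have [] : radii x (gauge x + e / 2) by apply: gauge_lt; rewrite ltrDl.
have [] : radii y (gauge y + e / 2) by apply: gauge_lt; rewrite ltrDl.
set r := gauge x + _; set s := gauge y + _ => s0 Bs r0 Br.
have -> : gauge x + gauge y + e = r + s by rewrite /r /s; lra.
apply: gauge_le; split; first exact: addr_gt0.
have -> : (r + s)^-1 *: (x + y) = (r / (r + s)) *: (r^-1 *: x) + (1 - r / (r + s)) *: (s^-1 *: y).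
  have rs : r + s != 0 by rewrite gt_eqF // addr_gt0.
  rewrite scalerDr !scalerA; congr (_ *: _ + _ *: _); field; rewrite ?rs ?gt_eqF //.
apply: Bconv => //; rewrite divr_ge0 ?(ltW r0) ?(ltW (addr_gt0 r0 s0)) //=.
by rewrite ler_pdivrMr ?(addr_gt0 r0 s0) // mul1r lerDl ltW.
Qed.

Let gaugeN x : gauge (- x) = gauge x.
Proof.
rewrite /gauge; congr inf; apply/seteqP; split=> r [r0]; rewrite ?scalerN => h; split => //.
  by rewrite -[_ *: _]opprK; exact: BN.
by rewrite scalerN; exact: BN.
Qed.

Let gaugeZ_le a x : 0 < a -> gauge (a *: x) <= a * gauge x.
Proof.
move=> a0; rewrite mulrC -ler_pdivrMr //; apply: lb_le_inf => // r [r0 Br].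
rewrite ler_pdivrMr //; apply: gauge_le; split; first exact: mulr_gt0.
rewrite scalerA; suff -> : (r * a)^-1 * a = r^-1 by [].
by field; rewrite !gt_eqF.
Qed.

Let gauge0 : gauge 0 = 0.
Proof.
apply/eqP; rewrite eq_le gauge_ge0 andbT; apply/ler_addgt0Pr => e e0; rewrite add0r.
by apply: gauge_le; split=> //; rewrite scaler0.
Qed.

Lemma gauge_cseminorm : cseminorm gauge.
Proof.
split; first exact: gaugeD.
- move=> a x.
  have pos b y : 0 < b -> gauge (b *: y) = b * gauge y.
    move=> b0; apply/eqP; rewrite eq_le gaugeZ_le //=.
    have := gaugeZ_le (b *: y) (a := b^-1); rewrite invr_gt0 => /(_ b0).
    by rewrite scalerA mulVf ?gt_eqF // scale1r ler_pdivlMl.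
  have [a0|a0|->] := ltgtP a 0.
  + by rewrite ltr0_norm // -(pos (- a)) ?oppr_gt0 // scaleNr gaugeN.
  + by rewrite gtr0_norm // pos.
  + by rewrite scale0r gauge0 normr0 mul0r.
- move=> e e0; have e2 : 0 < e / 2 by rewrite divr_gt0.
  have := nbhs0Z (lt0r_neq0 e2) B0; apply: filterS => x [y By <-].
  apply: (@le_lt_trans _ _ (e/2)); last lra.
  apply: gauge_le; split=> //.
  by rewrite scalerA mulVf ?gt_eqF // scale1r.
Qed.

End Gauge.

Lemma cseminorm_nbhs0 (U : set E) : nbhs (0 : E) U ->
  exists2 p, cseminorm p & forall x, p x < 1 -> U x.
Proof.
move=> /convex_nbhs0[B [B0 BU BN Bconv]]; exists (gauge B).
  exact: gauge_cseminorm.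
by move=> x /gauge_lt1 - /(_ B0 Bconv)/BU.
Qed.

Lemma cseminorm0 p : cseminorm p -> p 0 = 0.
Proof. by case=> _ h _; rewrite -(scale0r 0) h normr0 mul0r. Qed.

Lemma cseminormN p x : cseminorm p -> p (- x) = p x.
Proof. by case=> _ h _; rewrite -scaleN1r h normrN normr1 mul1r. Qed.

Lemma cseminormB p x y : cseminorm p -> p (x - y) = p (y - x).
Proof. by move=> sp; rewrite -(cseminormN _ sp) opprB. Qed.

Lemma cseminorm_ge0 p x : cseminorm p -> 0 <= p x.
Proof.
move=> sp; have [D _ _] := sp; have := D x (- x).
by rewrite subrr cseminorm0 // cseminormN //; lra.
Qed.

Lemma cseminormD p x y : cseminorm p -> p (x + y) <= p x + p y.
Proof. by case. Qed.

Lemma cseminormZ p a x : cseminorm p -> p (a *: x) = `|a| * p x.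
Proof. by case. Qed.

Lemma cseminormZ_le p a x m k : cseminorm p -> `|a| <= m -> p x <= k ->
  p (a *: x) <= m * k.
Proof.
by move=> sp am xk; rewrite cseminormZ //; apply: ler_pM => //; exact: cseminorm_ge0.
Qed.

Lemma cseminormD_le p x y m k : cseminorm p -> p x <= m -> p y <= k ->
  p (x + y) <= m + k.
Proof. by move=> sp xm yk; rewrite (le_trans (cseminormD _ _ sp)) // lerD. Qed.

Lemma cseminorm_sum p (I : Type) (r : seq I) (F : I -> E) : cseminorm p ->
  p (\sum_(i <- r) F i) <= \sum_(i <- r) p (F i).
Proof.
move=> sp; elim: r => [|i r IH]; first by rewrite !big_nil cseminorm0.
by rewrite !big_cons (le_trans (cseminormD _ _ sp)) // lerD2l.
Qed.

Lemma cseminorm_near p (l : E) e : cseminorm p -> 0 < e ->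
  \forall x \near l, p (x - l) < e.
Proof.
move=> [_ _ c] e0; have := nbhsT l (c e e0); apply: filterS => x [y py <-].
by rewrite [X in p X](_ : _ = y) // addrAC subrr add0r.
Qed.

(** Gauges of convex neighbourhoods generate the topology. From here on limits in locally convex
    spaces are handled by epsilon estimates, one seminorm at a time. *)
Lemma cvg_cseminormP {T : Type} (F : set_system T) {FF : Filter F} (f : T -> E) l :
  f x @[x --> F] --> l <->
  forall p e, cseminorm p -> 0 < e -> \forall x \near F, p (f x - l) < e.
Proof.
split=> [fl p e sp e0|H].
  exact: (fl _ (cseminorm_near l sp e0)).
move=> U Ul; have Ul0 : nbhs (0 : E) [set x | U (l + x)].
  have := nbhsB (- l) Ul; rewrite addNr; apply: filterS => x [y Uy <-] /=.
  by rewrite addrA subrr add0r.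
have [p sp pU] := cseminorm_nbhs0 Ul0.
have := H p 1 sp ltr01; rewrite near_map /=; apply: filterS => x /pU /=.
by rewrite addrC subrK.
Qed.

(** A vector on which all continuous seminorms vanish lies in every neighbourhood of 0. Equalities
    of vectors are derived from estimates in this way. *)
Lemma hausdorff_cseminorm (x : E) : hausdorff_space E ->
  (forall p, cseminorm p -> p x = 0) -> x = 0.
Proof.
move=> hE hx; apply: hE => U V Ux V0.
have [p sp pV] := cseminorm_nbhs0 V0.
exists x; split; last by apply: pV; rewrite hx.
exact: nbhs_singleton.
Qed.

End Seminorms.

Lemma norm_cseminorm {R : realType} : cseminorm (fun x : R^o => `|x|).
Proof.
split=> [x y|a x|e e0]; [exact: ler_normD|exact: normrM|].
have := @cvgr0_norm_lt R R^o _ (nbhs (0:R^o)) _ id; apply => //; exact: cvg_id.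
Qed.

(** * Derivatives of curves *)

Section Cderive.
Context {R : realType}.
Implicit Types E F : tvsType R.

Lemma near0P (P : R -> Prop) :
  (\forall h \near (0 : R), P h) <-> exists2 d, 0 < d & forall h, `|h| < d -> P h.
Proof.
split.
  move=> /nbhs_ballP[d /= d0 H]; exists d => // h hd; apply: H.
  by rewrite /= -ball_normE /= sub0r normrN.
move=> [d d0 H]; apply/nbhs_ballP; exists d => //= h.
by rewrite /= -ball_normE /= sub0r normrN; exact: H.
Qed.

(** With the difference quotient multiplied out, h = 0 is admissible (both sides vanish) and error
    terms can be added without dividing by h. *)
Lemma is_cderiveP E (c : R -> E) t v : is_cderive c t v <->
  forall p e, cseminorm p -> 0 < e -> exists2 d, 0 < d &
    forall h, `|h| < d -> p (c (t + h) - c t - h *: v) <= e * `|h|.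
Proof.
rewrite /is_cderive cvg_cseminormP; split => H p e sp e0.
  have /near0P[d d0 Hd] := H p e sp e0; exists d => // h hd.
  have [->|hN0] := eqVneq h 0.
    by rewrite addr0 subrr scale0r subrr normr0 mulr0 cseminorm0.
  have := Hd h hd hN0; rewrite /= /diff_quotient.
  have -> : c (t + h) - c t - h *: v = h *: (h^-1 *: (c (h + t) - c t) - v).
    by rewrite scalerBr scalerA divff // scale1r [t + h]addrC.
  rewrite cseminormZ // mulrC => /ltW h'.
  by rewrite ler_wpM2r.
have e2 : 0 < e / 2 by lra.
have [d d0 Hd] := H p _ sp e2; apply/near0P; exists d => // h hd hN0.
have := Hd h hd; rewrite /diff_quotient.
have -> : c (t + h) - c t - h *: v = h *: (h^-1 *: (c (h + t) - c t) - v).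
  by rewrite scalerBr scalerA divff // scale1r [t + h]addrC.
rewrite cseminormZ // mulrC ler_pM2r ?normr_gt0 //; lra.
Qed.

Lemma is_cderive_unique E (c : R -> E) t v w : hausdorff_space E ->
  is_cderive c t v -> is_cderive c t w -> v = w.
Proof.
move=> hE; apply: cvg_unique => //.
Qed.

Lemma cderive_val E (c : R -> E) t v : hausdorff_space E ->
  is_cderive c t v -> cderive c t = v.
Proof.
move=> hE cv; rewrite /cderive; case: xgetP => [w _ /= cw|/(_ v)//].
exact: is_cderive_unique cw cv.
Qed.

Lemma is_cderive_cderive E (c : R -> E) t v :
  is_cderive c t v -> is_cderive c t (cderive c t).
Proof.
by move=> cv; rewrite /cderive; case: xgetP => [w _ //|/(_ v)].
Qed.

Lemma is_cderive_near E (c d : R -> E) t v : (\forall s \near t, c s = d s) ->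
  is_cderive c t v -> is_cderive d t v.
Proof.
move=> cd /is_cderiveP cv; apply/is_cderiveP => p e sp e0.
have [r r0 H] := cv p e sp e0.
move/nbhs_ballP: cd => [r' /= r'0 cd].
exists (Num.min r r') => [|h]; first by rewrite lt_min r0.
rewrite lt_min => /andP[hr hr'].
rewrite -!cd; [exact: H|exact: ballxx|].
by rewrite -ball_normE /= opprD addrA subrr sub0r normrN.
Qed.

Lemma is_cderive_ext E (c d : R -> E) t v : (forall s, c s = d s) ->
  is_cderive c t v -> is_cderive d t v.
Proof. by move=> /funext ->. Qed.

Lemma eq_cderive E (c d : R -> E) t : (forall s, c s = d s) -> cderive c t = cderive d t.
Proof. by move=> /funext ->. Qed.

Lemma is_cderive_eq E (c : R -> E) t v w : is_cderive c t v -> v = w -> is_cderive c t w.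
Proof. by move=> ? <-. Qed.

Lemma is_cderive_cst E (x : E) t : is_cderive (fun=> x) t 0.
Proof.
apply/is_cderiveP => p e sp e0; exists 1 => // h _.
by rewrite subrr scaler0 subrr cseminorm0 // mulr_ge0 // ltW.
Qed.

Lemma is_cderive_id t : @is_cderive R R^o id t 1.
Proof.
apply/is_cderiveP => p e sp e0; exists 1 => // h _.
rewrite /= [X in p X](_ : _ = 0) ?cseminorm0 // ?mulr_ge0 // ?ltW //.
by rewrite /GRing.scale /= mulr1; ring.
Qed.

Lemma is_cderive_affine (a b t : R) : @is_cderive R R^o (fun s => a * s + b) t a.
Proof.
apply/is_cderiveP => p e sp e0; exists 1 => // h _.
rewrite /= [X in p X](_ : _ = 0) ?cseminorm0 // ?mulr_ge0 // ?ltW //.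
by rewrite /GRing.scale /=; ring.
Qed.

Lemma is_cderiveD E (c d : R -> E) t v w : is_cderive c t v -> is_cderive d t w ->
  is_cderive (fun s => c s + d s) t (v + w).
Proof.
move=> /is_cderiveP cv /is_cderiveP dw; apply/is_cderiveP => p e sp e0.
have e2 : 0 < e / 2 by lra.
have [r r0 H] := cv p _ sp e2; have [r' r'0 H'] := dw p _ sp e2.
exists (Num.min r r') => [|h]; first by rewrite lt_min r0.
rewrite lt_min => /andP[/H hr /H' hr'].
have -> : c (t + h) + d (t + h) - (c t + d t) - h *: (v + w) =
  (c (t + h) - c t - h *: v) + (d (t + h) - d t - h *: w).
  by lmod_coefs R E.
by apply: le_trans (cseminormD _ _ sp) _; lra.
Qed.

Lemma is_cderive_cont E (c : R -> E) t v p e : is_cderive c t v -> cseminorm p -> 0 < e ->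
  exists2 d, 0 < d & forall h, `|h| < d -> p (c (t + h) - c t) <= e.
Proof.
move=> /is_cderiveP cv sp e0; have [r r0 H] := cv p _ sp ltr01.
have pv := cseminorm_ge0 v sp.
exists (Num.min r (e / (1 + p v))) => [|h].
  by rewrite lt_min r0 /= divr_gt0 //; lra.
rewrite lt_min => /andP[/H hr]; rewrite ltr_pdivlMr; last lra.
move=> he; rewrite -[X in p X](subrK (h *: v)).
apply: le_trans (cseminormD _ _ sp) _; rewrite cseminormZ //; lra.
Qed.

Lemma is_cderiveZ E (a : R -> R^o) (c : R -> E) t (a' : R) v : is_cderive a t a' ->
  is_cderive c t v ->
  is_cderive (fun s => a s *: c s) t (a' *: c t + a t *: v).
Proof.
move=> Ha cv; apply/is_cderiveP => p e sp e0.
have pv := cseminorm_ge0 v sp; have pc := cseminorm_ge0 (c t) sp.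
have Na : 0 <= `|a t| by [].
(* The three error terms below are at most e / M * |h| times 1 + |a t|, p (c t) and p v; [M]
   dominates the sum of these factors. *)
pose M := 3 * (1 + `|a t| + p v + p (c t)).
have M0 : 0 < M by rewrite /M; lra.
have eM : 0 < e / M by rewrite divr_gt0.
have M1 : 0 < Num.min 1 (e / M) by rewrite lt_min ltr01.
have [d1 d10 H1] := is_cderive_cont Ha norm_cseminorm M1.
have [d2 d20 H2] := (is_cderiveP _ _ _).1 Ha _ _ norm_cseminorm eM.
have [d3 d30 H3] := (is_cderiveP _ _ _).1 cv _ _ sp eM.
exists (Num.min d1 (Num.min d2 d3)) => [|h]; first by rewrite !lt_min d10 d20 d30.
rewrite !lt_min => /andP[/H1 h1 /andP[/H2 h2 /H3 h3]].
move: h1; rewrite /= le_min => /andP[h1 h1'].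
have -> : a (t + h) *: c (t + h) - a t *: c t - h *: (a' *: c t + a t *: v) =
  a (t + h) *: (c (t + h) - c t - h *: v) + (a (t + h) - a t - h *: (a' : R^o)) *: c t
  + (h * (a (t + h) - a t)) *: v.
  have key (x y : R) (C D : E) : x *: C - y *: D - h *: (a' *: D + y *: v) =
      x *: (C - D - h *: v) + (x - y - h * a') *: D + (h * (x - y)) *: v.
    by lmod_coefs R E.
  exact: (key (a (t + h)) (a t)).
have h4 : `|a (t + h)| <= 1 + `|a t|.
  by rewrite -[a (t + h)](subrK (a t)) (le_trans (ler_normD _ _)) // lerD2r.
apply: (@le_trans _ _ ((1 + `|a t|) * (e / M * `|h|) + e / M * `|h| * p (c t)
  + `|h| * (e / M) * p v)).
  apply: cseminormD_le => //; first apply: cseminormD_le => //.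
  - exact: cseminormZ_le.
  - exact: cseminormZ_le.
  - apply: cseminormZ_le => //; rewrite normrM ler_wpM2l //.
have -> : (1 + `|a t|) * (e / M * `|h|) + e / M * `|h| * p (c t) + `|h| * (e / M) * p v
  = (e / M * `|h|) * (1 + `|a t| + p v + p (c t)) by ring.
rewrite mulrAC; apply: ler_wpM2r => //; rewrite mulrAC ler_pdivrMr //.
by rewrite ler_wpM2l // ?ltW // /M; lra.
Qed.

Lemma is_cderive_cstZ E (a : R) (c : R -> E) t v : is_cderive c t v ->
  is_cderive (fun s => a *: c s) t (a *: v).
Proof.
move=> cv; apply: is_cderive_eq (is_cderiveZ (is_cderive_cst (a : R^o) t) cv) _.
by rewrite scale0r add0r.
Qed.

Arguments is_cderive_cstZ {E} a {c t v} _.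

Lemma is_cderiveN E (c : R -> E) t v : is_cderive c t v -> is_cderive (fun s => - c s) t (- v).
Proof.
move=> /(is_cderive_cstZ (-1)); rewrite scaleN1r; apply: is_cderive_ext => s.
by rewrite scaleN1r.
Qed.

Lemma is_cderiveB E (c d : R -> E) t v w : is_cderive c t v -> is_cderive d t w ->
  is_cderive (fun s => c s - d s) t (v - w).
Proof. by move=> cv /is_cderiveN; exact: is_cderiveD. Qed.

Lemma is_cderive_sum E (I : Type) (r : seq I) (c : I -> R -> E) (v : I -> E) t :
  (forall i, is_cderive (c i) t (v i)) ->
  is_cderive (fun s => \sum_(i <- r) c i s) t (\sum_(i <- r) v i).
Proof.
move=> H; elim: r => [|i r IH].
  rewrite big_nil; apply: is_cderive_ext (is_cderive_cst 0 t) => s.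
  by rewrite big_nil.
rewrite big_cons; apply: is_cderive_ext (is_cderiveD (H i) IH) => s.
by rewrite big_cons.
Qed.

Lemma is_cderive_comp E (c : R -> E) (f : R -> R^o) t (f' : R) v :
  is_cderive f t f' -> is_cderive c (f t) v ->
  is_cderive (fun s => c (f s)) t (f' *: v).
Proof.
move=> Hf cv; apply/is_cderiveP => p e sp e0.
have pv := cseminorm_ge0 v sp.
pose M := 2 + p v + `|f'|.
have Nf : 0 <= `|f'| by [].
have M0 : 0 < M by rewrite /M; lra.
have eM : 0 < e / M by rewrite divr_gt0.
have [d1 d10 H1] := (is_cderiveP _ _ _).1 cv _ _ sp eM.
have d12 : 0 < d1 / 2 by lra.
have [d2 d20 H2] := is_cderive_cont Hf norm_cseminorm d12.
have m0 : 0 < Num.min 1 (e / M) by rewrite lt_min ltr01.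
have [d3 d30 H3] := (is_cderiveP _ _ _).1 Hf _ _ norm_cseminorm m0.
exists (Num.min d2 d3) => [|h]; first by rewrite !lt_min d20.
rewrite !lt_min => /andP[/H2 h2 /H3 h3].
have h3a : `|f (t + h) - f t - h *: (f' : R^o)| <= `|h|.
  by apply: le_trans h3 _; rewrite ler_piMl // ge_min lexx.
have h3b : `|f (t + h) - f t - h *: (f' : R^o)| <= e / M * `|h|.
  by apply: le_trans h3 _; rewrite ler_wpM2r // ge_min lexx orbT.
set k := f (t + h) - f t in h2 h3a h3b.
have kd1 : `|k| < d1 by apply: le_lt_trans h2 _; lra.
have := H1 k kd1; rewrite {1}/k [f t + _]addrC subrK => h1.
have kh : `|k| <= (1 + `|f'|) * `|h|.
  rewrite -(subrK (h *: (f' : R^o)) k); apply: le_trans (ler_normD _ _) _.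
  by rewrite /GRing.scale /= normrM in h3a *; rewrite mulrDl mul1r mulrC [`|f'| * _]mulrC lerD
    // mulrC.
have -> : c (f (t + h)) - c (f t) - h *: (f' *: v) =
  (c (f (t + h)) - c (f t) - k *: v) + (k - h * f') *: v.
  by lmod_coefs R E.
apply: le_trans (cseminormD _ _ sp) _; rewrite cseminormZ //.
apply: (@le_trans _ _ (e / M * ((1 + `|f'|) * `|h|) + e / M * `|h| * p v)).
  apply: lerD; last by apply: ler_pM.
  by apply: le_trans h1 _; rewrite ler_wpM2l // ltW.
have -> : e / M * ((1 + `|f'|) * `|h|) + e / M * `|h| * p v =
  (e / M * (1 + `|f'| + p v)) * `|h| by ring.
apply: ler_wpM2r => //; rewrite mulrAC ler_pdivrMr // ler_wpM2l ?ltW // /M; lra.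
Qed.

Lemma is_cderive_shift E (c : R -> E) s t v : is_cderive c (s + t) v ->
  is_cderive (fun r => c (s + r)) t v.
Proof.
move=> /is_cderiveP cv; apply/is_cderiveP => p e sp e0.
by have [r r0 H] := cv p _ sp e0; exists r => // h hr; rewrite addrA; exact: H.
Qed.

(* The last time up to which the bound holds with a slightly larger constant can only be [b]. *)
Lemma mean_value E (c c' : R -> E) p (a b M : R) : cseminorm p -> a <= b ->
  (forall t, a <= t <= b -> is_cderive c t (c' t)) ->
  (forall t, a <= t <= b -> p (c' t) <= M) ->
  p (c b - c a) <= M * (b - a).
Proof.
move=> sp ab cc' c'M.
apply/ler_addgt0Pr => e e0.
rewrite leNgt; apply/negP => bad.
(* The slack is such that N (b - a) <= M (b - a) + e, also when a = b. *)
pose N := M + e / (1 + (b - a)).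
have N1 : M < N by rewrite /N ltrDl divr_gt0 //; lra.
have {}bad : N * (b - a) < p (c b - c a).
  apply: le_lt_trans bad; rewrite /N mulrDl lerD2l mulrAC ler_pdivrMr; last lra.
  by rewrite ler_wpM2l //; [exact: ltW|lra].
pose S := [set t | a <= t <= b /\ p (c t - c a) <= N * (t - a)].
have M0 : 0 <= M by apply: le_trans (c'M a _); [exact: cseminorm_ge0|rewrite lexx].
have Sa : S a by split; rewrite ?lexx // !subrr mulr0 cseminorm0.
have ubS : ubound S b by move=> t [/andP[]].
have supS : has_sup S by split; [exists a|exists b].
pose s := sup S.
have sab : a <= s <= b.
  by rewrite /s (ub_le_sup (ex_intro _ b ubS) Sa) /= ge_sup //; exists a.
have eN : 0 < N - M by lra.
have [d d0 Hd] := (is_cderiveP _ _ _).1 (cc' s sab) p _ sp eN.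
(* Used backwards, this puts the supremum [s] itself into [S]; used forwards, it leads past [s],
   which is absurd if s < b. *)
have step h : `|h| < d -> p (c (s + h) - c s) <= N * `|h|.
  move=> hd; rewrite -[X in p X](subrK (h *: c' s)).
  apply: le_trans (cseminormD _ _ sp) _; rewrite cseminormZ //.
  have := Hd h hd; have : `|h| * p (c' s) <= M * `|h|.
    by rewrite mulrC ler_wpM2r // c'M.
  lra.
have Ss : S s.
  split => //.
  have [t St ts] := sup_adherent d0 supS; have [/andP[at_ _] pt] := St.
  have tles : t <= s by apply: ub_le_sup => //; exists b.
  have hd : `|t - s| < d by rewrite ler0_norm ?subr_le0 //; rewrite -/s in ts; lra.
  have := step _ hd; rewrite [s + _]addrC subrK ler0_norm ?subr_le0 // => h1.
  have -> : c s - c a = (c s - c t) + (c t - c a) by rewrite addrA subrK.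
  apply: le_trans (cseminormD _ _ sp) _; rewrite (cseminormB (c s)) //; lra.
have sb : s < b.
  rewrite lt_neqAle (andP sab).2 andbT; apply/eqP => sb.
  by have [_] := Ss; rewrite sb leNgt bad.
pose h := Num.min (d / 2) (b - s).
have h0 : 0 < h by rewrite /h lt_min; apply/andP; split; lra.
have hd : `|h| < d by rewrite gtr0_norm // /h gt_min; apply/orP; left; lra.
have hb : h <= b - s by rewrite /h ge_min lexx orbT.
have : S (s + h).
  have [/andP[as_ _] ps] := Ss.
  split; first by apply/andP; split; lra.
  have -> : c (s + h) - c a = (c (s + h) - c s) + (c s - c a) by rewrite addrA subrK.
  apply: le_trans (cseminormD _ _ sp) _.
  by have := step h hd; rewrite gtr0_norm //; lra.
move=> /(ub_le_sup (ex_intro _ b ubS)); rewrite -/s; lra.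
Qed.

Lemma mean_value_abs E (c c' : R -> E) p (a b M : R) : cseminorm p ->
  (forall t, `|t - a| <= `|b - a| -> is_cderive c t (c' t)) ->
  (forall t, `|t - a| <= `|b - a| -> p (c' t) <= M) ->
  p (c b - c a) <= M * `|b - a|.
Proof.
move=> sp cc' c'M; have [ab|ba] := leP a b.
  rewrite ger0_norm ?subr_ge0 //; apply: (@mean_value _ _ c' p) => // t /andP[h1 h2].
    by apply: cc'; rewrite !ger0_norm ?subr_ge0 //; lra.
  by apply: c'M; rewrite !ger0_norm ?subr_ge0 //; lra.
rewrite ltr0_norm ?subr_lt0 // opprB cseminormB //.
apply: (@mean_value _ _ c' p) => // [|t /andP[h1 h2]|t /andP[h1 h2]]; first exact: ltW.
  by apply: cc'; rewrite !ler0_norm ?subr_le0 //; lra.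
by apply: c'M; rewrite !ler0_norm ?subr_le0 //; lra.
Qed.

End Cderive.

Arguments is_cderive_cstZ {R E} a {c t v} _.

(** * Smooth curves and bump functions *)

Section Smooth.
Context {R : realType}.
Implicit Types (E F : tvsType R) (V W : set R) (n : nat).

Lemma realo_hausdorff : hausdorff_space R^o.
Proof. exact: Rhausdorff. Qed.

(** Derivatives are given by witnesses instead of iterating the choice function [cderive], so that
    the rules of calculus follow from their first-order versions by induction on [n]. *)
Fixpoint cdiff E n V (c : R -> E) : Prop :=
  if n is n'.+1 then
    exists2 c', (forall t, V t -> is_cderive c t (c' t)) & cdiff n' V c'
  else True.

Definition csmooth E V (c : R -> E) : Prop := forall n, cdiff n V c.

Lemma cdiff_eq E n V (c d : R -> E) : open V -> (forall t, V t -> c t = d t) ->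
  cdiff n V c -> cdiff n V d.
Proof.
move=> oV cd; case: n => // n [c' cc' c'n]; exists c' => // t Vt.
apply: is_cderive_near (cc' t Vt).
have : nbhs t V by apply: open_nbhs_nbhs.
by apply: filterS.
Qed.

Lemma cdiff_sub E n V W (c : R -> E) : W `<=` V -> cdiff n V c -> cdiff n W c.
Proof.
move=> WV; elim: n c => // n IH c [c' cc' /IH c'n]; exists c' => // t /WV; exact: cc'.
Qed.

Lemma cdiffS E n V (c : R -> E) : cdiff n.+1 V c -> cdiff n V c.
Proof.
elim: n c => // n IH c [c' cc' c'n]; exists c' => //; exact: IH.
Qed.

Lemma csmooth_eq E V (c d : R -> E) : open V -> (forall t, V t -> c t = d t) ->
  csmooth V c -> csmooth V d.
Proof. by move=> oV cd H n; exact: cdiff_eq (H n). Qed.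

Lemma csmooth_sub E V W (c : R -> E) : W `<=` V -> csmooth V c -> csmooth W c.
Proof. by move=> WV H n; exact: cdiff_sub (H n). Qed.

Lemma csmooth_cderive_at E V (c : R -> E) t : csmooth V c -> V t ->
  is_cderive c t (cderive c t).
Proof. by move=> /(_ 1)[c' cc' _] /cc'; exact: is_cderive_cderive. Qed.

Lemma csmooth_cderive E V (c : R -> E) : hausdorff_space E -> open V ->
  csmooth V c -> csmooth V (cderive c).
Proof.
move=> hE oV cs n; have [c' cc' c'n] := cs n.+1.
by apply: cdiff_eq c'n => // t Vt; rewrite (cderive_val hE (cc' t Vt)).
Qed.

Lemma csmooth_iter E V (c : R -> E) n : hausdorff_space E -> open V ->
  csmooth V c -> csmooth V (iter n (@cderive _ E) c).
Proof.
by move=> hE oV cs; elim: n => //= n IH; exact: csmooth_cderive.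
Qed.

Lemma smooth_curve_onP E V (c : R -> E) : hausdorff_space E -> open V ->
  smooth_curve_on V c <-> csmooth V c.
Proof.
move=> hE oV; split => [H n|H n t Vt]; last first.
  exists (cderive (iter n (@cderive _ E) c) t).
  by apply: csmooth_cderive_at (Vt); exact: csmooth_iter.
suff : cdiff n V (iter 0 (@cderive _ E) c) by [].
elim: n 0%N => // n IH k; exists (iter k.+1 (@cderive _ E) c) => //.
by move=> t Vt; have [v] := H k t Vt; exact: is_cderive_cderive.
Qed.

Lemma smooth_curveP E (c : R -> E) : hausdorff_space E ->
  smooth_curve c <-> csmooth setT c.
Proof. by move=> hE; apply: smooth_curve_onP => //; exact: openT. Qed.

Lemma cdiffD E n V (c d : R -> E) : cdiff n V c -> cdiff n V d ->
  cdiff n V (fun t => c t + d t).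
Proof.
elim: n c d => // n IH c d [c' cc' c'n] [d' dd' d'n].
exists (fun t => c' t + d' t) => [t Vt|]; last exact: IH.
by apply: is_cderiveD; [exact: cc'|exact: dd'].
Qed.

Lemma cdiffZ E n V (a : R -> R^o) (c : R -> E) : cdiff n V a -> cdiff n V c ->
  cdiff n V (fun t => a t *: c t).
Proof.
elim: n a c => // n IH a c an cn; have [a' aa' a'n] := an; have [c' cc' c'n] := cn.
exists (fun t => a' t *: c t + a t *: c' t) => [t Vt|]; last first.
  by apply: cdiffD; apply: IH => //; exact: cdiffS.
by apply: is_cderiveZ; [exact: aa'|exact: cc'].
Qed.

Lemma cdiff_cst E n V (x : E) : cdiff n V (fun=> x).
Proof. by elim: n x => // n IH x; exists (fun=> 0) => // t _; exact: is_cderive_cst. Qed.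

Lemma cdiff_id n V : @cdiff R^o n V id.
Proof.
case: n => // n; exists (fun=> 1) => [t _|]; [exact: is_cderive_id|exact: cdiff_cst].
Qed.

Lemma cdiff_comp E n V W (c : R -> E) (f : R -> R^o) : (forall t, V t -> W (f t)) ->
  cdiff n W c -> cdiff n V f -> cdiff n V (fun t => c (f t)).
Proof.
move=> VW; elim: n c => // n IH c cn fn; have [c' cc' c'n] := cn; have [f' ff' f'n] := fn.
exists (fun t => f' t *: c' (f t)) => [t Vt|].
  by apply: is_cderive_comp; [exact: ff'|exact/cc'/VW].
by apply: cdiffZ => //; apply: IH => //; exact: cdiffS.
Qed.

Lemma csmoothD E V (c d : R -> E) : csmooth V c -> csmooth V d ->
  csmooth V (fun t => c t + d t).
Proof. by move=> H H' n; exact: cdiffD. Qed.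

Lemma csmoothZ E V (a : R -> R^o) (c : R -> E) : csmooth V a -> csmooth V c ->
  csmooth V (fun t => a t *: c t).
Proof. by move=> H H' n; exact: cdiffZ. Qed.

Lemma csmooth_cst E V (x : E) : csmooth V (fun=> x).
Proof. by move=> n; exact: cdiff_cst. Qed.

Lemma csmooth_id V : @csmooth R^o V id.
Proof. by move=> n; exact: cdiff_id. Qed.

Lemma csmooth_comp E V W (c : R -> E) (f : R -> R^o) : (forall t, V t -> W (f t)) ->
  csmooth W c -> csmooth V f -> csmooth V (fun t => c (f t)).
Proof. by move=> H Hc Hf n; apply: cdiff_comp => //. Qed.

Lemma csmooth_cstZ E V (a : R) (c : R -> E) : csmooth V c ->
  csmooth V (fun t => a *: c t).
Proof. by move=> H; apply: csmoothZ => //; exact: (@csmooth_cst R^o). Qed.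

Arguments csmooth_cstZ {E V} a {c} _.

Lemma csmoothN E V (c : R -> E) : csmooth V c -> csmooth V (fun t => - c t).
Proof.
move=> /(csmooth_cstZ (-1)); congr csmooth; apply/funext => t; exact: scaleN1r.
Qed.

Lemma csmoothB E V (c d : R -> E) : csmooth V c -> csmooth V d ->
  csmooth V (fun t => c t - d t).
Proof. by move=> H /csmoothN; exact: csmoothD. Qed.

Lemma csmooth_sum E V (I : Type) (r : seq I) (c : I -> R -> E) :
  (forall i, csmooth V (c i)) -> csmooth V (fun t => \sum_(i <- r) c i t).
Proof.
move=> H; elim: r => [|i r IH].
  by have -> : (fun t => \sum_(i <- [::]) c i t) = (fun=> 0); [apply/funext => t;
    rewrite big_nil|exact: csmooth_cst].
have -> : (fun t => \sum_(j <- i :: r) c j t) = (fun t => c i t + \sum_(j <- r) c j t).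
  by apply/funext => t; rewrite big_cons.
exact: csmoothD.
Qed.

Lemma csmoothM V (a b : R -> R^o) : csmooth V a -> csmooth V b ->
  csmooth V (fun t => a t * b t : R^o).
Proof. exact: csmoothZ. Qed.

Lemma is_derive_is_cderive (f : R -> R^o) t (df : R^o) :
  is_derive (t : R^o) (1 : R^o) (f : R^o -> R^o) df -> is_cderive f t df.
Proof.
move=> [fd <-]; have : cvg (h^-1 *: ((f \o shift t) (h *: (1 : R^o)) - f t) @[h --> (0:R)^'])
  by exact: fd.
move=> /cvg_ex[l fl]; rewrite /derive.
rewrite (cvg_lim realo_hausdorff fl).
have e : diff_quotient f t = (fun h => h^-1 *: ((f \o shift t) (h *: (1 : R^o)) - f t)).
  by apply/funext => h /=; rewrite /diff_quotient /GRing.scale /= mulr1.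
by rewrite /is_cderive e.
Qed.

Lemma is_cderive_inv t : t != 0 -> is_cderive (fun x : R => x^-1 : R^o) t (- (t^-1 * t^-1)).
Proof.
move=> t0; apply: is_derive_is_cderive.
have did : derivable (id : R^o -> R^o) t 1 by exact: derivable_id.
apply: DeriveDef; first exact: derivableV.
by rewrite deriveV // derive_id /GRing.scale /= mulr1 expr2 invfM.
Qed.

Lemma csmooth_inv (f : R -> R^o) V : (forall t, V t -> f t != 0) -> csmooth V f ->
  csmooth V (fun t => (f t)^-1 : R^o).
Proof.
move=> f0; apply: (@csmooth_comp R^o V [set x | x != 0] (fun x => x^-1)) => // n.
elim: n => // n IH; exists (fun t => - (t^-1 * t^-1)) => [t t0|]; first exact: is_cderive_inv.
have -> : (fun t : R => - (t^-1 * t^-1) : R^o) = (fun t =>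
  ((-1 : R) : R^o) *: ((t^-1 : R^o) *: (t^-1 : R^o))).
  by apply/funext => t; rewrite /GRing.scale /= mulN1r.
apply: cdiffZ; first exact: cdiff_cst.
exact: cdiffZ.
Qed.

Lemma is_cderive_pow n t : is_cderive (fun x : R => x ^+ n : R^o) t (n%:R * t ^+ n.-1).
Proof.
elim: n => [|n IH].
  by apply: is_cderive_eq (is_cderive_cst (1 : R^o) t) _; rewrite mul0r.
have H := is_cderiveZ (@is_cderive_id R t) IH.
apply: is_cderive_ext (is_cderive_eq H _) => [s|]; first by rewrite exprS.
rewrite /GRing.scale /= mul1r.
by case: n {IH H} => [|n] /=; rewrite ?expr0 ?exprS -?natr1; ring.
Qed.

(** The powers of 1/t are there because the derivative of [flat n] is a combination of [flat n.+1]
    and [flat n.+2]; a single induction then shows that the whole family is smooth. *)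
Definition flat n (t : R) : R^o := if 0 < t then t^-1 ^+ n * expR (- t^-1) else 0.

(** With x = 1/t, one term of the exponential series bounds x^n by n! exp x; the larger factorial
    also covers n = 0. *)
Lemma flat_le n t : `|flat n t| <= n.+1`!%:R.
Proof.
rewrite /flat; case: ifP => [t0|]; last by rewrite normr0.
have u0 : 0 < t^-1 by rewrite invr_gt0.
rewrite ger0_norm; last by rewrite mulr_ge0 ?expR_ge0 // exprn_ge0 // ltW.
rewrite expRN ler_pdivrMr ?expR_gt0 //.
case: n => [|n]; first by rewrite expr0 mul1r -expR0 ler_expR ltW.
have := expR_ge1Dxn n (ltW u0) => h.
have f0 : 0 < n.+1`!%:R :> R by rewrite ltr0n fact_gt0.
have h2 : t^-1 ^+ n.+1 <= n.+1`!%:R * expR t^-1.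
  by rewrite mulrC -ler_pdivrMr //; lra.
apply: le_trans h2 _; rewrite ler_wpM2r ?expR_ge0 // ler_nat.
by rewrite [leqRHS]factS leq_pmull.
Qed.

(** Together with [flat_le], this writes [flat n] as t^2 times a bounded function, whence the
    derivative 0 at the origin. *)
Lemma flat_shift n t : flat n t = t ^+ 2 * flat n.+2 t.
Proof.
rewrite /flat; case: ifP => [t0|]; last by rewrite mulr0.
by rewrite mulrA !exprS expr0; field; rewrite gt_eqF.
Qed.

Lemma is_cderive_flat n t :
  is_cderive (flat n) t (- n%:R * flat n.+1 t + flat n.+2 t).
Proof.
have [t0|t0|->] := ltgtP t 0.
- apply: (@is_cderive_near _ _ (fun=> 0)); last first.
    rewrite /flat !ifF ?mulr0 ?addr0; [exact: is_cderive_cst| |]; by apply/negP; lra.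
  near=> s; rewrite /flat ifF //; apply/negP/negP; rewrite -leNgt; apply/ltW.
  by near: s; exact: lt_nbhsl.
- apply: (@is_cderive_near _ _ (fun s => (s^-1 ^+ n : R^o) *: (expR (- s^-1) : R^o))).
    near=> s; rewrite /flat ifT //.
    by near: s; exact: lt_nbhsr.
  have Hi := is_cderive_inv (lt0r_neq0 t0).
  have H1 := is_cderive_comp Hi (@is_cderive_pow n t^-1).
  have H2 := is_cderive_comp (is_cderiveN Hi) (is_derive_is_cderive (is_derive_expR (- t^-1))).
  apply: is_cderive_eq (is_cderiveZ H1 H2) _.
  rewrite /flat !ifT // /GRing.scale /=.
  by case: n {H1} => [|n] /=; rewrite ?exprS ?expr0; ring.
- rewrite {2 3}/flat !ifF ?ltxx // mulr0 addr0.
  apply/is_cderiveP => p e sp e0; have p1 : 0 <= p 1 by exact: cseminorm_ge0.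
  have M0 : 0 < n.+3`!%:R * (1 + p 1) by rewrite mulr_gt0 ?ltr0n ?fact_gt0 //; lra.
  exists (e / (n.+3`!%:R * (1 + p 1))); first by rewrite divr_gt0.
  move=> h; rewrite ltr_pdivlMr // => he.
  rewrite add0r scaler0 {2}/flat ltxx !subr0 flat_shift.
  rewrite -[_ * flat _ _]mulr1 -[_ * 1]/(_ *: (1 : R^o)) cseminormZ // normrM.
  have := flat_le n.+2 h; set F := flat _ _ => hF.
  have hFp : `|F| * p 1 <= n.+3`!%:R * (1 + p 1) by apply: ler_pM => //; lra.
  rewrite normrX expr2 -!mulrA mulrC; apply: ler_wpM2r => //.
  by apply: le_trans (ltW he); rewrite ler_wpM2l.
Unshelve. all: by end_near. Qed.

Lemma csmooth_flat n V : csmooth V (flat n).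
Proof.
move=> k; elim: k n => // k IH n; eexists; first by move=> t _; exact: is_cderive_flat.
by apply: cdiffD => //; apply: (@cdiffZ R^o) => //; exact: cdiff_cst.
Qed.

Definition smoothstep (t : R) : R^o := flat 0 t / (flat 0 t + flat 0 (1 - t)).

Lemma csmooth_smoothstep : csmooth setT smoothstep.
Proof.
have c1 : csmooth setT (fun t : R => flat 0 (1 - t)).
  apply: (@csmooth_comp R^o _ setT) => //; first exact: csmooth_flat.
  by apply: csmoothB; [exact: csmooth_cst|exact: csmooth_id].
apply: csmoothM; first exact: csmooth_flat.
apply: csmooth_inv => [t _|]; last by apply: csmoothD => //; exact: csmooth_flat.
rewrite /flat !expr0 !mul1r gt_eqF //.
case: ifP => t0; case: ifP => t1; rewrite ?addr0 ?add0r ?addr_gt0 ?expR_gt0 //.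
by move: t0 t1; lra.
Qed.

Lemma smoothstep0 t : t <= 0 -> smoothstep t = 0.
Proof. by move=> t0; rewrite /smoothstep /flat ifF ?mul0r //; apply/negP; lra. Qed.

Lemma smoothstep1 t : 1 <= t -> smoothstep t = 1.
Proof.
move=> t1; rewrite /smoothstep /flat ifT; last lra.
rewrite ifF; last by apply/negP; lra.
by rewrite addr0 divff // gt_eqF // mulr_gt0 // expR_gt0.
Qed.

Lemma smoothstep01 t : 0 <= smoothstep t <= 1.
Proof.
have f0 s : 0 <= flat 0 s by rewrite /flat; case: ifP => // _; rewrite mulr_ge0 ?expR_ge0.
rewrite /smoothstep divr_ge0 ?addr_ge0 //=.
have [->|h] := eqVneq (flat 0 t + flat 0 (1 - t)) 0; first by rewrite invr0 mulr0.
rewrite ler_pdivrMr ?mul1r ?lerDl // lt_neqAle eq_sym h; exact: addr_ge0.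
Qed.

Definition plateau (t : R) : R^o := smoothstep (2 - 4 * t) * smoothstep (2 + 4 * t).

Lemma csmooth_plateau : csmooth setT plateau.
Proof.
apply: csmoothM; apply: (@csmooth_comp R^o _ setT) => //; try exact: csmooth_smoothstep.
  by apply: csmoothB; [exact: csmooth_cst|apply: (@csmooth_cstZ R^o); exact: csmooth_id].
by apply: csmoothD; [exact: csmooth_cst|apply: (@csmooth_cstZ R^o); exact: csmooth_id].
Qed.

Lemma plateau1 t : `|t| <= 4^-1 -> plateau t = 1.
Proof. by rewrite ler_norml => /andP[h1 h2]; rewrite /plateau !smoothstep1 ?mulr1 //; lra. Qed.

Lemma plateau0 t : 2^-1 <= `|t| -> plateau t = 0.
Proof.
rewrite ler_normr => /orP[] h; rewrite /plateau.
  by rewrite smoothstep0 ?mul0r //; lra.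
by rewrite [smoothstep (2 + _)]smoothstep0 ?mulr0 //; lra.
Qed.

Lemma plateau01 t : 0 <= plateau t <= 1.
Proof.
have /andP[a1 a2] := smoothstep01 (2 - 4 * t); have /andP[b1 b2] := smoothstep01 (2 + 4 * t).
by rewrite /plateau mulr_ge0 //= mulr_ile1.
Qed.

(** The main localization device: composing with [f] keeps the germ of a curve at [t0] and makes its
    time stay within [d] of [t0], so that a curve which is smooth, or lies in a chart, only near
    [t0] becomes one on the whole line. *)
Lemma smooth_cutoff (t0 d : R) : 0 < d -> exists f : R -> R^o,
  [/\ csmooth setT f, forall t, `|t - t0| <= d / 4 -> f t = t &
      forall t, `|f t - t0| < d].
Proof.
move=> d0; exists (fun t => t0 + plateau ((t - t0) / d) * (t - t0)).
have sub : csmooth setT (fun t : R => t - t0 : R^o).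
  by apply: csmoothB; [exact: csmooth_id|exact: csmooth_cst].
split.
- apply: csmoothD; first exact: csmooth_cst.
  apply: csmoothM => //; apply: (@csmooth_comp R^o _ setT) => //; first exact: csmooth_plateau.
  by apply: csmoothM => //; exact: csmooth_cst.
- move=> t td; rewrite plateau1; first by rewrite mul1r addrC subrK.
  by rewrite normrM normfV (gtr0_norm d0) ler_pdivrMr // mulrC.
- move=> t; rewrite addrAC subrr add0r.
  have [h|h] := leP 2^-1 `|(t - t0) / d|; first by rewrite plateau0 // mul0r normr0.
  have /andP[b1 b2] := plateau01 ((t - t0) / d).
  rewrite normrM (ger0_norm b1); apply: (@le_lt_trans _ _ `|t - t0|); first by rewrite ler_piMl.
  by move: h; rewrite normrM normfV (gtr0_norm d0) ltr_pdivrMr // => h; lra.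
Qed.

End Smooth.

Arguments csmooth_cstZ {R E V} a {c} _.

(** * The special curve lemma *)

Lemma continuous_csmooth {R : realType} (f : R -> R^o) : csmooth setT f ->
  continuous (f : R -> R).
Proof.
move=> /(_ 1)[f' ff' _] t; apply/cvgrPdist_le => /= e e0.
have [d d0 H] := is_cderive_cont (ff' t I) norm_cseminorm e0.
apply/nbhs_ballP; exists d => // s; rewrite /ball /= distrC => sd.
by have := H _ sd; rewrite [t + _]addrC subrK distrC.
Qed.

Section Train.
Context {R : realType}.
Implicit Types (al : nat -> R) (th : R -> R^o).

(** The j-th derivative of the n-th bump of a train carries the factor (4^n)^j, so the amplitudes
    have to decay faster than every power of 4^-n. *)
Definition rapid al := forall j, exists C, forall n, `|al n| * (4 ^+ n) ^+ j <= C.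

(** With this support the n-th bump lives on 4^-n (1/2, 3/2). These intervals are disjoint since the
    next one ends at 3/8 * 4^-n. *)
Definition bumplike th := csmooth setT th /\ forall x, 2^-1 <= `|x| -> th x = 0.

(* A sum of copies of [th] centred at 4^-n and scaled by 4^-n, which accumulate at 0 only; its
   value at [t] does not depend on the number [N] of terms as soon as [past N t]. *)
Definition train al th (t : R) : R^o :=
  \sum_(n < (Num.truncn (2 / t)).+1) al n * th (4 ^+ n * t - 1).

Definition past (N : nat) (t : R) := t <= 0 \/ 2 <= 4 ^+ N * t.

Lemma ler_pow4n n : n%:R <= 4 ^+ n :> R.
Proof.
elim: n => [|n IH]; first by rewrite expr0.
rewrite -natr1 exprS; have : 1 <= 4 ^+ n :> R by rewrite exprn_ege1 //; lra.
lra.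
Qed.

Lemma pow4_gt0 n : 0 < 4 ^+ n :> R.
Proof. by rewrite exprn_gt0 //; lra. Qed.

Lemma past_out th N t n : bumplike th -> past N t -> (N <= n)%N -> th (4 ^+ n * t - 1) = 0.
Proof.
move=> [_ th0] Nt Nn; apply: th0; have n0 := pow4_gt0 n.
case: Nt => [t0|Nt].
  have : 4 ^+ n * t <= 0 by rewrite pmulr_rle0.
  by rewrite ler_normr => ?; apply/orP; right; lra.
rewrite ler_normr; apply/orP; left.
have t0 : 0 < t by rewrite -(pmulr_rgt0 _ (pow4_gt0 N)); lra.
have : 4 ^+ N * t <= 4 ^+ n * t by rewrite ler_pM2r // ler_weXn2l //; lra.
lra.
Qed.

(** Since 4^N >= N > 2 / t for this number [N] of terms. *)
Lemma past_truncn t : past (Num.truncn (2 / t)).+1 t.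
Proof.
have [t0|t0] := leP t 0; [by left|right].
rewrite -ler_pdivrMr //; apply: le_trans (ler_pow4n _).
by apply/ltW; exact: truncnS_gt.
Qed.

Lemma train_past al th N t : bumplike th -> past N t ->
  train al th t = \sum_(n < N) al n * th (4 ^+ n * t - 1).
Proof.
move=> bth Nt; rewrite /train; set K := (Num.truncn _).+1.
have ext M M' : past M t -> (M <= M')%N ->
    \sum_(n < M) al n * th (4 ^+ n * t - 1) = \sum_(n < M') al n * th (4 ^+ n * t - 1).
  move=> Mt MM'; rewrite -(subnKC MM') big_split_ord /= [X in _ = _ + X]big1 ?addr0 // => i _.
  by rewrite (past_out bth Mt) ?mulr0 // leq_addr.
rewrite (ext K (maxn K N)) ?leq_maxl //; last exact: past_truncn.
by rewrite [RHS](ext N (maxn K N)) // leq_maxr.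
Qed.

Lemma rapid_shift al : rapid al -> rapid (fun n => al n * 4 ^+ n).
Proof.
move=> H j; have [C HC] := H j.+1; exists C => n.
by rewrite normrM (gtr0_norm (pow4_gt0 n)) -mulrA -exprS.
Qed.

(** Where |x| >= 1/2, boundary points included, the derivative is computed from increments that move
    away from 0, along which [th] vanishes. *)
Lemma bumplike_deriv th : bumplike th -> exists2 th', bumplike th' &
  forall t, is_cderive th t (th' t).
Proof.
move=> [sth th0]; have cth t : is_cderive th t (cderive th t) by exact: csmooth_cderive_at sth I.
exists (cderive th) => //; split.
  by apply: csmooth_cderive => //; exact: openT.
move=> x hx; apply/normr0_eq0/le_anti/andP; split => //.
apply/ler_addgt0Pr => e e0; rewrite add0r.
have [d d0 Hd] := (is_cderiveP _ _ _).1 (cth x) _ _ norm_cseminorm e0.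
have key h : `|h| < d -> h != 0 -> 2^-1 <= `|x + h| -> `|cderive th x| <= e.
  move=> hd h0 hx'; have := Hd h hd; rewrite !th0 // subrr sub0r normrN /GRing.scale /= normrM.
  by rewrite mulrC ler_pM2r // normr_gt0.
move: hx; rewrite ler_normr => /orP[] hx.
  apply: (key (d / 2)).
  - by rewrite gtr0_norm; lra.
  - by rewrite gt_eqF //; lra.
  - by rewrite ler_normr; apply/orP; left; lra.
apply: (key (- (d / 2))).
- by rewrite normrN gtr0_norm; lra.
- by rewrite oppr_eq0 gt_eqF //; lra.
- by rewrite ler_normr; apply/orP; right; lra.
Qed.

Lemma bumplike_bounded th : bumplike th -> exists2 M, 0 <= M & forall x, `|th x| <= M.
Proof.
move=> [sth th0].
have cont : {within `[(-1 : R), 1], continuous (fun x => `|th x| : R)}.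
  apply: continuous_subspaceT => x.
  by apply: (@continuous_comp _ _ _ (th : R -> R) (fun y : R => `|y|));
    [exact: continuous_csmooth|exact: norm_continuous].
have N11 : -1 <= 1 :> R by lra.
have [c _ Hc] := EVT_max N11 cont.
exists `|th c| => // x.
have [h|h] := leP 2^-1 `|x|; first by rewrite th0 // normr0.
by apply: Hc; rewrite in_itv /=; move: h; rewrite ltr_norml => /andP[]; lra.
Qed.

(** This gives the derivative 0 at 0, where the bumps accumulate. Where the n-th term is nonzero, 1
    <= 4 (4^n)^2 t^2; against the decay of order 3 this leaves a factor 4^-n, and the geometric
    series converges. *)
Lemma train_small al th : rapid al -> bumplike th ->
  exists C, forall t, `|train al th t| <= C * t ^+ 2.
Proof.
move=> ral bth; have [M M0 HM] := bumplike_bounded bth; have [C HC] := ral 3.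
have C0 : 0 <= C by apply: le_trans (HC 0%N); rewrite mulr_ge0 // !expr0 expr1n.
exists (8 * (C * M)) => t.
rewrite /train; set K := (Num.truncn _).+1.
apply: le_trans (ler_norm_sum _ _ _) _.
apply: (@le_trans _ _ (\sum_(n < K) (4 * (C * M) * t ^+ 2) * (4^-1) ^+ n)).
  apply: ler_sum => n _.
  have [h|h] := leP 2^-1 `|4 ^+ n * t - 1|.
    have q0 : 0 <= (4^-1 : R) ^+ n by rewrite exprn_ge0 // invr_ge0.
    by rewrite (proj2 bth) // mulr0 normr0 mulr_ge0 // mulr_ge0 ?sqr_ge0 // mulr_ge0 // mulr_ge0.
  have n0 := pow4_gt0 n.
  have h1 : 2^-1 <= 4 ^+ n * t by move: h; rewrite ltr_norml => /andP[]; lra.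
  have h2 : 1 <= 4 * (4 ^+ n) ^+ 2 * t ^+ 2.
    have := @lerXn2r R 2 2^-1 (4 ^+ n * t); rewrite !nnegrE => /(_ _ _ h1).
    rewrite exprMn => h2.
    have := h2 ltac:(lra) ltac:(lra); rewrite expr2; lra.
  rewrite normrM; apply: (@le_trans _ _ (`|al n| * M)); first by rewrite ler_wpM2l.
  have alM : 0 <= `|al n| * M by rewrite mulr_ge0.
  apply: (@le_trans _ _ (`|al n| * M * (4 * (4 ^+ n) ^+ 2 * t ^+ 2))).
    by rewrite -[X in X <= _]mulr1 ler_wpM2l.
  have -> : `|al n| * M * (4 * (4 ^+ n) ^+ 2 * t ^+ 2) =
    (`|al n| * (4 ^+ n) ^+ 3) * (4 * M * t ^+ 2 * (4^-1) ^+ n).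
    by rewrite exprVn; field; rewrite gt_eqF.
  have -> : 4 * (C * M) * t ^+ 2 * 4^-1 ^+ n = C * (4 * M * t ^+ 2 * 4^-1 ^+ n) by ring.
  by rewrite ler_wpM2r // mulr_ge0 ?exprn_ge0 ?invr_ge0 // mulr_ge0 ?sqr_ge0 // mulr_ge0.
rewrite -mulr_sumr.
have S2 m : \sum_(n < m) (4^-1 : R) ^+ n <= 2 - 2 * (4^-1) ^+ m.
  elim: m => [|m IH]; first by rewrite big_ord0 expr0; lra.
  rewrite big_ord_recr /= exprS.
  have : 0 <= (4^-1 : R) ^+ m by rewrite exprn_ge0 // invr_ge0.
  lra.
apply: (@le_trans _ _ (4 * (C * M) * t ^+ 2 * 2)); last lra.
apply: ler_wpM2l; first by rewrite mulr_ge0 ?sqr_ge0 // mulr_ge0 // mulr_ge0.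
apply: le_trans (S2 K) _.
have : 0 <= (4^-1 : R) ^+ K by rewrite exprn_ge0 // invr_ge0.
lra.
Qed.

(** Away from 0 a train is thus locally a finite sum with a fixed number of terms. *)
Lemma past_near t : t != 0 -> exists N, \forall s \near t, past N s.
Proof.
move=> t0; have [tn|tp] := ltP t 0.
  by exists 0%N; near=> s; left; apply/ltW; near: s; exact: lt_nbhsl.
have {t0}tp : 0 < t by rewrite lt_neqAle eq_sym t0.
exists (Num.truncn (2 / (t / 2))).+1.
have [|h] := past_truncn (t / 2); first lra.
near=> s; right; apply: le_trans h _; rewrite ler_pM2l ?pow4_gt0 //.
apply/ltW; near: s; apply: lt_nbhsr; lra.
Unshelve. all: by end_near. Qed.

Lemma is_cderive_train al th th' t : rapid al -> bumplike th -> bumplike th' ->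
  (forall s, is_cderive th s (th' s)) ->
  is_cderive (train al th) t (train (fun n => al n * 4 ^+ n) th' t).
Proof.
move=> ral bth bth' thth'.
have [->|t0] := eqVneq t 0.
  rewrite (@train_past _ _ 0 0) //; last by left.
  rewrite big_ord0; have [C HC] := train_small ral bth.
  have C0 : 0 <= C by have := HC 1; rewrite expr1n mulr1; exact: le_trans.
  apply/is_cderiveP => p e sp e0; have p1 : 0 <= p 1 by exact: cseminorm_ge0.
  have M0 : 0 < 1 + C * p 1 by have := mulr_ge0 C0 p1; lra.
  exists (e / (1 + C * p 1)); first by rewrite divr_gt0.
  move=> h; rewrite ltr_pdivlMr // => he.
  rewrite scaler0 subr0 add0r (@train_past al th 0 0) //; last by left.
  rewrite big_ord0 subr0 -[train al th h]mulr1 -[_ * 1]/(_ *: (1 : R^o)) cseminormZ //.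
  apply: (@le_trans _ _ (C * h ^+ 2 * p 1)); first by rewrite ler_wpM2r.
  rewrite -[h ^+ 2]real_normK ?num_real // expr2.
  have -> : C * (`|h| * `|h|) * p 1 = `|h| * (C * p 1) * `|h| by ring.
  rewrite ler_wpM2r //; have := normr_ge0 h; lra.
have [N HN] := past_near t0.
rewrite (@train_past _ _ N) //; last exact: (nbhs_singleton HN).
apply: (@is_cderive_near _ _ (fun s => \sum_(n < N) al n *: th (4 ^+ n * s - 1))).
  by apply: filterS HN => s Ns; rewrite (@train_past _ _ N).
apply: is_cderive_sum => n.
have H1 : is_cderive (fun s : R => 4 ^+ n * s - 1 : R^o) t (4 ^+ n).
  exact: is_cderive_affine.
have H2 := is_cderive_cstZ (al n) (is_cderive_comp H1 (thth' (4 ^+ n * t - 1))).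
apply: is_cderive_eq H2 _.
by rewrite /GRing.scale /= mulrA.
Qed.

Lemma csmooth_train al th : rapid al -> bumplike th -> csmooth setT (train al th).
Proof.
move=> ral bth k; elim: k al th ral bth => // k IH al th ral bth.
have [th' bth' thth'] := bumplike_deriv bth.
exists (train (fun n => al n * 4 ^+ n) th') => [t _|]; first exact: is_cderive_train.
by apply: IH => //; exact: rapid_shift.
Qed.

Lemma train0 al th : bumplike th -> train al th 0 = 0.
Proof. by move=> bth; rewrite (@train_past _ _ 0) ?big_ord0 //; left. Qed.

(** At this point the later bumps are past, as 4 (1 + x) >= 3, and the arguments of the earlier ones
    are at most (1 + x) / 4 - 1 < -1/2, outside the support. *)
Lemma train_at al th m (x : R) : bumplike th -> `|x| <= 4^-1 ->
  train al th ((4 ^+ m)^-1 * (1 + x)) = al m * th x.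
Proof.
move=> bth; rewrite ler_norml => /andP[x1 x2].
have m0 := pow4_gt0 m.
have e k : 4 ^+ (m + k) * ((4 ^+ m)^-1 * (1 + x)) = 4 ^+ k * (1 + x).
  by rewrite exprD; field; rewrite gt_eqF.
rewrite (@train_past _ _ m.+1) //; last first.
  by right; have := e 1%N; rewrite addn1 expr1 => ->; lra.
rewrite big_ord_recr /= big1 ?add0r => [|n _].
  by have := e 0%N; rewrite addn0 expr0 mul1r => ->; rewrite addrC addKr.
rewrite (proj2 bth) ?mulr0 // ler_normr; apply/orP; right.
have n0 := pow4_gt0 n; have := e 0%N; rewrite addn0 expr0 mul1r => e0.
have h : 4 ^+ n * 4 <= 4 ^+ m :> R.
  by rewrite -exprSr ler_weXn2l //; lra.
have y0 : 0 < (4 ^+ m)^-1 * (1 + x) by rewrite mulr_gt0 ?invr_gt0 //; lra.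
have : (4 ^+ n * 4) * ((4 ^+ m)^-1 * (1 + x)) <= 1 + x.
  by rewrite -[X in _ <= X]e0 ler_pM2r.
lra.
Qed.

(** 4^-(n^2) outruns every power of 4^n because n j <= n^2 + j^2. *)
Definition fast n : R := (4^-1) ^+ (n * n).

Lemma rapid_fast al : (forall n, `|al n| <= fast n) -> rapid al.
Proof.
move=> H j; exists ((4 ^+ j) ^+ j) => n.
apply: (@le_trans _ _ (fast n * (4 ^+ n) ^+ j)).
  by rewrite ler_wpM2r // exprn_ge0 // ltW // pow4_gt0.
rewrite /fast exprVn -!exprM mulrC ler_pdivrMr ?pow4_gt0 // -exprD.
rewrite ler_weXn2l //; first lra.
have [nj|jn] := leqP n j.
  by rewrite (leq_trans (leq_mul nj (leqnn j))) // leq_addr.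
by rewrite (leq_trans (leq_mul (leqnn n) (ltnW jn))) // leq_addl.
Qed.

Lemma fast_gt0 n : 0 < fast n. Proof. by rewrite exprn_gt0 // invr_gt0. Qed.

Lemma bumplike_plateau : bumplike plateau.
Proof. by split; [exact: csmooth_plateau|exact: plateau0]. Qed.

Lemma bumplike_plateau_id : bumplike (fun x => x * plateau x).
Proof.
split; last by move=> x /plateau0 ->; rewrite mulr0.
by apply: csmoothM; [exact: csmooth_id|exact: csmooth_plateau].
Qed.

(* The special curve lemma KM 2.8, with prescribed horizontal velocities [e n]. *)
Lemma special_curve (s r e : nat -> R) :
  (forall n, [/\ `|s n| <= fast n, `|r n| <= fast n & `|e n| <= fast n]) ->
  exists a b : R -> R^o, [/\ csmooth setT a, csmooth setT b, a 0 = 0, b 0 = 0 &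
    forall n x, `|x| <= (4 ^+ n)^-1 / 4 ->
      a ((4 ^+ n)^-1 + x) = s n + e n * x /\ b ((4 ^+ n)^-1 + x) = r n].
Proof.
move=> H.
have rs : rapid s by apply: rapid_fast => n; have [] := H n.
have rr : rapid r by apply: rapid_fast => n; have [] := H n.
have re : rapid (fun n => e n * (4 ^+ n)^-1).
  apply: rapid_fast => n; have [_ _ en] := H n; rewrite normrM; apply: le_trans en.
  by rewrite ler_piMr // gtr0_norm ?invr_gt0 ?pow4_gt0 // invf_le1 ?pow4_gt0 // exprn_ege1 //; lra.
(* The first train has plateaus of height [s n]. In the second, [x * plateau x] is the identity near
   0, and the factor 4^-n in the amplitude undoes the dilation by 4^n, leaving the slope [e n]. *)
exists (fun t => train s plateau t + train (fun n => e n * (4 ^+ n)^-1) (fun x => x * plateau x) t).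
exists (train r plateau); split.
- apply: csmoothD; apply: csmooth_train => //; [exact: bumplike_plateau|exact: bumplike_plateau_id].
- by apply: csmooth_train => //; exact: bumplike_plateau.
- by rewrite !train0 ?addr0 //; [exact: bumplike_plateau_id|exact: bumplike_plateau].
- by rewrite train0 //; exact: bumplike_plateau.
- move=> n x xn; have n0 := pow4_gt0 n.
  have x4 : `|4 ^+ n * x| <= 4^-1.
    by rewrite normrM gtr0_norm // mulrC -ler_pdivlMr // mulrC.
  have -> : (4 ^+ n)^-1 + x = (4 ^+ n)^-1 * (1 + 4 ^+ n * x).
    by field; rewrite gt_eqF.
  rewrite !train_at //; [|exact: bumplike_plateau|exact: bumplike_plateau_id|exact:
    bumplike_plateau].
  by rewrite plateau1 // !mulr1; split => //; field; rewrite gt_eqF.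
Qed.

End Train.

(** * Taylor expansions *)

Lemma scaleRE {R : realType} (a b : R) : a *: (b : R^o) = a * b :> R^o.
Proof. by []. Qed.

Section IteratedDerivatives.
Context {R : realType} {E : tvsType R}.
Hypothesis hE : hausdorff_space E.
Implicit Types (c : R -> E).

Local Notation dn n := (iter n (@cderive R E)).

Lemma cderive_near c (d : R -> E) t : (\forall s \near t, c s = d s) ->
  cderive c t = cderive d t.
Proof.
move=> cd; rewrite /cderive; congr xget; apply/funext => v; apply/propext; split => h.
  exact: is_cderive_near h.
by apply: is_cderive_near h; apply: filterS cd => s ->.
Qed.

Lemma iter_cderive_near n c (d : R -> E) t : (\forall s \near t, c s = d s) ->
  dn n c t = dn n d t.
Proof.
elim: n t => [|n IH] t cd; first exact: nbhs_singleton cd.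
apply: cderive_near; move/nbhs_interior: cd; apply: filterS => s; exact: IH.
Qed.

Lemma is_cderive_iter n c t : csmooth setT c -> is_cderive (dn n c) t (dn n.+1 c t).
Proof.
by move=> cs; exact: (csmooth_cderive_at (csmooth_iter n hE openT cs) I).
Qed.

Lemma csmooth_iterT n c : csmooth setT c -> csmooth setT (dn n c).
Proof. by apply: csmooth_iter => //; exact: openT. Qed.

Lemma cderive_csmooth c t : csmooth setT c -> is_cderive c t (cderive c t).
Proof. by move=> cs; exact: csmooth_cderive_at cs I. Qed.

Lemma csmooth_cderiveT c : csmooth setT c -> csmooth setT (cderive c).
Proof. exact: (@csmooth_iterT 1). Qed.

Lemma iter_cderive_affine n c (a b : R) t : csmooth setT c ->
  dn n (fun x => c (a * x + b)) t = a ^+ n *: dn n c (a * t + b).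
Proof.
move=> cs; elim: n t => [|n IH] t; first by rewrite expr0 scale1r.
rewrite iterS (funext IH); apply: cderive_val => //.
rewrite exprSr -scalerA; apply: is_cderive_cstZ.
exact: is_cderive_comp (@is_cderive_affine _ a b t) (is_cderive_iter cs).
Qed.

Lemma iter_cderiveZ n c (a : R) t : csmooth setT c ->
  dn n (fun x => a *: c x) t = a *: dn n c t.
Proof.
move=> cs; elim: n t => [//|n IH] t.
rewrite iterS (funext IH); apply: cderive_val => //.
exact: is_cderive_cstZ (is_cderive_iter cs).
Qed.

Lemma csmooth_continuous c t p e : csmooth setT c -> cseminorm p -> 0 < e ->
  exists2 d, 0 < d & forall h, `|h| < d -> p (c (t + h) - c t) <= e.
Proof. by move=> /cderive_csmooth cs sp e0; exact: is_cderive_cont (cs t) sp e0. Qed.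

Lemma csmooth_bounded c t p : csmooth setT c -> cseminorm p ->
  exists2 d, 0 < d & exists M, forall h, `|h| < d -> p (c (t + h)) <= M.
Proof.
move=> cs sp; have [d d0 H] := csmooth_continuous t cs sp ltr01.
exists d => //; exists (1 + p (c t)) => h /H hd.
by rewrite -[c (t + h)](subrK (c t)); exact: cseminormD_le.
Qed.

Definition taylor n c (t : R) : E := \sum_(j < n) ((j`!%:R)^-1 * t ^+ j) *: dn j c 0.

Lemma taylorSr n c t : taylor n.+1 c t = taylor n c t + ((n`!%:R)^-1 * t ^+ n) *: dn n c 0.
Proof. by rewrite /taylor big_ord_recr. Qed.

Lemma is_cderive_taylor n c t : is_cderive (taylor n.+1 c) t (taylor n (cderive c) t).
Proof.
apply: (@is_cderive_ext _ _ (fun t => c 0 + \sum_(j < n) ((j.+1`!%:R)^-1 * t ^+ j.+1) *: dn j.+1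
  c 0)).
  by move=> s; rewrite /taylor big_ord_recl /= fact0 expr0 invr1 mulr1 scale1r.
rewrite -[taylor _ _ _]add0r; apply: is_cderiveD; first exact: is_cderive_cst.
apply: is_cderive_sum => j.
have H1 := is_cderive_cstZ (j.+1`!%:R)^-1 (@is_cderive_pow R j.+1 t).
apply: is_cderive_eq (is_cderiveZ H1 (is_cderive_cst _ t)) _.
rewrite scaler0 addr0 -iterSr; congr (_ *: _).
rewrite /GRing.scale /= factS natrM; field; by rewrite !pnatr_eq0 -lt0n fact_gt0 /= nat1r pnatr_eq0.
Qed.

(** The derivative of a Taylor remainder is the remainder of one order less of the derivative, so
    each use of the mean value inequality contributes a factor |t|. No factorial is gained, and none
    is required later. *)
Lemma taylor_bound p n c M t : cseminorm p -> csmooth setT c ->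
  (forall s, `|s| <= `|t| -> p (dn n c s) <= M) -> p (c t - taylor n c t) <= M * `|t| ^+ n.
Proof.
move=> sp; elim: n c t => [|n IH] c t cs H.
  by rewrite /taylor big_ord0 subr0 expr0 mulr1; exact: H.
have -> : c t - taylor n.+1 c t = (c t - taylor n.+1 c t) - (c 0 - taylor n.+1 c 0).
  rewrite [taylor _ _ 0]/taylor big_ord_recl big1 /= => [|j _].
    by rewrite fact0 expr0 invr1 mulr1 scale1r addr0 subrr subr0.
  by rewrite expr0n mulr0 scale0r.
rewrite exprSr mulrA -[X in _ * `|X|]subr0.
apply: (@mean_value_abs _ _ (fun s => c s - taylor n.+1 c s) (fun s =>
  cderive c s - taylor n (cderive c) s) p 0 t) => // s; rewrite !subr0 => st.
  by apply: is_cderiveB; [exact: cderive_csmooth|exact: is_cderive_taylor].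
apply: (@le_trans _ _ (M * `|s| ^+ n)).
  apply: IH; first exact: csmooth_cderiveT.
  by move=> x xs; rewrite -iterSr; apply: H; exact: le_trans st.
apply: ler_wpM2l; last by rewrite lerXn2r ?nnegrE.
by apply: le_trans (H 0 _); [exact: cseminorm_ge0|rewrite normr0].
Qed.

(* The Taylor remainder divided by t^n; the value at 0 is the limit. *)
Definition hadamard n c (t : R) : E :=
  if t == 0 then (n`!%:R)^-1 *: dn n c 0 else (t ^+ n)^-1 *: (c t - taylor n c t).

Lemma hadamard0 n c : hadamard n c 0 = (n`!%:R)^-1 *: dn n c 0.
Proof. by rewrite /hadamard eqxx. Qed.

Lemma hadamardE n c t : t != 0 -> hadamard n c t = (t ^+ n)^-1 *: (c t - taylor n c t).
Proof. by rewrite /hadamard => /negbTE ->. Qed.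

Lemma hadamardS n c t : hadamard n c t = (n`!%:R)^-1 *: dn n c 0 + t *: hadamard n.+1 c t.
Proof.
have [->|t0] := eqVneq t 0; first by rewrite hadamard0 scale0r addr0.
rewrite !hadamardE // taylorSr exprS.
have tn : t ^+ n != 0 by rewrite expf_neq0.
move: (n`!%:R^-1) (t ^+ n) tn (c t) (taylor n c t) (dn n c 0) => f u u0 X Y Z.
by lmod_coefs R E; field; rewrite ?u0 ?t0.
Qed.

Lemma hadamard_bounded n c p : csmooth setT c -> cseminorm p ->
  exists2 d, 0 < d & exists M, forall t, `|t| < d -> p (hadamard n c t) <= M.
Proof.
move=> cs sp; have [d d0 [M HM]] := csmooth_bounded 0 (csmooth_iterT n cs) sp.
exists d => //; exists M => t td.
have HM' s : `|s| < d -> p (dn n c s) <= M by move=> /HM; rewrite add0r.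
have [->|t0] := eqVneq t 0.
  rewrite hadamard0 -[M]mul1r; apply: cseminormZ_le => //; last by apply: HM'; rewrite normr0.
  have f0 : 0 < n`!%:R :> R by rewrite ltr0n fact_gt0.
  by rewrite gtr0_norm ?invr_gt0 // invf_le1 // ler1n fact_gt0.
rewrite hadamardE // cseminormZ // normfV normrX mulrC ler_pdivrMr ?exprn_gt0 ?normr_gt0 //.
by apply: taylor_bound => // s st; apply: HM'; exact: le_lt_trans td.
Qed.

(** Peeling off two Taylor coefficients with [hadamardS] leaves t^2 times a quotient that is bounded
    near 0. *)
Lemma is_cderive_hadamard0 n c : csmooth setT c ->
  is_cderive (hadamard n c) 0 ((n.+1`!%:R)^-1 *: dn n.+1 c 0).
Proof.
move=> cs; apply/is_cderiveP => p e sp e0.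
have [d d0 [M HM]] := hadamard_bounded n.+2 cs sp.
have M0 : 0 <= M by apply: le_trans (HM 0 _); [exact: cseminorm_ge0|rewrite normr0].
exists (Num.min d (e / (1 + M))); first by rewrite lt_min d0 divr_gt0 //; lra.
move=> h; rewrite lt_min => /andP[hd]; rewrite ltr_pdivlMr; last lra.
move=> he; rewrite add0r hadamardS [hadamard n.+1 c h]hadamardS hadamard0.
move: (HM h hd) (_ *: dn n c 0) (_ *: dn n.+1 c 0) => hM X Y.
rewrite [X in p X](_ : _ = (h * h) *: hadamard n.+2 c h); last by lmod_coefs R E.
apply: (@le_trans _ _ (`|h| * `|h| * M)); first by apply: cseminormZ_le => //; rewrite normrM.
rewrite mulrAC ler_wpM2r //; apply: le_trans (ltW he).
by rewrite ler_wpM2l //; lra.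
Qed.

(** In the quotient rule the two singular terms in the (n+1)-st derivative of [c] at 0 cancel. The
    result consists of Hadamard quotients again, so smoothness follows by induction. *)
Lemma is_cderive_hadamard n c t : csmooth setT c ->
  is_cderive (hadamard n.+1 c) t
    (hadamard n.+1 (cderive c) t - n.+1%:R *: hadamard n.+2 c t).
Proof.
move=> cs; have [->|t0] := eqVneq t 0.
  apply: is_cderive_eq (is_cderive_hadamard0 cs) _.
  rewrite !hadamard0 -iterSr; lmod_coefs R E; rewrite [(n.+2)`!]factS natrM; field.
  by rewrite !pnatr_eq0 -lt0n fact_gt0 /= -natrD pnatr_eq0.
apply: (@is_cderive_near _ _ (fun s => (s ^+ n.+1)^-1 *: (c s - taylor n.+1 c s))).
  near=> s; rewrite hadamardE //; near: s.
  have : open [set x : R | x != 0] by exact: open_neq.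
  by move=> o; apply: open_nbhs_nbhs; split.
have H1 := is_cderive_comp (@is_cderive_pow R n.+1 t) (is_cderive_inv (expf_neq0 n.+1 t0)).
apply: is_cderive_eq (is_cderiveZ H1 (is_cderiveB (cderive_csmooth cs) (@is_cderive_taylor n c
  t))) _.
rewrite !hadamardE // !taylorSr -[dn n (cderive c) 0]/(dn n (cderive c) 0) -iterSr /=.
have tn : t ^+ n != 0 by rewrite expf_neq0.
rewrite /= !exprS factS natrM scaleRE.
have f0 : n`!%:R != 0 :> R by rewrite pnatr_eq0 -lt0n fact_gt0.
have n0 : n.+1%:R != 0 :> R by rewrite pnatr_eq0.
move: (n`!%:R) (n.+1%:R) f0 n0 (t ^+ n) tn (c t) (taylor n c t) (taylor n (cderive c) t)
  (cderive c t) => f N f0 n0 u u0 X Y Z W.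
move: (iter n (@cderive R E) c 0) (cderive (iter n (@cderive R E) c) 0) => D0 D1.
lmod_coefs R E; field; rewrite ?f0 ?n0 ?u0 ?t0 //.
Unshelve. all: by end_near. Qed.

Lemma csmooth_hadamard n c : csmooth setT c -> csmooth setT (hadamard n.+1 c).
Proof.
move=> cs k; elim: k n c cs => // k IH n c cs; eexists.
  by move=> t _; exact: is_cderive_hadamard.
apply: cdiffD; first by apply: IH; exact: csmooth_cderiveT.
have := IH n.+1 c cs; move: (hadamard _ _) => f fk.
have -> : (fun t => - (n.+1%:R *: f t)) = (fun t => (- n.+1%:R : R) *: f t).
  by apply/funext => t; rewrite scaleNr.
by apply: cdiffZ => //; exact: cdiff_cst.
Qed.

End IteratedDerivatives.

(** * Two-parameter families *)

Lemma pow4_small {R : realType} (d : R) : 0 < d -> exists n, (4 ^+ n)^-1 < d.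
Proof.
move=> d0; exists (Num.truncn d^-1).+1.
rewrite invf_plt ?posrE ?pow4_gt0 //.
by apply: lt_le_trans (ler_pow4n _); exact: truncnS_gt.
Qed.

Lemma small_pos {R : realType} (s : seq R) : all (fun x => 0 < x) s ->
  exists2 r, 0 < r & all (fun x => r < x) s.
Proof.
elim: s => [_|x s IH /= /andP[x0 /IH[r r0 rs]]]; first by exists 1.
exists (Num.min (x / 2) r); first by rewrite lt_min r0 andbT; lra.
apply/andP; split; first by rewrite gt_min; apply/orP; left; lra.
by apply: sub_all rs => y; apply: le_lt_trans; rewrite ge_min lexx orbT.
Qed.

(* Otherwise a special curve runs through points outside [W] that converge fast to (s0, r0). *)
Lemma plane_open {R : realType} (W : R -> R -> Prop) (s0 r0 : R) :
  (forall a b : R -> R^o, csmooth setT a -> csmooth setT b -> W (a 0) (b 0) ->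
    exists2 d, 0 < d & forall h, `|h| < d -> W (a h) (b h)) ->
  W s0 r0 -> exists2 d, 0 < d & forall s r, `|s - s0| < d -> `|r - r0| < d -> W s r.
Proof.
move=> Wop W0; apply: contrapT => bad.
have /choice[x Hx] : forall n, exists x : R * R, [/\ `|x.1 - s0| <= fast n, `|x.2 - r0| <= fast
  n & ~ W x.1 x.2].
  move=> n; apply: contrapT => no; apply: bad; exists (fast n); first exact: fast_gt0.
  move=> s r hs hr; apply: contrapT => nW; apply: no.
  by exists (s, r); split=> //; exact: ltW.
have [|a [b [sa sb a0 b0 ab]]] := @special_curve R (fun n => (x n).1 - s0) (fun n =>
  (x n).2 - r0) (fun=> 0).
  by move=> n; have [h1 h2 _] := Hx n; split=> //; rewrite normr0 ltW // fast_gt0.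
have [|||d d0 Hd] := Wop (fun t => s0 + a t) (fun t => r0 + b t).
- by apply: csmoothD => //; exact: csmooth_cst.
- by apply: csmoothD => //; exact: csmooth_cst.
- by rewrite a0 b0 !addr0.
have [n nd] := pow4_small d0.
have n0 : 0 < (4 ^+ n)^-1 :> R by rewrite invr_gt0 pow4_gt0.
have := Hd (4 ^+ n)^-1; rewrite gtr0_norm // => /(_ nd).
have [|] := ab n 0; first by rewrite normr0 divr_ge0 // ltW.
rewrite addr0 => -> ->; rewrite mul0r addr0 ![_ + (_ - _)]addrC !subrK.
by have [_ _] := Hx n.
Qed.

Section Families.
Context {R : realType} {E : tvsType R}.
Hypothesis hE : hausdorff_space E.
Implicit Types (k : R -> R -> E).

Local Notation dn n := (iter n (@cderive R E)).

Definition smooth_fam k := forall a b : R -> R^o, csmooth setT a -> csmooth setT b ->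
  csmooth setT (fun t => k (a t) (b t)).

Lemma smooth_fam_flip k : smooth_fam k -> smooth_fam (fun s r => k r s).
Proof. by move=> fk a b sa sb; exact: fk. Qed.

Lemma smooth_fam_row k r : smooth_fam k -> csmooth setT (fun s => k s r).
Proof. by move=> fk; apply: (fk id (fun=> r)); [exact: csmooth_id|exact: csmooth_cst]. Qed.

Lemma smooth_fam_col k s : smooth_fam k -> csmooth setT (k s).
Proof. by move=> fk; apply: (fk (fun=> s) id); [exact: csmooth_cst|exact: csmooth_id]. Qed.

(** The set where the seminorm is below [e] is open along smooth curves, and [plane_open] makes it a
    genuine neighbourhood. *)
Lemma smooth_fam_continuous k s0 r0 p e : smooth_fam k -> cseminorm p -> 0 < e ->
  exists2 d, 0 < d & forall s r, `|s - s0| < d -> `|r - r0| < d ->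
    p (k s r - k s0 r0) <= e.
Proof.
move=> fk sp e0.
have [||d d0 H] := @plane_open R (fun s r => p (k s r - k s0 r0) < e) s0 r0.
- move=> a b sa sb; set x := p _ => xe.
  have ex : 0 < (e - x) / 2 by lra.
  have [d d0 Hd] := csmooth_continuous 0 (fk a b sa sb) sp ex.
  exists d => // h /Hd; rewrite add0r => hd.
  rewrite -(subrK (k (a 0) (b 0)) (k (a h) (b h))) -addrA.
  by apply: le_lt_trans (cseminormD _ _ sp) _; rewrite -/x; lra.
- by rewrite subrr cseminorm0.
- by exists d => // s r hs hr; rewrite ltW // H.
Qed.

Definition pdn n k (s r : R) : E := dn n (fun x => k x r) s.

(* Otherwise a special curve moves horizontally, with speed [fast m], through points where
   [pdn n k] is larger than [m / fast m ^ n], so its image has an unbounded n-th derivative. *)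
Lemma pdn_bounded n k s0 r0 p : smooth_fam k -> cseminorm p ->
  exists2 d, 0 < d & exists M, forall s r, `|s - s0| < d -> `|r - r0| < d ->
    p (pdn n k s r) <= M.
Proof.
move=> fk sp; apply: contrapT => bad.
have /choice[x Hx] : forall m, exists x : R * R, [/\ `|x.1 - s0| <= fast m, `|x.2 - r0| <= fast m &
    m%:R / fast m ^+ n < p (pdn n k x.1 x.2)].
  move=> m; apply: contrapT => no; apply: bad; exists (fast m); first exact: fast_gt0.
  exists (m%:R / fast m ^+ n).
  move=> s r hs hr; rewrite leNgt; apply/negP => nW; apply: no.
  by exists (s, r); split=> //; exact: ltW.
have [|a [b [sa sb a0 b0 ab]]] := @special_curve R (fun n => (x n).1 - s0) (fun n =>
  (x n).2 - r0) fast.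
  by move=> m; have [h1 h2 _] := Hx m; split=> //; rewrite gtr0_norm ?fast_gt0.
pose c t := k (s0 + a t) (r0 + b t).
have sc : csmooth setT c.
  by apply: fk; apply: csmoothD => //; exact: csmooth_cst.
have [d d0 [M HM]] := csmooth_bounded 0 (csmooth_iterT hE n sc) sp.
have [m0 m0d] := pow4_small d0.
pose m := maxn m0 (Num.truncn M).+1.
have m0' : 0 < (4 ^+ m)^-1 :> R by rewrite invr_gt0 pow4_gt0.
have md : `|(4 ^+ m)^-1| < d.
  rewrite gtr0_norm //; apply: le_lt_trans m0d.
  by rewrite lef_pV2 ?posrE ?pow4_gt0 // ler_weXn2l ?ler1n // leq_maxl.
have := HM _ md; rewrite add0r.
(* Near 4^-m the special curve is horizontal with constant speed [fast m], so the n-th derivative of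
   [c] carries the factor [fast m ^+ n]. It cancels the denominator in the choice of [x m]. *)
have -> : dn n c (4 ^+ m)^-1 = fast m ^+ n *: pdn n k (x m).1 (x m).2.
  pose al := (x m).1 - fast m * (4 ^+ m)^-1.
  rewrite (@iter_cderive_near _ _ _ _ (fun t => k (fast m * t + al) (x m).2)).
    rewrite (@iter_cderive_affine _ _ hE n (fun s => k s (x m).2)); last exact: smooth_fam_row.
    by rewrite /pdn /al addrC subrK.
  apply/nbhs_ballP; exists ((4 ^+ m)^-1 / 4) => /=; first by rewrite divr_gt0.
  move=> t; rewrite /ball /= => /ltW ht.
  have := ab m (t - (4 ^+ m)^-1); rewrite distrC ht => /(_ isT) [].
  rewrite addrC subrK /c => -> ->.
  by congr k; rewrite /al; ring.
have fm : 0 < fast m ^+ n :> R by apply: exprn_gt0; exact: fast_gt0.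
rewrite cseminormZ // gtr0_norm // => h2.
have [_ _] := Hx m; rewrite ltr_pdivrMr // mulrC => h1.
have : (Num.truncn M).+1%:R <= M.
  apply: (@le_trans _ _ m%:R); first by rewrite ler_nat leq_maxr.
  by apply: le_trans (ltW h1) h2.
by rewrite leNgt truncnS_gt.
Qed.

(** The moment conditions form a Vandermonde system for the distinct nodes 0, ..., n+1. One node
    more than an n-th difference requires makes the moment of order n+1 vanish too, so the error is
    of order n+2. *)
Lemma difference_weights n : exists e : nat -> R, forall i, (i < n.+2)%N ->
  \sum_(j < n.+2) e j * j%:R ^+ i = n`!%:R * (i == n)%:R.
Proof.
pose a : 'rV[R]_(n.+2) := \row_j (j : nat)%:R.
pose V := Vandermonde n.+2 a.
have detV : \det V != 0.
  rewrite det_Vandermonde; apply/prodf_neq0 => i _; apply/prodf_neq0 => j ij.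
  by rewrite !mxE subr_eq0 eqr_nat gtn_eqF.
pose dlt : 'cV[R]_(n.+2) := \col_i (n`!%:R * (i == n :> nat)%:R).
pose e := invmx V *m dlt.
have Ve : V *m e = dlt by rewrite mulmxA mulmxV ?mul1mx // unitmxE unitfE.
exists (fun j => e (inord j) 0) => i hi.
have /matrixP/(_ (Ordinal hi) 0) := Ve; rewrite !mxE /= => <-.
by apply: eq_bigr => j _; rewrite !mxE /= mulrC inord_val.
Qed.

(* The weights cancel all Taylor coefficients of order at most n + 1 except the n-th. *)
Lemma difference_bound n k t p (e : nat -> R) : smooth_fam k -> cseminorm p ->
  (forall i, (i < n.+2)%N -> \sum_(j < n.+2) e j * j%:R ^+ i = n`!%:R * (i == n)%:R) ->
  exists2 d, 0 < d & exists2 C, 0 <= C & forall s r, `|s| < d -> `|r| < d ->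
    p (s ^+ n *: pdn n k 0 (t + r) - \sum_(j < n.+2) e j *: k (j%:R * s) (t
      + r)) <= C * `|s| ^+ n.+2.
Proof.
move=> fk sp He; have [d d0 [M HM]] := pdn_bounded n.+2 0 t fk sp.
have M0 : 0 <= M by apply: le_trans (HM 0 t _ _); rewrite ?subrr ?normr0 //; exact: cseminorm_ge0.
have N0 : 0 < n.+2%:R :> R by rewrite ltr0n.
(* All nodes j s with j <= n + 1 then stay within [d] of 0. *)
exists (d / n.+2%:R); first by rewrite divr_gt0.
exists (\sum_(j < n.+2) `|e j| * (M * n.+2%:R ^+ n.+2)).
  by apply: sumr_ge0 => j _; rewrite mulr_ge0 // mulr_ge0 // exprn_ge0.
move=> s r; rewrite !ltr_pdivlMr // => sd rd.
pose f x := k x (t + r).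
have sf : csmooth setT f by exact: smooth_fam_row.
have rd' : `|t + r - t| < d.
  rewrite addrAC subrr add0r; apply: le_lt_trans rd.
  by rewrite ler_peMr // ler1n.
have -> : s ^+ n *: pdn n k 0 (t + r) = \sum_(j < n.+2) e j *: taylor n.+2 f (j%:R * s).
  rewrite /taylor.
  under eq_bigr => j _ do rewrite scaler_sumr.
  rewrite exchange_big /=.
  have nn : (n < n.+2)%N by [].
  have sumE i : (i < n.+2)%N -> \sum_(j < n.+2) e j *: ((i`!%:R^-1 * (j%:R * s) ^+ i) *: dn i f 0) =
      (i`!%:R^-1 * s ^+ i * (n`!%:R * (i == n)%:R)) *: dn i f 0.
    move=> hi; rewrite -(He i hi) mulr_sumr scaler_suml; apply: eq_bigr => j _.
    by rewrite scalerA exprMn; congr (_ *: _); ring.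
  rewrite (bigD1 (Ordinal nn)) //= sumE // eqxx mulr1 big1 => [|i iN].
    have f0 : n`!%:R != 0 :> R by rewrite pnatr_eq0 -lt0n fact_gt0.
    by rewrite addr0 /pdn; congr (_ *: _); rewrite mulrAC mulVf // mul1r.
  rewrite sumE //; move: iN; rewrite -val_eqE /= => /negbTE ->.
  by rewrite !mulr0 scale0r.
rewrite -sumrB.
under eq_bigr => j _ do rewrite -scalerBr.
apply: le_trans (cseminorm_sum _ _ sp) _; rewrite mulr_suml; apply: ler_sum => j _.
rewrite -mulrA; apply: cseminormZ_le => //; rewrite cseminormB //.
apply: (@le_trans _ _ (M * `|j%:R * s| ^+ n.+2)).
  apply: taylor_bound => // x xs; apply: HM => //; rewrite subr0.
  apply: le_lt_trans xs _; rewrite normrM normr_nat mulrC; apply: le_lt_trans sd.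
  by rewrite ler_wpM2l // ler_nat ltnW.
rewrite -mulrA; apply: ler_wpM2l => //; rewrite normrM normr_nat exprMn ler_wpM2r ?exprn_ge0 //.
by rewrite lerXn2r ?nnegrE ?ler0n // ler_nat ltnW.
Qed.

(** The n-th derivative times s^n is within O(s^(n+2)) of a finite difference, uniformly in [r].
    Once a small [s] is fixed, that difference is a finite sum of functions continuous in [r]. *)
Lemma pdn_continuous n k t p e : smooth_fam k -> cseminorm p -> 0 < e ->
  exists2 d, 0 < d & forall r, `|r| < d -> p (pdn n k 0 (t + r) - pdn n k 0 t) <= e.
Proof.
move=> fk sp e0; have [w Hw] := difference_weights n.
have [d d0 [C C0 HC]] := difference_bound t fk sp Hw.
pose s := Num.min (d / 2) (Num.min 1 (e / (4 * (1 + C)))).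
have s0 : 0 < s by rewrite /s !lt_min ltr01 !divr_gt0 //; lra.
have sd : `|s| < d by rewrite gtr0_norm // /s gt_min; apply/orP; left; lra.
have s1 : s <= 1 by rewrite /s !ge_min lexx !orbT.
have sC : s * (4 * (1 + C)) <= e.
  by rewrite -ler_pdivlMr; [rewrite /s !ge_min lexx !orbT|lra].
pose S := \sum_(j < n.+2) `|w j|.
have S0 : 0 <= S by apply: sumr_ge0.
have e' : 0 < e * s ^+ n / (2 * (1 + S)) by rewrite divr_gt0 ?mulr_gt0 ?exprn_gt0 //; lra.
have [d' d'0 Hd'] : exists2 d', 0 < d' & forall r, `|r| < d' -> forall j : 'I_n.+2,
    p (k (j%:R * s) (t + r) - k (j%:R * s) t) <= e * s ^+ n / (2 * (1 + S)).
  have /fin_all_exists2[D D0 HD] : forall j : 'I_n.+2, exists2 d', 0 < d' & forall r, `|r| < d' ->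
      p (k (j%:R * s) (t + r) - k (j%:R * s) t) <= e * s ^+ n / (2 * (1 + S)).
    by move=> j; exact: csmooth_continuous (smooth_fam_col _ fk) sp e'.
  exists (\big[Num.min/1]_(j < n.+2) D j).
    by elim/big_ind: _ => // x y x0 y0; rewrite lt_min x0.
  move=> r hr j; apply: HD; apply: lt_le_trans hr _.
  by rewrite (bigD1 j) //= ge_min lexx.
exists (Num.min d d'); first by rewrite lt_min d0.
move=> r; rewrite lt_min => /andP[rd rd'].
have h1 := HC s r sd rd; have := HC s 0 sd _; rewrite normr0 addr0 => /(_ d0) h0.
rewrite -(ler_pM2l (exprn_gt0 n s0)) -[X in X * p _]gtr0_norm ?exprn_gt0 // -cseminormZ //.
set X := \sum_(j < _) _ in h1; set X0 := \sum_(j < _) _ in h0.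
have hX : p (X - X0) <= s ^+ n * e / 2.
  rewrite /X /X0 -sumrB.
  under eq_bigr => j _ do rewrite -scalerBr.
  apply: le_trans (cseminorm_sum _ _ sp) _.
  apply: (@le_trans _ _ (\sum_(j < n.+2) `|w j| * (e * s ^+ n / (2 * (1 + S))))).
    by apply: ler_sum => j _; apply: cseminormZ_le => //; exact: Hd'.
  rewrite -mulr_suml -/S mulrA ler_pdivrMr; last lra.
  have : 0 <= e * s ^+ n by rewrite mulr_ge0 ?exprn_ge0 // ltW.
  set z := e * _ => z0; have -> : s ^+ n * e / 2 * (2 * (1 + S)) = z * (1 + S) by rewrite /z; field.
  by rewrite mulrC ler_wpM2l //; lra.
have hs : C * `|s| ^+ n.+2 <= s ^+ n * e / 4.
  rewrite gtr0_norm // !exprS.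
  have -> : C * (s * (s * s ^+ n)) = s ^+ n * (C * s * s) by ring.
  rewrite -[s ^+ n * e / 4]mulrA ler_wpM2l ?exprn_ge0 ?(ltW s0) //.
  apply: (@le_trans _ _ (C * s)); first by rewrite ler_piMr // mulr_ge0 // ltW.
  rewrite ler_pdivlMr //; lra.
have -> : s ^+ n *: (pdn n k 0 (t + r) - pdn n k 0 t) =
  (s ^+ n *: pdn n k 0 (t + r) - X) - (s ^+ n *: pdn n k 0 t - X0) + (X - X0).
  by move: X X0 h1 h0 hX => X X0 _ _ _; lmod_coefs R E.
apply: le_trans (_ : _ <= (s ^+ n * e / 4 + s ^+ n * e / 4) + s ^+ n * e / 2) _; last lra.
apply: cseminormD_le => //; apply: cseminormD_le => //; first exact: le_trans hs.
by rewrite cseminormN //; exact: le_trans hs.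
Qed.

(* The core of Boman's theorem. Taking finite differences with step [r] shows that
   [pdn n k 0 (t + r)] agrees up to O(r^2) with [H r / r^n], where [H] is a smooth curve; so the
   latter is a smooth Hadamard quotient, and both have the same value and derivative at r = 0. *)
Lemma pdn_derivable n k : smooth_fam k -> exists2 K, smooth_fam K &
  forall t, is_cderive (pdn n k 0) t (pdn n.+1 K 0 t).
Proof.
move=> fk; have [w Hw] := difference_weights n.
(* The curve [H] below is (n+1)! times [K ^~ t]. Since [hadamard n H] has derivative H^(n+1)(0) /
   (n+1)! at 0, that derivative equals [pdn n.+1 K 0 t]. *)
pose K s t := (n.+1`!%:R)^-1 *: \sum_(j < n.+2) w j *: k (j%:R * s) (t + s).
have fK : smooth_fam K.
  move=> a b sa sb; apply: csmooth_cstZ; apply: csmooth_sum => j; apply: csmooth_cstZ.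
  by apply: fk; [apply: (@csmooth_cstZ _ R^o)|apply: csmoothD].
exists K => // t.
pose H r := \sum_(j < n.+2) w j *: k (j%:R * r) (t + r).
have sH : csmooth setT H.
  apply: csmooth_sum => j; apply: csmooth_cstZ; apply: fk.
    by apply: (@csmooth_cstZ _ R^o); exact: csmooth_id.
  by apply: csmoothD; [exact: (@csmooth_cst _ R^o)|exact: csmooth_id].
have -> : pdn n.+1 K 0 t = (n.+1`!%:R)^-1 *: dn n.+1 H 0 by exact: (iter_cderiveZ hE n.+1 _ 0 sH).
pose A r := pdn n k 0 (t + r).
have A0 : A 0 = pdn n k 0 t by rewrite /A addr0.
have est p : cseminorm p -> exists2 d, 0 < d & exists2 C, 0 <= C & forall r, `|r| < d ->
    p (A r) <= C /\ p (r ^+ n *: A r - H r) <= C * `|r| ^+ n.+2.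
  move=> sp; have [d d0 [C C0 HC]] := difference_bound t fk sp Hw.
  have [d' d'0 [M HM]] := pdn_bounded n 0 t fk sp.
  exists (Num.min d d'); first by rewrite lt_min d0.
  exists (Num.max C M); first by rewrite le_max C0.
  move=> r; rewrite lt_min => /andP[rd rd']; split.
    rewrite le_max; apply/orP; right; apply: HM; first by rewrite subrr normr0.
    by rewrite addrAC subrr add0r.
  apply: le_trans (HC r r rd rd) _; rewrite ler_wpM2r ?exprn_ge0 //.
  by rewrite le_max lexx.
have Hbound p : cseminorm p -> exists2 d, 0 < d & exists2 C, 0 <= C & forall r, `|r| < d ->
    p (H r) <= C * `|r| ^+ n.
  move=> sp; have [d d0 [C C0 HC]] := est p sp.
  exists (Num.min d 1); first by rewrite lt_min d0 ltr01.
  exists (C + C); first exact: addr_ge0.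
  move=> r; rewrite lt_min => /andP[rd r1]; have [h1 h2] := HC r rd.
  rewrite -[H r](subrK (r ^+ n *: A r)) mulrDl; apply: cseminormD_le => //.
    rewrite cseminormB //; apply: le_trans h2 _; apply: ler_wpM2l => //.
    rewrite !exprS; have r0 := normr_ge0 r; have rn0 : 0 <= `|r| ^+ n by rewrite exprn_ge0.
    by rewrite mulrA ler_piMl // mulr_ile1 // ltW.
  by rewrite mulrC; apply: cseminormZ_le; rewrite ?normrX.
(* By strong induction: if the lower derivatives vanish, [hadamard i H r] is H r / r^i = O(r^(n-i)),
   which tends to 0 since i < n, and its limit is H^(i)(0) / i!. *)
have dH0 i : (i < n)%N -> dn i H 0 = 0.
  have [m] := ubnP i; elim: m i => // m IH i im ltin.
  have T0 r : taylor i H r = 0.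
    by rewrite /taylor big1 // => j _; rewrite IH ?scaler0 //;
     [exact: leq_trans (ltn_ord j) im|exact: ltn_trans (ltn_ord j) ltin].
  suff : (i`!%:R)^-1 *: dn i H 0 = 0.
    move/eqP; rewrite scaler_eq0 invr_eq0 pnatr_eq0 -leqn0 leqNgt fact_gt0 /=.
    by move/eqP.
  apply: (hausdorff_cseminorm hE) => p sp; rewrite -hadamard0.
  apply/le_anti/andP; split; last exact: cseminorm_ge0.
  apply/ler_addgt0Pr => e e0; rewrite add0r.
  have e2 : 0 < e / 2 by lra.
  have [d d0 Hd] := is_cderive_cont (is_cderive_hadamard0 hE (n := i) sH) sp e2.
  have [d' d'0 [C C0 HC]] := Hbound p sp.
  have [|r r0 /and5P[rd rd' /ltW r1 rC _]] := @small_pos R [:: d; d'; 1; e / 2 / (1 + C)].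
    by rewrite /= d0 d'0 ltr01 divr_gt0 //; lra.
  move: rC; rewrite ltr_pdivlMr => [/ltW rC|]; last lra.
  rewrite -(gtr0_norm r0) in rd rd'.
  have := Hd r rd; rewrite add0r cseminormB // => h1.
  rewrite -(subrK (hadamard i H r) (hadamard i H 0)).
  have -> : e = e / 2 + e / 2 by lra.
  apply: cseminormD_le => //; rewrite hadamardE ?gt_eqF // T0 subr0 cseminormZ //.
  rewrite normfV normrX gtr0_norm // mulrC ler_pdivrMr ?exprn_gt0 //.
  apply: le_trans (HC r rd') _; rewrite gtr0_norm //.
  rewrite -(subnK ltin) addnS exprS exprD.
  have q1 : r ^+ (n - i.+1) <= 1 by rewrite exprn_ile1 // ltW.
  have q0 : 0 <= r ^+ (n - i.+1) by rewrite exprn_ge0 // ltW.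
  have ri : 0 <= r ^+ i by rewrite exprn_ge0 // ltW.
  have -> : C * (r * (r ^+ (n - i.+1) * r ^+ i)) = (C * r * r ^+ (n - i.+1)) * r ^+ i by ring.
  rewrite ler_wpM2r //; have Cr : 0 <= C * r by rewrite mulr_ge0 // ltW.
  by apply: (@le_trans _ _ (C * r)); [rewrite ler_piMr|lra].
have TH r : taylor n H r = 0 by rewrite /taylor big1 // => j _; rewrite dH0 ?scaler0.
have close p : cseminorm p -> exists2 d, 0 < d & exists2 C, 0 <= C & forall r, r != 0 -> `|r| < d ->
    p (A r - hadamard n H r) <= C * (`|r| * `|r|).
  move=> sp; have [d d0 [C C0 HC]] := est p sp; exists d => //; exists C => // r rN0 rd.
  rewrite hadamardE // TH subr0.
  have rn : r ^+ n != 0 by rewrite expf_neq0.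
  have -> : A r - (r ^+ n)^-1 *: H r = (r ^+ n)^-1 *: (r ^+ n *: A r - H r).
    by rewrite scalerBr scalerA mulVf // scale1r.
  rewrite cseminormZ // normfV normrX mulrC ler_pdivrMr ?exprn_gt0 ?normr_gt0 //.
  have [_ h] := HC r rd; apply: le_trans h _.
  by rewrite !exprS !mulrA.
(* The estimate [close] says nothing at r = 0; there the two values are identified by continuity,
   which for [A] is [pdn_continuous]. *)
have Ahad : A 0 = hadamard n H 0.
  apply/eqP; rewrite -subr_eq0; apply/eqP; apply: (hausdorff_cseminorm hE) => p sp.
  apply/le_anti/andP; split; last exact: cseminorm_ge0.
  apply/ler_addgt0Pr => e e0; rewrite add0r.
  have e3 : 0 < e / 3 by lra.
  have [d1 d10 H1] := is_cderive_cont (is_cderive_hadamard0 hE (n := n) sH) sp e3.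
  have [d2 d20 [C C0 H2]] := close p sp.
  have [d3 d30 H3] := pdn_continuous n t fk sp e3.
  have [|r r0 /and5P[rd1 rd2 rd3 /ltW r1 /andP[rC _]]] := @small_pos R [:: d1; d2; d3; 1;
    e / 3 / (1 + C)].
    by rewrite /= d10 d20 d30 ltr01 divr_gt0 //; lra.
  move: rC; rewrite ltr_pdivlMr => [/ltW rC|]; last lra.
  have nr : `|r| = r by rewrite gtr0_norm.
  have := H1 r; rewrite add0r nr => /(_ rd1) h1.
  have := H2 r; rewrite nr gt_eqF // => /(_ isT rd2) h2.
  have := H3 r; rewrite nr => /(_ rd3) h3.
  have -> : A 0 - hadamard n H 0 = - (A r - A 0) + (A r - hadamard n H r)
    + (hadamard n H r - hadamard n H 0).
    by move: (A r) (A 0) (hadamard n H r) (hadamard n H 0) => x y z u; lmod_coefs R E.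
  have -> : e = e / 3 + e / 3 + e / 3 by lra.
  apply: cseminormD_le => //; apply: cseminormD_le => //; first by rewrite cseminormN // A0.
  apply: le_trans h2 _; apply: le_trans rC; rewrite mulrA [C * r]mulrC -mulrA ler_wpM2l ?(ltW
    r0) //.
  by apply: le_trans (_ : C <= _); [rewrite ler_piMr|lra].
apply/is_cderiveP => p e sp e0.
have e2 : 0 < e / 2 by lra.
have [d1 d10 H1] := (is_cderiveP _ _ _).1 (is_cderive_hadamard0 hE (n := n) sH) p _ sp e2.
have [d2 d20 [C C0 H2]] := close p sp.
exists (Num.min d1 (Num.min d2 (e / 2 / (1 + C)))); first by rewrite !lt_min d10 d20 divr_gt0 //;
  lra.
move=> r; rewrite !lt_min => /andP[rd1 /andP[rd2]]; rewrite ltr_pdivlMr; last lra.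
move=> rC; have [->|rN0] := eqVneq r 0.
  by rewrite addr0 subrr scale0r subrr normr0 mulr0 cseminorm0.
have := H1 r rd1; rewrite add0r -Ahad => h1.
have := H2 r rN0 rd2 => h2.
rewrite -/(A r) -A0; set L := _ *: _ in h1 *.
have -> : A r - A 0 - L = (A r - hadamard n H r) + (hadamard n H r - A 0 - L).
  by move: (A r) (A 0) (hadamard n H r) => x y z; lmod_coefs R E.
have -> : e * `|r| = e / 2 * `|r| + e / 2 * `|r| by lra.
apply: cseminormD_le => //; apply: le_trans h2 _; rewrite mulrA ler_wpM2r // mulrC.
by have := normr_ge0 r; lra.
Qed.

End Families.

Section PartialDerivatives.
Context {R : realType} {E : tvsType R}.
Hypothesis hE : hausdorff_space E.
Implicit Types (k : R -> R -> E).

(** The derivative of [pdn n k 0] has the same form for another family, so the induction runs over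
    all [n] and [k] at once. *)
Lemma csmooth_pdn n k : smooth_fam k -> csmooth setT (pdn n k 0).
Proof.
move=> fk m; elim: m n k fk => // m IH n k fk.
by have [K fK HK] := pdn_derivable hE n fk; exists (pdn n.+1 K 0) => [t _|]; [exact: HK|exact: IH].
Qed.

Definition pd1 k (s r : R) : E := cderive (fun x => k x r) s.
Definition pd2 k (s r : R) : E := cderive (k s) r.

Lemma is_cderive_pd1 k s r : smooth_fam k -> is_cderive (fun x => k x r) s (pd1 k s r).
Proof. by move=> fk; apply: cderive_csmooth; exact: smooth_fam_row. Qed.

Lemma is_cderive_pd2 k s r : smooth_fam k -> is_cderive (k s) r (pd2 k s r).
Proof. by move=> fk; apply: cderive_csmooth; exact: smooth_fam_col. Qed.

(** Shifting the first argument along the curve [a] moves the point of differentiation to 0, where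
    [csmooth_pdn] applies with n = 1. *)
Lemma smooth_fam_pd1 k : smooth_fam k -> smooth_fam (pd1 k).
Proof.
move=> fk a b sa sb.
pose k' s t := k (a t + s) (b t).
have fk' : smooth_fam k'.
  move=> a' b' sa' sb'; apply: fk; last exact: (csmooth_comp (W := setT)).
  by apply: csmoothD => //; exact: (csmooth_comp (W := setT)).
apply: csmooth_eq (csmooth_pdn 1 fk'); first exact: openT.
move=> t _; rewrite /pdn /=; apply: cderive_val => //.
apply: (@is_cderive_shift _ _ (fun x => k x (b t)) (a t)).
by rewrite addr0; exact: is_cderive_pd1.
Qed.

Lemma smooth_fam_pd2 k : smooth_fam k -> smooth_fam (pd2 k).
Proof. by move=> fk; apply: smooth_fam_flip; apply: smooth_fam_pd1; exact: smooth_fam_flip. Qed.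

(** The increment is split at (t, t + h): the horizontal leg is controlled by the mean value
    inequality and the joint continuity of [pd1 k], the vertical one by the definition of [pd2]. *)
Lemma is_cderive_diag k t : smooth_fam k ->
  is_cderive (fun s => k s s) t (pd1 k t t + pd2 k t t).
Proof.
move=> fk; apply/is_cderiveP => p e sp e0.
have e2 : 0 < e / 2 by lra.
have [d1 d10 H1] := smooth_fam_continuous t t (smooth_fam_pd1 fk) sp e2.
have [d2 d20 H2] := (is_cderiveP _ _ _).1 (@is_cderive_pd2 k t t fk) p _ sp e2.
exists (Num.min d1 d2); first by rewrite lt_min d10.
move=> h; rewrite lt_min => /andP[hd1 /H2 h2].
have h1 : p ((k (t + h) (t + h) - (t + h) *: pd1 k t t) - (k t (t
  + h) - t *: pd1 k t t)) <= e / 2 * `|t + h - t|.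
  apply: (@mean_value_abs _ _ (fun s => k s (t + h) - s *: pd1 k t t) (fun s =>
    pd1 k s (t + h) - pd1 k t t) p t (t + h)) => // s.
    move=> _; apply: is_cderiveB; first exact: is_cderive_pd1.
    have := is_cderiveZ (@is_cderive_id R s) (is_cderive_cst (pd1 k t t) s).
    by rewrite scaler0 addr0 scale1r.
  have -> : t + h - t = h by ring.
  move=> sh; apply: H1; first exact: le_lt_trans sh hd1.
  by have -> : t + h - t = h by ring.
move: h1; have -> : t + h - t = h by ring.
move: h2; move: (k _ _) (k (t + h) _) (k t t) (pd1 k t t) (pd2 k t t) => x y z u v h2 h1.
have -> : e * `|h| = e / 2 * `|h| + e / 2 * `|h| by lra.
have -> : y - z - h *: (u + v) = ((y - (t + h) *: u) - (x - t *: u)) + (x - z - h *: v).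
  by lmod_coefs R E.
exact: cseminormD_le.
Qed.

Let mixed k s r h := k (s + h) (r + h) - k (s + h) r - k s (r + h) + k s r.

(** The mean value inequality is applied once in each variable, to [k] corrected by a multiple of s
    r. *)
Let mixed_diff k s r p e : smooth_fam k -> cseminorm p -> 0 < e ->
  exists2 d, 0 < d & forall h, `|h| < d ->
    p (mixed k s r h - (h * h) *: pd2 (pd1 k) s r) <= e * (`|h| * `|h|).
Proof.
move=> fk sp e0; have fk1 := smooth_fam_pd1 fk; have fk12 := smooth_fam_pd2 fk1.
have [d d0 H] := smooth_fam_continuous s r fk12 sp e0; exists d => // h hd.
set L := pd2 (pd1 k) s r.
have addK (x : R) : x + h - x = h by ring.
have der (x y : R) : is_cderive (fun z => (y * z) *: L) x (y *: L).
  have := is_cderiveZ (@is_cderive_affine _ y 0 x) (is_cderive_cst L x).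
  by rewrite scaler0 addr0; apply: is_cderive_ext => z; rewrite addr0.
have inner x : `|x - s| <= `|h| -> p (pd1 k x (r + h) - pd1 k x r - h *: L) <= e * `|h|.
  move=> xs; have -> : pd1 k x (r + h) - pd1 k x r - h *: L =
      (pd1 k x (r + h) - (1 * (r + h)) *: L) - (pd1 k x r - (1 * r) *: L).
    by move: (pd1 _ _ _) (pd1 _ _ _) => X Y; lmod_coefs R E.
  rewrite -{3}(addK r).
  apply: (@mean_value_abs _ _ (fun y => pd1 k x y - (1 * y) *: L) (fun y =>
    pd2 (pd1 k) x y - 1 *: L) p r (r + h)) => // y; rewrite addK => yr.
    by apply: is_cderiveB; [exact: is_cderive_pd2|exact: der].
  by rewrite scale1r; apply: H; [exact: le_lt_trans hd|exact: le_lt_trans hd].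
have -> : mixed k s r h - (h * h) *: L =
    (k (s + h) (r + h) - k (s + h) r - (h * (s + h)) *: L) - (k s (r + h) - k s r - (h * s) *: L).
  rewrite /mixed; move: (k (s + h) (r + h)) (k (s + h) r) (k s (r + h)) (k s r) => X Y Z U.
  by lmod_coefs R E.
rewrite mulrA; apply: le_trans (_ : _ <= e * `|h| * `|s + h - s|) _; last by rewrite addK.
apply: (@mean_value_abs _ _ (fun x => k x (r + h) - k x r - (h * x) *: L) (fun x =>
  pd1 k x (r + h) - pd1 k x r - h *: L) p s (s + h)) => // x; rewrite addK => xs.
  by apply: is_cderiveB; [apply: is_cderiveB; exact: is_cderive_pd1|exact: der].
exact: inner.
Qed.

(** The second difference [mixed] is symmetric in the two variables, so both mixed derivatives
    approximate it divided by h^2. *)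
Lemma pd_comm k s r : smooth_fam k -> pd2 (pd1 k) s r = pd1 (pd2 k) s r.
Proof.
move=> fk; apply/eqP; rewrite -subr_eq0; apply/eqP.
apply: (hausdorff_cseminorm hE) => p sp.
apply/le_anti/andP; split; last exact: cseminorm_ge0.
apply/ler_addgt0Pr => e e0; rewrite add0r.
have e2 : 0 < e / 2 by lra.
have [d d0 H] := mixed_diff s r fk sp e2.
have [d' d'0 H'] := mixed_diff r s (smooth_fam_flip fk) sp e2.
have [|h h0 /and3P[hd hd' _]] := @small_pos R [:: d; d']; first by rewrite /= d0 d'0.
have nh : `|h| = h by rewrite gtr0_norm.
have := H h; rewrite nh => /(_ hd) h1; have := H' h; rewrite nh => /(_ hd') h2.
have hh : 0 < h * h by rewrite mulr_gt0.
rewrite -(ler_pM2l hh) -[X in X * p _](gtr0_norm hh) -cseminormZ //.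
have -> : (h * h) *: (pd2 (pd1 k) s r - pd1 (pd2 k) s r) =
  - (mixed k s r h - (h * h) *: pd2 (pd1 k) s r) + (mixed (fun s r =>
    k r s) r s h - (h * h) *: pd1 (pd2 k) s r).
  rewrite /mixed; move: (k (s + h) (r + h)) (k (s + h) r) (k s (r + h)) (k s r) => X Y Z U.
  move: (pd2 _ _ _) (pd1 _ _ _) => V W; lmod_coefs R E.
have -> : h * h * e = e / 2 * (h * h) + e / 2 * (h * h) by field.
by apply: cseminormD_le h2 => //; rewrite cseminormN.
Qed.

End PartialDerivatives.

Section ChainRule.
Context {R : realType} {E F : tvsType R}.
Hypotheses (hE : hausdorff_space E) (hF : hausdorff_space F).

(* Writing y (t + s) = y t + s q s with [q] smooth, f (y (t + s)) is the diagonal of the family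
   f (y t + s q r); cutoffs keep the arguments of [f] inside [U]. *)
Lemma smooth_chain (U : set E) (f : E -> F) (y : R -> E) t :
  cinf_open U -> smooth_map_on U f -> csmooth setT y -> U (y t) ->
  is_cderive (fun s => f (y s)) t (dirderive f (y t) (cderive y t)).
Proof.
move=> oU sf sy Uy.
pose c s := y (t + s).
have shift : csmooth setT (fun s : R => t + s : R^o).
  by apply: csmoothD; [exact: (@csmooth_cst _ R^o)|exact: csmooth_id].
have sc : csmooth setT c by exact: (csmooth_comp (W := setT)).
pose q := hadamard 1 c; have sq : csmooth setT q by exact: csmooth_hadamard.
have cq s : c s = c 0 + s *: q s.
  have := hadamardS 0 c s; rewrite /= fact0 invr1 scale1r => <-.
  have [->|s0] := eqVneq s 0; first by rewrite hadamard0 fact0 invr1 scale1r.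
  by rewrite hadamardE // /taylor big_ord0 expr0 invr1 scale1r subr0.
have c0 : c 0 = y t by rewrite /c addr0.
have q0 : q 0 = cderive y t.
  rewrite /q hadamard0 (_ : 1`! = 1%N) // invr1 scale1r /=; apply: cderive_val => //.
  by apply: is_cderive_shift; rewrite addr0; exact: cderive_csmooth.
(* [U] is open only along smooth curves; [plane_open] still yields a full square of parameters on
   which [f] may be evaluated. *)
have [||d d0 Hd] := @plane_open R (fun s r => U (c 0 + s *: q r)) 0 0.
- move=> a b sa sb Uab.
  have sm : csmooth setT (fun h => c 0 + a h *: q (b h)).
    apply: csmoothD; first exact: csmooth_cst.
    by apply: csmoothZ => //; exact: (csmooth_comp (W := setT)).
  have /oU op := (smooth_curveP _ hE).2 sm.
  have : nbhs (0 : R) [set h | U (c 0 + a h *: q (b h))] by apply: open_nbhs_nbhs.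
  by move=> /near0P.
- by rewrite scale0r addr0 c0.
have [phi [sphi phi_id phi_small]] := smooth_cutoff 0 d0.
pose k s r := f (c 0 + phi s *: q (phi r)).
have fk : smooth_fam k.
  move=> a b sa sb; apply/smooth_curveP => //; apply: sf.
    apply/smooth_curveP => //; apply: csmoothD; first exact: csmooth_cst.
    apply: csmoothZ; first exact: (csmooth_comp (W := setT)).
    by apply: (csmooth_comp (W := setT)) => //; exact: (csmooth_comp (W := setT)).
  by move=> s; apply: Hd; rewrite ?subr0; [have := phi_small (a s)|have := phi_small (b s)];
    rewrite subr0.
have phi_near : \forall s \near (0 : R), phi s = s.
  apply/near0P; exists (d / 4); first by rewrite divr_gt0.
  by move=> s /ltW; have := phi_id s; rewrite subr0.
have phi0 : phi 0 = 0 by exact: nbhs_singleton phi_near.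
have H := is_cderive_diag hF (t := 0) fk.
have pd1E : pd1 k 0 0 = dirderive f (y t) (cderive y t).
  rewrite /pd1 /dirderive -q0 -c0; apply: cderive_near.
  by apply: filterS phi_near => s es; rewrite /k es phi0.
have pd2E : pd2 k 0 0 = 0.
  rewrite /pd2; apply: cderive_val => //; apply: is_cderive_ext (is_cderive_cst (f (c 0)) 0) => s.
  by rewrite /k phi0 scale0r addr0.
rewrite pd1E pd2E addr0 in H.
have {}H : is_cderive (fun s => f (c s)) 0 (dirderive f (y t) (cderive y t)).
  apply: is_cderive_near H; apply: filterS phi_near => s es.
  by rewrite /k es -cq.
have H' : is_cderive (fun s => f (c (- t + s))) t (dirderive f (y t) (cderive y t)).
  by apply: (@is_cderive_shift _ _ (fun s => f (c s)) (- t)); rewrite addNr.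
by apply: is_cderive_ext H' => s; rewrite /c addrA subrr add0r.
Qed.

End ChainRule.

(** * Manifolds *)

Section Localize.
Context {R : realType}.

Lemma localize (V : set R) t : open V -> V t -> exists phi : R -> R^o,
  [/\ csmooth setT phi, \forall s \near t, phi s = s & forall s, V (phi s)].
Proof.
move=> oV Vt; have /nbhs_ballP[d /= d0 dV] : nbhs t V by apply: open_nbhs_nbhs.
have [phi [sphi phi_id phi_small]] := smooth_cutoff t d0; exists phi; split => //.
  apply/nbhs_ballP; exists (d / 4) => /=; first by rewrite divr_gt0.
  by move=> s; rewrite /ball /= distrC => /ltW /phi_id.
by move=> s; apply: dV; rewrite /ball /= distrC.
Qed.

Lemma csmooth_preimage_open (f : R -> R^o) (V : set R) : csmooth setT f -> open V ->
  open (f @^-1` V).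
Proof. by move=> /continuous_csmooth cf oV; apply: open_comp => // x _; exact: cf. Qed.

Lemma csmooth_compT {E : tvsType R} (c : R -> E) (f : R -> R^o) :
  csmooth setT c -> csmooth setT f -> csmooth setT (fun t => c (f t)).
Proof. exact: csmooth_comp. Qed.

End Localize.

Section Linearity.
Context {R : realType} {E F : tvsType R}.
Hypotheses (hE : hausdorff_space E) (hF : hausdorff_space F).
Variables (U : set E) (f : E -> F) (x : E).
Hypotheses (oU : cinf_open U) (sf : smooth_map_on U f) (Ux : U x).

Lemma is_cderive_dirderive v : is_cderive (fun h => f (x + h *: v)) 0 (dirderive f x v).
Proof.
have sl : csmooth setT (fun h : R => x + h *: v).
  by apply: csmoothD; [exact: csmooth_cst|apply: csmoothZ; [exact: csmooth_id|exact: csmooth_cst]].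
have Ul : U (x + 0 *: v) by rewrite scale0r addr0.
by have := smooth_chain hE hF oU sf sl Ul; exact: is_cderive_cderive.
Qed.

Lemma dirderiveZ a v : dirderive f x (a *: v) = a *: dirderive f x v.
Proof.
apply: cderive_val => //.
have H : is_cderive (fun h => f (x + h *: v)) (a * 0 + 0) (dirderive f x v).
  by rewrite mulr0 addr0; exact: is_cderive_dirderive.
apply: is_cderive_ext (is_cderive_comp (@is_cderive_affine R a 0 0) H) => h.
by rewrite addr0 scalerA mulrC.
Qed.

(** The diagonal rule for the family f (x + s u + r v), with cutoffs that keep its arguments in
    [U]. *)
Lemma dirderiveD u v : dirderive f x (u + v) = dirderive f x u + dirderive f x v.
Proof.
have sl (a b : R -> R^o) : csmooth setT a -> csmooth setT b -> csmooth setT (fun h =>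
  x + a h *: u + b h *: v).
  move=> sa sb; apply: csmoothD; last by apply: csmoothZ => //; exact: csmooth_cst.
  by apply: csmoothD; [exact: csmooth_cst|apply: csmoothZ => //; exact: csmooth_cst].
have [||d d0 Hd] := @plane_open R (fun s r => U (x + s *: u + r *: v)) 0 0.
- move=> a b sa sb Uab.
  have /oU op := (smooth_curveP _ hE).2 (sl a b sa sb).
  have : nbhs (0 : R) [set h | U (x + a h *: u + b h *: v)] by apply: open_nbhs_nbhs.
  by move=> /near0P.
- by rewrite !scale0r !addr0.
have [phi [sphi phi_id phi_small]] := smooth_cutoff 0 d0.
have phi_near : \forall s \near (0 : R), phi s = s.
  apply/near0P; exists (d / 4); first by rewrite divr_gt0.
  by move=> s /ltW; have := phi_id s; rewrite subr0.
have phi0 : phi 0 = 0 by exact: nbhs_singleton phi_near.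
pose k s r := f (x + phi s *: u + phi r *: v).
have fk : smooth_fam k.
  move=> a b sa sb; apply/smooth_curveP => //; apply: sf.
    by apply/smooth_curveP => //; apply: sl; exact: csmooth_compT.
  by move=> s; apply: Hd.
have H := is_cderive_diag hF (t := 0) fk.
have -> : dirderive f x (u + v) = cderive (fun s => k s s) 0.
  apply: cderive_near; apply: filterS phi_near => s es.
  by rewrite /k es scalerDr addrA.
rewrite (cderive_val hF H) /pd1 /pd2; congr (_ + _); apply: cderive_near.
  by apply: filterS phi_near => s es; rewrite /k es phi0 scale0r addr0.
by apply: filterS phi_near => s es; rewrite /k es phi0 scale0r addr0.
Qed.

End Linearity.

Lemma cinf_openT {R : realType} (E : tvsType R) : cinf_open (@setT E).
Proof. by move=> c _; rewrite preimage_setT; exact: openT. Qed.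

Lemma is_cderive_linear {R : realType} {E F : tvsType R} (f : E -> F) (y : R -> E) t :
  hausdorff_space E -> hausdorff_space F -> linear f ->
  (forall c : R -> E, csmooth setT c -> csmooth setT (fun t => f (c t))) ->
  csmooth setT y -> is_cderive (fun s => f (y s)) t (f (cderive y t)).
Proof.
move=> hE hF lf sf sy.
have sf' : smooth_map_on setT f.
  by move=> c sc _; apply/smooth_curveP => //; apply: sf; exact/smooth_curveP.
apply: is_cderive_eq (smooth_chain hE hF (cinf_openT (E := E)) sf' sy I) _.
apply: cderive_val => //.
have H := is_cderiveD (is_cderiveZ (@is_cderive_id R 0) (is_cderive_cst (f (cderive y t)) 0))
  (is_cderive_cst (f (y t)) 0).
rewrite scaler0 !addr0 scale1r in H.
by apply: is_cderive_ext H => h; rewrite [y t + _]addrC lf.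
Qed.

Section Manifolds.
Context {R : realType} {E : tvsType R} {T : Type} (M : manifold E T).
Implicit Types (c : R -> T) (p q : T).

Lemma manifold_hausdorff : hausdorff_space E.
Proof. by have [] := model_convenient M. Qed.
Let hE := manifold_hausdorff.

Lemma chart_imgP p x : dom M p x -> chart_img M p (co M p x).
Proof. by exists x. Qed.

Lemma co_pt p y : chart_img M p y -> co M p (pt M p y) = y.
Proof. by move=> [x px <-]; rewrite coK. Qed.

Lemma dom_pt p y : chart_img M p y -> dom M p (pt M p y).
Proof. by move=> [x px <-]; rewrite coK. Qed.

Lemma chart_img_open p : cinf_open (chart_img M p).
Proof. by have := @co_open _ _ _ M p p; rewrite setIid. Qed.

Lemma dom_preimage_open p c : msmooth_curve M c -> open (c @^-1` dom M p).
Proof.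
move=> sc; rewrite openE => t /= pt; have [V [oV Vt Vd _]] := sc p t I pt.
by apply: filterS Vd _; apply: open_nbhs_nbhs.
Qed.

Lemma csmooth_chart p c : msmooth_curve M c -> (forall t, dom M p (c t)) ->
  csmooth setT (fun t => co M p (c t)).
Proof.
move=> sc pc; apply/smooth_curve_onP => //; first exact: openT.
by move=> n t _; have [V [oV Vt _ sV]] := sc p t I (pc t); exact: sV.
Qed.

(** The definition asks for all charts, but one chart around each time is enough. Transition maps
    act on entire curves in the overlap, hence two cutoffs: [phi] to stay in [V], then [psi] to stay
    in the overlap. *)
Lemma msmooth_curveP c :
  (forall t, exists p (V : set R), [/\ open V, V t, V `<=` c @^-1` dom M p &
     csmooth V (fun s => co M p (c s))]) -> msmooth_curve M c.
Proof.
move=> H q t _ qt; have [p [V [oV Vt Vp sV]]] := H t.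
have [phi [sphi phi_id phiV]] := localize oV Vt.
pose y s := co M p (c (phi s)).
have sy : csmooth setT y by apply: csmooth_comp sV sphi => s _; exact: phiV.
have phit : phi t = t by exact: nbhs_singleton phi_id.
pose O : set R := y @^-1` (co M p @` (dom M p `&` dom M q)).
have oO : open O by apply: co_open; apply/smooth_curveP.
have Ot : O t by exists (c t); [split => //; exact: Vp|rewrite /y phit].
have [psi [spsi psi_id psiO]] := localize oO Ot.
have psit : psi t = t by exact: nbhs_singleton psi_id.
have sz : csmooth setT (fun s => co M q (pt M p (y (psi s)))).
  apply/smooth_curveP => //; apply: transition_smooth => //.
  by apply/smooth_curveP => //; exact: csmooth_compT.
have : nbhs t (O `&` V `&` [set s | phi s = s] `&` [set s | psi s = s]).
  by do !apply: filterI => //; apply: open_nbhs_nbhs.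
rewrite nbhsE => -[W [oW Wt] WV]; exists W; split => //.
  move=> s /WV[[[Os Vs] /= es] _]; have [x [px qx]] := Os.
  rewrite /y es => /(congr1 (pt M p)); rewrite !coK // => [<- //|]; exact: Vp.
apply/smooth_curve_onP => //; apply: csmooth_eq (csmooth_sub (subsetT W) sz) => // s.
by move=> /WV[[[Os Vs] /= es] es']; rewrite es' /y es coK //; exact: Vp.
Qed.

Lemma msmooth_curve_cst x : msmooth_curve M (fun=> x).
Proof.
apply: msmooth_curveP => t; exists x, setT; split => //; [exact: openT| |exact: csmooth_cst].
by move=> s _; exact: dom_refl.
Qed.

Lemma msmooth_curve_comp (J : set R) c (f : R -> R^o) : open J -> msmooth_curve_on M J c ->
  csmooth setT f -> (forall t, J (f t)) -> msmooth_curve M (fun t => c (f t)).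
Proof.
move=> oJ sc sf Jf p t _ pt; have [V [oV Vt Vp sV]] := sc p (f t) (Jf t) pt.
exists (f @^-1` V); split => //; first exact: csmooth_preimage_open.
  by move=> s /= /Vp.
apply/smooth_curve_onP => //; first exact: csmooth_preimage_open.
apply: (@csmooth_comp _ _ _ V (fun s => co M p (c s))) => //; first by apply/smooth_curve_onP.
exact: csmooth_sub sf.
Qed.

Lemma msmooth_curve_compT c (f : R -> R^o) : msmooth_curve M c ->
  csmooth setT f -> msmooth_curve M (fun t => c (f t)).
Proof. by move=> sc sf; apply: (msmooth_curve_comp openT sc). Qed.

Lemma msmooth_curve_pt p (y : R -> E) : csmooth setT y -> (forall t, chart_img M p (y t)) ->
  msmooth_curve M (fun t => pt M p (y t)).
Proof.
move=> sy py; apply: msmooth_curveP => t; exists p, setT; split => //; first exact: openT.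
  by move=> s _; exact: dom_pt.
by apply: csmooth_eq sy; [exact: openT|move=> s _; rewrite co_pt].
Qed.

Lemma msmooth_id : msmooth M M id.
Proof. by move=> c. Qed.

Definition mfam (Q : R -> R -> T) := forall a b : R -> R^o, csmooth setT a -> csmooth setT b ->
  msmooth_curve M (fun t => Q (a t) (b t)).

(** Being in the chart is an open condition along curves, hence by [plane_open] it holds on a square
    around (s0, r0), into which the cutoffs push the parameters. *)
Lemma mfam_local Q p s0 r0 : mfam Q -> dom M p (Q s0 r0) -> exists phi psi : R -> R^o,
  [/\ csmooth setT phi /\ csmooth setT psi,
      \forall s \near s0, phi s = s, \forall r \near r0, psi r = r,
      forall s r, dom M p (Q (phi s) (psi r)) &
      smooth_fam (fun s r => co M p (Q (phi s) (psi r)))].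
Proof.
move=> fQ p0.
have [||d d0 Hd] := @plane_open R (fun s r => dom M p (Q s r)) s0 r0.
- move=> a b sa sb pab; have op := @dom_preimage_open p _ (fQ a b sa sb).
  have : nbhs (0 : R) [set h | dom M p (Q (a h) (b h))] by apply: open_nbhs_nbhs.
  by move=> /near0P.
- by [].
have near_ball t0 : nbhs t0 [set s : R | `|s - t0| <= d / 4].
  apply/nbhs_ballP; exists (d / 4) => /=; first by rewrite divr_gt0.
  by move=> s; rewrite /ball /= distrC => /ltW.
have [phi [sphi phi_id phi_small]] := smooth_cutoff s0 d0.
have [psi [spsi psi_id psi_small]] := smooth_cutoff r0 d0.
exists phi, psi; split => //.
- by apply: filterS (near_ball s0) => s /phi_id.
- by apply: filterS (near_ball r0) => s /psi_id.
- by move=> s r; exact: Hd.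
- move=> a b sa sb; apply: csmooth_chart.
    by apply: fQ; exact: csmooth_compT.
  by move=> t; exact: Hd.
Qed.

(** The family is in the chart only at s = s0, yet smoothness in [t] is local: near each [t],
    cutoffs replace it by a family in the chart, to which [smooth_fam_pd1] applies. *)
Lemma mfam_velocity Q p s0 : mfam Q -> (forall t, dom M p (Q s0 t)) ->
  csmooth setT (fun t => cderive (fun s => co M p (Q s t)) s0).
Proof.
move=> fQ pQ; apply/smooth_curve_onP => //; first exact: openT.
move=> n t _; have [phi [psi [[sphi spsi] phi_id psi_id _ fx]]] := mfam_local fQ (pQ t).
have sx : csmooth setT (pd1 (fun s r => co M p (Q (phi s) (psi r))) s0).
  exact: smooth_fam_col _ (smooth_fam_pd1 hE fx).
have [v Hv] := (smooth_curve_onP _ hE openT).2 sx n t I.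
exists v; apply: is_cderive_near Hv; move/nbhs_interior: psi_id; apply: filterS => r Hr.
apply: iter_cderive_near; apply: filterS Hr => r' er.
by apply: cderive_near; apply: filterS phi_id => s es; rewrite es er.
Qed.

End Manifolds.

Section TangentMap.
Context {R : realType} {E F : tvsType R} {S T : Type} (M : manifold E S) (N : manifold F T).
Variable f : S -> T.
Hypothesis sf : msmooth M N f.
Implicit Types (p : S) (r : T).

Let hE := manifold_hausdorff M.
Let hF := manifold_hausdorff N.

Lemma chart_preimage_open p r : cinf_open (co M p @` (dom M p `&` f @^-1` dom N r)).
Proof.
move=> y sy; rewrite openE => t /= -[x [px rx] xy].
have sy' := (smooth_curveP _ hE).1 sy.
have ot := @chart_img_open _ _ _ M p _ sy.
have pt_ : chart_img M p (y t) by rewrite -xy; exact: chart_imgP.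
have [phi [sphi phi_id phiV]] := localize ot pt_.
have sz : msmooth_curve M (fun s => pt M p (y (phi s))).
  by apply: msmooth_curve_pt => //; exact: csmooth_compT.
have phit : phi t = t by exact: nbhs_singleton phi_id.
have rt : dom N r (f (pt M p (y (phi t)))) by rewrite phit -xy coK.
have : nbhs t ([set s | dom N r (f (pt M p (y (phi s))))] `&` [set s | phi s = s]).
  by apply: filterI => //; apply: open_nbhs_nbhs; split => //;
    exact: dom_preimage_open (sf sz (fun=> I)).
apply: filterS => s [/= rs es]; have ys := phiV s; rewrite /= es in rs ys.
by exists (pt M p (y s)); [split => //; exact: dom_pt|exact: co_pt].
Qed.

Lemma chart_smooth_map p r :
  smooth_map_on (co M p @` (dom M p `&` f @^-1` dom N r)) (fun y => co N r (f (pt M p y))).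
Proof.
move=> y sy Uy; apply/smooth_curveP => //; apply: csmooth_chart.
  apply: (sf (c := fun t => pt M p (y t))) => //; apply: msmooth_curve_pt;
    first exact/smooth_curveP.
  by move=> t; have [x [px _] <-] := Uy t; exists x.
by move=> t; have [x [px rx] <-] := Uy t; rewrite coK.
Qed.

Lemma msmooth_chain c p r t : msmooth_curve M c -> dom M p (c t) -> dom N r (f (c t)) ->
  is_cderive (fun s => co N r (f (c s))) t
    (dirderive (fun y => co N r (f (pt M p y))) (co M p (c t)) (cderive (fun s => co M p (c s)) t)).
Proof.
move=> sc pc rc; have ot := @dom_preimage_open _ _ _ M p c sc.
have [phi [sphi phi_id phiV]] := localize ot pc.
have phit : phi t = t by exact: nbhs_singleton phi_id.
have sy : csmooth setT (fun s => co M p (c (phi s))).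
  by apply: csmooth_chart => //; exact: msmooth_curve_compT.
have Uy : (co M p @` (dom M p `&` f @^-1` dom N r)) (co M p (c (phi t))).
  by exists (c t); rewrite ?phit.
have H := smooth_chain hE hF (@chart_preimage_open p r) (@chart_smooth_map p r) sy Uy.
have -> : cderive (fun s => co M p (c s)) t = cderive (fun s => co M p (c (phi s))) t.
  by apply: cderive_near; apply: filterS phi_id => s ->.
rewrite phit in H; apply: is_cderive_near H; apply: filterS phi_id => s es.
by rewrite es coK // -es; exact: phiV.
Qed.

Lemma tangent_map_velocity c t : msmooth_curve M c ->
  tangent_map M N f (c t) (velocity M c t) = velocity N (fun s => f (c s)) t.
Proof.
move=> sc; symmetry; apply: cderive_val => //.
by apply: msmooth_chain => //; exact: dom_refl.
Qed.

End TangentMap.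

Section Tangents.
Context {R : realType} {E : tvsType R} {T : Type} (M : manifold E T).
Implicit Types (c : R -> T) (p q : T) (y u v : E).

Let hE := manifold_hausdorff M.

(** [coord_change] is the differential of the identity map read in two charts, so this is the chain
    rule for [id]. *)
Lemma coord_change_velocity c p q t : msmooth_curve M c -> dom M p (c t) -> dom M q (c t) ->
  coord_change M p q (c t) (cderive (fun s => co M p (c s)) t) = cderive (fun s => co M q (c s)) t.
Proof.
move=> sc pc qc; symmetry; apply: cderive_val => //.
exact: (msmooth_chain (@msmooth_id _ _ _ M)).
Qed.

Lemma coord_change_linear p q x : dom M p x -> dom M q x -> linear (coord_change M p q x).
Proof.
move=> px qx a u v.
have oU := @chart_preimage_open _ _ _ _ _ M M id (@msmooth_id _ _ _ M) p q.
have sf := @chart_smooth_map _ _ _ _ _ M M id (@msmooth_id _ _ _ M) p q.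
have Ux : (co M p @` (dom M p `&` id @^-1` dom M q)) (co M p x) by exists x.
have := dirderiveD hE hE oU sf Ux (a *: u) v.
by rewrite (dirderiveZ hE hE oU sf Ux).
Qed.

Lemma line_near p x v : dom M p x -> exists phi : R -> R^o,
  [/\ csmooth setT phi, \forall s \near (0 : R), phi s = s &
      forall s, chart_img M p (co M p x + phi s *: v)].
Proof.
move=> px; have sl : smooth_curve (fun s : R => co M p x + s *: v).
  apply/smooth_curveP => //; apply: csmoothD; first exact: csmooth_cst.
  by apply: csmoothZ; [exact: csmooth_id|exact: csmooth_cst].
have o := @chart_img_open _ _ _ M p _ sl.
have [|phi [sphi phi_id phiV]] := localize o (t := 0); last by exists phi.
by rewrite /= scale0r addr0; exact: chart_imgP.
Qed.

Lemma line_curve p x v : dom M p x -> exists c, [/\ msmooth_curve M c, c 0 = x,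
  forall s, dom M p (c s) & \forall s \near (0 : R), co M p (c s) = co M p x + s *: v].
Proof.
move=> px; have [phi [sphi phi_id phiV]] := line_near v px.
have phi0 : phi 0 = 0 by exact: nbhs_singleton phi_id.
exists (fun s => pt M p (co M p x + phi s *: v)); split.
- apply: msmooth_curve_pt => //; apply: csmoothD; first exact: csmooth_cst.
  by apply: csmoothZ => //; exact: csmooth_cst.
- by rewrite phi0 scale0r addr0 coK.
- by move=> s; exact: dom_pt.
- by apply: filterS phi_id => s es; rewrite co_pt // es.
Qed.

Lemma cderive_line c p x v : c 0 = x ->
  (\forall s \near (0 : R), co M p (c s) = co M p x + s *: v) ->
  cderive (fun s => co M p (c s)) 0 = v.
Proof.
move=> c0 cl; apply: cderive_val => //.
apply: (@is_cderive_near _ _ (fun s => co M p x + s *: v)).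
  by apply: filterS cl => s ->.
have H := is_cderiveD (is_cderive_cst (co M p x) 0) (is_cderiveZ (@is_cderive_id R 0)
  (is_cderive_cst v 0)).
by rewrite scaler0 !addr0 add0r scale1r in H.
Qed.

(** Tangent vectors are represented by curves, so that statements on right translations become
    statements on derivatives of curves. *)
Lemma velocity_surj x v : exists c, [/\ msmooth_curve M c, c 0 = x & velocity M c 0 = v].
Proof.
have [c [sc c0 _ cl]] := line_curve v (dom_refl M x); exists c; split => //.
by rewrite /velocity c0; apply: cderive_line cl.
Qed.

Lemma coord_change_id p v : coord_change M p p p v = v.
Proof.
have [c [sc c0 pc cl]] := line_curve v (dom_refl M p).
have cv : cderive (fun s => co M p (c s)) 0 = v by apply: cderive_line cl.
by have := coord_change_velocity sc (pc 0) (pc 0); rewrite c0 cv.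
Qed.

Section LocTensor.
Variable g : T -> E -> E -> R.
Hypothesis tg : is_tensor M g.

Lemma loc_tensor_linear1 p y v : chart_img M p y -> linear (fun u => loc_tensor M g p y u v : R^o).
Proof.
move=> py a u w; rewrite /loc_tensor; set q := pt M p y.
rewrite coord_change_linear; [|exact: dom_pt|exact: dom_refl].
by have [H _ _] := tg; exact: (H q _ a).
Qed.

Lemma loc_tensor_linear2 p y u : chart_img M p y -> linear (fun v => loc_tensor M g p y u v : R^o).
Proof.
move=> py a v w; rewrite /loc_tensor; set q := pt M p y.
rewrite coord_change_linear; [|exact: dom_pt|exact: dom_refl].
by have [_ H _] := tg; exact: (H q _ a).
Qed.

Lemma loc_tensor_smooth p (c u v : R -> E) : csmooth setT c -> (forall t, chart_img M p (c t)) ->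
  csmooth setT u -> csmooth setT v -> csmooth setT (fun t => loc_tensor M g p (c t) (u t) (v t)).
Proof.
move=> sc pc su sv; have [_ _ H] := tg.
by apply/smooth_curveP; [exact: realo_hausdorff|apply: H => //; exact/smooth_curveP].
Qed.

Lemma loc_tensor_id p u v : loc_tensor M g p (co M p p) u v = g p u v.
Proof. by rewrite /loc_tensor coK ?coord_change_id //; exact: dom_refl. Qed.

Lemma loc_tensor_velocity p c d t s : msmooth_curve M c -> msmooth_curve M d ->
  c t = d s -> dom M p (c t) ->
  loc_tensor M g p (co M p (c t)) (cderive (fun r => co M p (c r)) t) (cderive (fun r =>
    co M p (d r)) s)
  = g (c t) (velocity M c t) (velocity M d s).
Proof.
move=> sc sd cd pc; rewrite /loc_tensor coK // coord_change_velocity //; last exact: dom_refl.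
congr (g _ _ _); rewrite cd in pc *; apply: coord_change_velocity => //; exact: dom_refl.
Qed.

Lemma loc_tensor_cderive p y (u v : R -> E) t : chart_img M p y -> csmooth setT u ->
  csmooth setT v ->
  is_cderive (fun s => loc_tensor M g p y (u s) (v s)) t
    (loc_tensor M g p y (cderive u t) (v t) + loc_tensor M g p y (u t) (cderive v t)).
Proof.
move=> py su sv; have cy := @csmooth_cst _ _ setT y.
have fk : smooth_fam (fun a b => loc_tensor M g p y (u a) (v b)).
  by move=> a b sa sb; apply: loc_tensor_smooth => //; exact: csmooth_compT.
have := is_cderive_diag realo_hausdorff (t := t) fk; rewrite /pd1 /pd2.
have hR := @realo_hausdorff R.
have H1 : is_cderive (fun s => loc_tensor M g p y (u s) (v t)) t (loc_tensor M g p y (cderive u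
  t) (v t)).
  apply: (is_cderive_linear hE hR (@loc_tensor_linear1 p y (v t) py)) => // c sc.
  by apply: loc_tensor_smooth => //; exact: csmooth_cst.
have H2 : is_cderive (fun s => loc_tensor M g p y (u t) (v s)) t (loc_tensor M g p y (u t)
  (cderive v t)).
  apply: (is_cderive_linear hE hR (@loc_tensor_linear2 p y (u t) py)) => // c sc.
  by apply: loc_tensor_smooth => //; exact: csmooth_cst.
by rewrite (cderive_val hR H1) (cderive_val hR H2).
Qed.

(** Compatibility of the connection with the metric, along a curve. The diagonal rule separates the
    variation of the base point, where the Christoffel symbols enter, from that of the two
    vectors. *)
Lemma levi_civita_cderive Gam p (y u v : R -> E) t : levi_civita M g Gam ->
  csmooth setT y -> (forall s, chart_img M p (y s)) -> csmooth setT u -> csmooth setT v ->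
  is_cderive (fun s => loc_tensor M g p (y s) (u s) (v s)) t
    (loc_tensor M g p (y t) (cderive u t + Gam p (y t) (cderive y t) (u t)) (v t)
     + loc_tensor M g p (y t) (u t) (cderive v t + Gam p (y t) (cderive y t) (v t))).
Proof.
move=> [_ _ compat] sy py su sv; have hR := @realo_hausdorff R.
have fk : smooth_fam (fun a b => loc_tensor M g p (y a) (u b) (v b)).
  by move=> a b sa sb; apply: loc_tensor_smooth => //; exact: csmooth_compT.
apply: is_cderive_eq (is_cderive_diag hR (t := t) fk) _.
rewrite /pd1 /pd2 (cderive_val hR (loc_tensor_cderive (t := t) (py t) su sv)).
have -> : cderive (fun x => loc_tensor M g p (y x) (u t) (v t)) t =
    dirderive (fun e => loc_tensor M g p e (u t) (v t)) (y t) (cderive y t).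
  apply: cderive_val => //; apply: (smooth_chain hE hR (@chart_img_open _ _ _ M p)) => //.
  move=> c sc pc; apply/smooth_curveP => //; apply: loc_tensor_smooth => //; try exact: csmooth_cst.
  exact/smooth_curveP.
rewrite compat //.
have D1 a b w : loc_tensor M g p (y t) (a + b) w = loc_tensor M g p (y t) a w
  + loc_tensor M g p (y t) b w.
  by have := loc_tensor_linear1 w (py t) 1 a b; rewrite !scale1r.
have D2 a b w : loc_tensor M g p (y t) w (a + b) = loc_tensor M g p (y t) w a
  + loc_tensor M g p (y t) w b.
  by have := loc_tensor_linear2 w (py t) 1 a b; rewrite !scale1r.
by rewrite D1 D2 addrACA addrC [X in X + _]addrC [in X in _ + X]addrC [RHS]addrC.
Qed.

End LocTensor.

End Tangents.

(** * Lie groups *)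

Section LieGroup.
Context {R : realType} {E : tvsType R} (G : lie_group E).
Implicit Types (c d h : R -> G) (q x : G) (u v w : E).

Let hE := manifold_hausdorff G.
Local Notation co1 := (co G (1%g : G)).

Lemma msmooth_rtrans x : msmooth G G (fun y : G => (y * x)%g).
Proof. by move=> c sc _; apply: mul_smooth => //; exact: msmooth_curve_cst. Qed.

Lemma msmooth_curve_mulr x c : msmooth_curve G c -> msmooth_curve G (fun t => (c t * x)%g).
Proof. by move=> sc; apply: mul_smooth => //; exact: msmooth_curve_cst. Qed.

Lemma msmooth_curve_mull x c : msmooth_curve G c -> msmooth_curve G (fun t => (x * c t)%g).
Proof. by move=> sc; apply: mul_smooth => //; exact: msmooth_curve_cst. Qed.

Lemma msmooth_curve_inv c : msmooth_curve G c -> msmooth_curve G (fun t => (c t)^-1%g).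
Proof. by move=> sc; exact: inv_smooth sc (fun=> I). Qed.

Lemma mfam_mul (Q P : R -> R -> G) : mfam G Q -> mfam G P ->
  mfam G (fun s t => (Q s t * P s t)%g).
Proof. by move=> sQ sP a b sa sb; apply: mul_smooth; [exact: sQ|exact: sP]. Qed.

Lemma mfam_inv (Q : R -> R -> G) : mfam G Q -> mfam G (fun s t => (Q s t)^-1%g).
Proof. by move=> sQ a b sa sb; apply: msmooth_curve_inv; exact: sQ. Qed.

Lemma mfam_fst c : msmooth_curve G c -> mfam G (fun s t => c s).
Proof. by move=> sc a b sa sb; exact: msmooth_curve_compT. Qed.

Lemma mfam_snd c : msmooth_curve G c -> mfam G (fun s t => c t).
Proof. by move=> sc a b sa sb; exact: msmooth_curve_compT. Qed.

Lemma mfam_cst x : mfam G (fun s t => x).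
Proof. by move=> a b _ _; exact: msmooth_curve_cst. Qed.

Lemma trtrans_velocity x c t : msmooth_curve G c ->
  trtrans x (c t) (velocity G c t) = velocity G (fun s => (c s * x)%g) t.
Proof. by move=> sc; apply: (@tangent_map_velocity _ _ _ _ _ G G (fun y : G => (y * x)%g)) => //;
  exact: msmooth_rtrans. Qed.

(** The translated curve passes through 1 at time [t], so for every [t] the Eulerian velocity is
    read in the chart at 1. *)
Lemma eulerian_velocityE c t : msmooth_curve G c ->
  eulerian_velocity c t = cderive (fun s => co1 (c s * (c t)^-1)%g) t.
Proof.
by move=> sc; rewrite /eulerian_velocity trtrans_velocity // /velocity mulgV.
Qed.

Lemma loc_rinv_field c q t : msmooth_curve G c -> c t = 1%g -> dom G (1%g : G) q ->
  loc_field G (rinv_field (velocity G c t)) (1%g : G) (co1 q) =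
  cderive (fun s => co1 (c s * q)%g) t.
Proof.
move=> sc ct1 q1; rewrite /loc_field coK // /rinv_field.
have := trtrans_velocity q t sc; rewrite [in LHS]ct1 => ->.
have sq : msmooth_curve G (fun s => (c s * q)%g) by exact: msmooth_curve_mulr.
have ctq : (c t * q)%g = q by rewrite ct1 mul1g.
have := @coord_change_velocity _ _ _ G _ q (1%g : G) t sq.
by rewrite /velocity ctq; apply => //; exact: dom_refl.
Qed.

Lemma right_invariant_velocity (m : G -> E -> E -> R) c d t s : right_invariant m ->
  msmooth_curve G c -> msmooth_curve G d -> c t = d s ->
  m (c t) (velocity G c t) (velocity G d s) =
  m 1%g (cderive (fun r => co1 (c r * (c t)^-1)%g) t) (cderive (fun r => co1 (d r * (c t)^-1)%g) s).
Proof.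
move=> im sc sd cd; rewrite -(im (c t)^-1%g) mulgV trtrans_velocity //.
have := trtrans_velocity (d s)^-1%g s sd; rewrite -cd => ->.
by rewrite /velocity -cd mulgV.
Qed.

(** The family c (t + s) c(t)^-1 equals 1 at s = 0, which is the only place where [mfam_velocity]
    requires it to be in the chart at 1. *)
Lemma eulerian_velocity_csmooth c : msmooth_curve G c -> csmooth setT (eulerian_velocity c).
Proof.
move=> sc; pose Q s t := (c (t + s) * (c t)^-1)%g.
have sQ : mfam G Q.
  move=> a b sa sb; apply: mul_smooth; last by apply: msmooth_curve_inv; exact: msmooth_curve_compT.
  by apply: msmooth_curve_compT => //; exact: csmoothD.
have := mfam_velocity (p := (1%g : G)) (s0 := 0) sQ; rewrite /Q => H.
have {}H : csmooth setT (fun t => cderive (fun s => co1 (Q s t)) 0).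
  by apply: H => t; rewrite addr0 mulgV; exact: dom_refl.
apply: csmooth_eq H; first exact: openT.
move=> t _; rewrite eulerian_velocityE //; apply: cderive_val => //.
apply: (@is_cderive_shift _ _ (fun s => co1 (c s * (c t)^-1)%g) t); rewrite addr0.
have sct : msmooth_curve G (fun s => (c s * (c t)^-1)%g) by exact: msmooth_curve_mulr.
have := msmooth_chain (@msmooth_id _ _ _ G) sct (p := 1%g) (r := 1%g) (t := t).
by rewrite mulgV => /(_ (dom_refl _ _) (dom_refl _ _)); exact: is_cderive_cderive.
Qed.

Lemma mfam_family p (Q : R -> R -> G) : mfam G Q -> (forall s t, dom G p (Q s t)) ->
  smooth_fam (fun s t => co G p (Q s t)).
Proof. by move=> sQ pQ a b sa sb; apply: csmooth_chart => //; exact: sQ. Qed.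

Section RightTranslatedCurve.
Variables (c h : R -> G) (t0 : R).
Hypotheses (sc : msmooth_curve G c) (sh : msmooth_curve G h).
Hypotheses (h0 : h 0 = 1%g) (h1 : forall e, dom G (1%g : G) (h e)).
Variable w : E.
Hypothesis hw : \forall e \near (0 : R), co1 (h e) = co1 (1%g : G) + e *: w.

Let u := eulerian_velocity c t0.
Let ct s := (c s * (c t0)^-1)%g.

Let sct : msmooth_curve G ct. Proof. exact: msmooth_curve_mulr. Qed.

Let ct_t0 : ct t0 = 1%g. Proof. by rewrite /ct mulgV. Qed.

Let ct_velocity : velocity G ct t0 = u.
Proof. by rewrite /u eulerian_velocityE // /velocity ct_t0. Qed.

Let h_cderive : cderive (fun e => co1 (h e)) 0 = w.
Proof. exact: cderive_line hw. Qed.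

Let h_velocity : velocity G h 0 = w.
Proof. by rewrite /velocity h0. Qed.

Lemma rinv_field1 v : rinv_field v (1%g : G) = v.
Proof.
have [d [sd d0 dv]] := velocity_surj G (1%g : G) v.
have := trtrans_velocity (1%g : G) 0 sd; rewrite dv d0 /rinv_field => ->.
by rewrite -[RHS]dv /velocity mulg1; apply: eq_cderive => s; rewrite mulg1.
Qed.

(* The Eulerian velocity at [t0] of the left translate [h e * c]. *)
Let B e := cderive (fun s => co1 (h e * c s * (h e * c t0)^-1)%g) t0.

Let sB : csmooth setT B.
Proof.
apply: (mfam_velocity (Q := fun s e => (h e * c s * (h e * c t0)^-1)%g)) => [|e].
  apply: mfam_mul; first by apply: mfam_mul; [exact: mfam_snd|exact: mfam_fst].
  apply: mfam_inv; apply: mfam_mul; first exact: mfam_snd.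
  exact: mfam_cst.
by rewrite mulgV; exact: dom_refl.
Qed.

Let loc_rinv_w q : dom G (1%g : G) q ->
  loc_field G (rinv_field w) (1%g : G) (co1 q) = cderive (fun e => co1 (h e * q)%g) 0.
Proof. by move=> q1; rewrite -h_velocity loc_rinv_field. Qed.

Let csmooth_rinv_field : smooth_map_on (chart_img G (1%g : G)) (loc_field G (rinv_field w) (1%g
  : G)).
Proof.
move=> y sy yU; have sq : msmooth_curve G (fun t => pt G 1%g (y t)).
  by apply: msmooth_curve_pt => //; apply/smooth_curveP.
have E1 t : loc_field G (rinv_field w) 1%g (y t) = cderive (fun e =>
  co1 (h e * pt G 1%g (y t))%g) 0.
  rewrite -{1}(co_pt (yU t)) loc_rinv_w //; exact: dom_pt.
rewrite (funext E1); apply/smooth_curveP => //.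
apply: (mfam_velocity (Q := fun e t => (h e * pt G 1%g (y t))%g)) => [|t].
  by apply: mfam_mul; [exact: mfam_fst|exact: mfam_snd].
by rewrite h0 mul1g; exact: dom_pt.
Qed.

(* Differentiate  (h a * c s * (h a * c t0)^-1) * h a = h a * (c s * (c t0)^-1)  in s at t0 and
   in a at 0, splitting the left-hand side by the diagonal rule. *)
Lemma cderive_left_translate : cderive B 0 = bracket G u w.
Proof.
pose k a b := cderive (fun s => co1 (h a * c s * (h a * c t0)^-1 * h b)%g) t0.
have fk : smooth_fam k.
  move=> a b sa sb.
  apply: (mfam_velocity (Q := fun s t => (h (a t) * c s * (h (a t) * c t0)^-1 * h (b t))%g)) =>
    [|t].
    have sha := msmooth_curve_compT sh sa; have shb := msmooth_curve_compT sh sb.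
    apply: mfam_mul; last exact: mfam_snd shb.
    apply: mfam_mul; first by apply: mfam_mul; [exact: mfam_snd sha|exact: mfam_fst].
    apply: mfam_inv; apply: mfam_mul; first exact: mfam_snd sha.
    exact: mfam_cst.
  by rewrite mulgV mul1g.
have pd1k : pd1 k 0 0 = cderive B 0.
  apply: eq_cderive => a; apply: eq_cderive => s.
  by rewrite h0 mulg1.
(* At a = 0 the curve is [ct s * h b], whose velocity at [t0] is the right-invariant field of [u] at
   [h b]; varying [b] differentiates that field in the direction [w]. *)
have pd2k : pd2 k 0 0 = dirderive (loc_field G (rinv_field u) 1%g) (co1 1%g) w.
  rewrite /pd2 /dirderive; apply: cderive_near; apply: filterS hw => b hb.
  rewrite -hb -ct_velocity loc_rinv_field //; apply: eq_cderive => s.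
  by rewrite h0 !mul1g.
pose K s a := (h a * ct s)%g.
have sK : mfam G K by apply: mfam_mul; [exact: mfam_snd|exact: mfam_fst].
have [|phi [psi [[sphi spsi] phi_id psi_id pK fx]]] := mfam_local (p := (1%g : G)) (s0 :=
  t0) (r0 := 0) sK.
  by rewrite /K h0 ct_t0 mulg1; exact: dom_refl.
set x := (fun s a => co1 (K (phi s) (psi a))) in fx.
have phit0 : phi t0 = t0 by exact: nbhs_singleton phi_id.
have psi0 : psi 0 = 0 by exact: nbhs_singleton psi_id.
(* On the diagonal the factors (h a)^-1 and h a cancel, leaving h a * (c s * (c t0)^-1). *)
have diag : cderive (fun a => k a a) 0 = pd2 (pd1 x) t0 0.
  apply: cderive_near; apply: filterS psi_id => a ea; rewrite /k /pd1.
  apply: cderive_near; apply: filterS phi_id => s es; rewrite /x /K es ea /ct.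
  by rewrite invgM !mulgA mulgVK.
have sy : csmooth setT (fun s => co1 (ct (phi s))).
  by have := smooth_fam_row 0 fx; rewrite /x /K psi0 h0; under eq_fun do rewrite mul1g.
have mixed : pd1 (pd2 x) t0 0 = dirderive (loc_field G (rinv_field w) 1%g) (co1 1%g) u.
  have cy s : chart_img G 1%g (co1 (ct (phi s))).
    by apply: chart_imgP; have := pK s 0; rewrite /K psi0 h0 mul1g.
  have := smooth_chain hE hE (@chart_img_open _ _ _ G 1%g) csmooth_rinv_field sy (cy t0).
  have -> : cderive (fun s => co1 (ct (phi s))) t0 = u.
    rewrite -ct_velocity /velocity ct_t0; apply: cderive_near.
    by apply: filterS phi_id => s ->.
  rewrite phit0 ct_t0 => H; apply: (cderive_val hE); apply: is_cderive_ext H => s.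
  have ps : dom G (1%g : G) (ct (phi s)) by have := pK s 0; rewrite /K psi0 h0 mul1g.
  rewrite (loc_rinv_w ps).
  by apply: cderive_near; apply: filterS psi_id => a ea; rewrite /x /K ea.
(* With X_u, X_w the right-invariant fields in the chart at 1, the diagonal rule reads D X_w(u) =
   B'(0) + D X_u(w), and the difference of the two field derivatives is the Lie bracket. *)
have := cderive_val hE (is_cderive_diag hE (t := 0) fk).
rewrite diag (pd_comm hE t0 0 fx) mixed pd1k pd2k => /eqP.
rewrite -subr_eq => /eqP <-.
by rewrite /bracket /lie_bracket !rinv_field1.
Qed.

Section Metric.
Variables (g : G -> E -> E -> R) (Gam : G -> E -> E -> E -> E).
Hypotheses (rg : riemannian_metric G g) (ig : right_invariant g) (lc : levi_civita G g Gam).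
Hypothesis chart_hc : forall s e, dom G (c t0) (h e * c s)%g.

Let p : G := c t0.
Let x s e := co G p (h e * c s)%g.
Let hR := @realo_hausdorff R.
Let tg : is_tensor G g. Proof. by case: rg. Qed.
Let Q_mfam : mfam G (fun s e => (h e * c s)%g).
Proof. by apply: mfam_mul; [exact: mfam_snd|exact: mfam_fst]. Qed.
Let fx : smooth_fam x. Proof. exact: mfam_family. Qed.
Let gsym q a b : g q a b = g q b a. Proof. by case: rg. Qed.

(* First variation of the energy along the variation [h e * c s] of the curve. *)
Lemma euler_arnold_aux :
  g p (covariant_acceleration G Gam c t0) (rinv_field w p) =
  g 1%g (cderive (eulerian_velocity c) t0) w - g 1%g u (bracket G u w).
Proof.
have x_chart s e : chart_img G p (x s e) by apply: chart_imgP.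
have row e := smooth_fam_row e fx; have col s := smooth_fam_col s fx.
have fx1 := smooth_fam_pd1 hE fx; have fx2 := smooth_fam_pd2 hE fx.
have x_row0 : (fun s => x s 0) = (fun s => co G p (c s)).
  by apply/funext => s; rewrite /x h0 mul1g.
have x00 : x t0 0 = co G p p by rewrite /x h0 mul1g.
have gu := eulerian_velocity_csmooth sc.
have shc s : msmooth_curve G (fun e => (h e * c s)%g) by exact: msmooth_curve_mulr.
have sch e : msmooth_curve G (fun s => (h e * c s)%g).
  exact: msmooth_curve_mull.
have inv1 s : loc_tensor G g p (x s 0) (pd1 x s 0) (pd2 x s 0) = loc_tensor G g 1%g (co1 1%g)
  (eulerian_velocity c s) w.
  have e0 : (h 0 * c s)%g = c s by rewrite h0 mul1g.
  have -> : x s 0 = co G p (c s) by rewrite /x e0.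
  rewrite /pd1 x_row0 /pd2 (@loc_tensor_velocity _ _ _ G g p c (fun e => h e * c s)%g) //;
    last by rewrite -e0.
  rewrite (right_invariant_velocity ig) // loc_tensor_id // eulerian_velocityE //.
  rewrite -h_cderive; congr (g _ _ _); apply: eq_cderive => e.
  by rewrite mulgK.
have inv2 e : loc_tensor G g p (x t0 e) (pd1 x t0 e) (pd1 x t0 e) = loc_tensor G g 1%g (co1 1%g)
  (B e) (B e).
  rewrite /pd1 /x (@loc_tensor_velocity _ _ _ G g p (fun s => h e * c s)%g (fun s =>
    h e * c s)%g) //.
  by rewrite (right_invariant_velocity ig) // loc_tensor_id.
have im1 : chart_img G 1%g (co1 1%g) by apply: chart_imgP; exact: dom_refl.
have D1 := levi_civita_cderive (t := t0) tg lc (row 0) (fun s =>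
  x_chart s 0) (smooth_fam_row 0 fx1) (smooth_fam_row 0 fx2).
have D1' := loc_tensor_cderive tg (t := t0) im1 gu (@csmooth_cst _ _ setT w).
have D2 := levi_civita_cderive (t := 0) tg lc (col t0) (x_chart t0) (smooth_fam_col t0 fx1)
  (smooth_fam_col t0 fx1).
have D2' := loc_tensor_cderive tg (t := 0) im1 sB sB.
rewrite (funext inv1) in D1; rewrite (funext inv2) in D2.
(* [eq1] differentiates g(x_s, x_e) = g(u, w) in s, and [eq2] differentiates g(x_s, x_s) = g(B, B)
   in e. The covariant derivatives of x_e in s and of x_s in e agree by [pd_comm] and the symmetry
   of [Gam], so the common term can be eliminated. *)
have {D1 D1'} eq1 := is_cderive_unique hR D1 D1'.
have {D2 D2'} eq2 := is_cderive_unique hR D2 D2'.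
rewrite x00 !loc_tensor_id // in eq1 eq2.
rewrite -/(pd1 (pd1 x) t0 0) -/(pd1 (pd2 x) t0 0) -/(pd1 x t0 0) in eq1.
rewrite -/(pd2 (pd1 x) t0 0) -/(pd2 x t0 0) in eq2.
have V : velocity G c t0 = pd1 x t0 0 by rewrite /pd1 x_row0.
have W : rinv_field w p = pd2 x t0 0.
  have := trtrans_velocity p 0 sh; rewrite h_velocity h0 /rinv_field => ->.
  by rewrite /velocity h0 mul1g.
have A : covariant_acceleration G Gam c t0 = pd1 (pd1 x) t0 0
  + Gam p (co G p p) (pd1 x t0 0) (pd1 x t0 0).
  have A2 : iter 2 (@cderive R E) (fun s => co G p (c s)) t0 = pd1 (pd1 x) t0 0.
    by apply: eq_cderive => s; rewrite /pd1 x_row0.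
  by rewrite /covariant_acceleration -A2 V.
have B0 : B 0 = u.
  by rewrite /B /u eulerian_velocityE //; apply: eq_cderive => s; rewrite h0 !mul1g.
have dw : cderive (fun=> w) t0 = 0 by apply: cderive_val => //; exact: is_cderive_cst.
have g0 : g 1%g (eulerian_velocity c t0) 0 = 0.
  have := loc_tensor_linear2 tg (eulerian_velocity c t0) im1 (-1) 0 0.
  by rewrite scaler0 addr0 !loc_tensor_id // scaleN1r addNr.
have [_ Gsym _] := lc.
rewrite dw g0 addr0 -A -W in eq1.
rewrite B0 cderive_left_translate (gsym 1%g (bracket _ _ _)) pd_comm // in eq2.
rewrite (Gsym p _ (pd2 x t0 0)) in eq2; last by rewrite -x00.
rewrite [X in X + _]gsym -W in eq2; move: eq1 eq2; set z := g p (pd1 x t0 0) _.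
by rewrite -/u; lra.
Qed.

End Metric.
End RightTranslatedCurve.

End LieGroup.

(** * The Euler-Arnold equation *)

Section EulerArnold.
Context {R : realType} {E : tvsType R} (G : lie_group E).
Implicit Types (c d : R -> G).

Let hE := manifold_hausdorff G.

Lemma velocity_near c d t : (\forall s \near t, c s = d s) -> velocity G c t = velocity G d t.
Proof.
move=> cd; rewrite /velocity (nbhs_singleton cd); apply: cderive_near.
by apply: filterS cd => s ->.
Qed.

Lemma eulerian_velocity_near c d t : (\forall s \near t, c s = d s) ->
  eulerian_velocity c t = eulerian_velocity d t.
Proof.
by move=> cd; rewrite /eulerian_velocity (velocity_near cd) (nbhs_singleton cd).
Qed.

Lemma covariant_acceleration_near Gam c d t : (\forall s \near t, c s = d s) ->
  covariant_acceleration G Gam c t = covariant_acceleration G Gam d t.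
Proof.
move=> cd; rewrite /covariant_acceleration (velocity_near cd) (nbhs_singleton cd).
have -> : iter 2 (@cderive R E) (fun s => co G (d t) (c s)) t = iter 2 (@cderive R E) (fun s =>
  co G (d t) (d s)) t.
  by apply: iter_cderive_near; apply: filterS cd => s ->.
by [].
Qed.

(** Cutoffs in time and in the variation parameter keep h(e) c(s) in the chart at [c t], as
    [euler_arnold_aux] requires; both sides depend only on the germ of the curve at [t]. *)
Lemma euler_arnold g Gam c t w : riemannian_metric G g -> right_invariant g ->
  levi_civita G g Gam -> msmooth_curve G c ->
  g (c t) (covariant_acceleration G Gam c t) (rinv_field w (c t)) =
  g 1%g (cderive (eulerian_velocity c) t) w
  - g 1%g (eulerian_velocity c t) (bracket G (eulerian_velocity c t) w).
Proof.
move=> rg ig lc sc.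
have [h [sh h0 h1 hw]] := line_curve w (dom_refl G (1%g : G)).
have sQ : mfam G (fun s e => (h e * c s)%g).
  by apply: mfam_mul; [exact: mfam_snd|exact: mfam_fst].
have Q0 : dom G (c t) (h 0 * c t)%g by rewrite h0 mul1g; exact: dom_refl.
have [phi [psi [[sphi spsi] phi_id psi_id pQ _]]] := mfam_local sQ Q0.
have phit : phi t = t by exact: nbhs_singleton phi_id.
have psi0 : psi 0 = 0 by exact: nbhs_singleton psi_id.
have hw' : \forall e \near (0 : R), co G (1%g : G) (h (psi e)) = co G (1%g : G) (1%g : G) + e *: w.
  by apply: filterS2 hw psi_id => e he ->.
have cphi : \forall s \near t, c (phi s) = c s by apply: filterS phi_id => s ->.
have h0' : h (psi 0) = 1%g by rewrite psi0.
have pQ' s e : dom G (c (phi t)) (h (psi e) * c (phi s))%g by rewrite phit.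
have := euler_arnold_aux (msmooth_curve_compT sc sphi) (msmooth_curve_compT sh spsi) h0' (fun e
  => h1 (psi e)) hw' rg ig lc pQ'.
have -> : cderive (eulerian_velocity (fun s => c (phi s))) t = cderive (eulerian_velocity c) t.
  apply: cderive_near; move/nbhs_interior: cphi.
  by apply: filterS => s; exact: eulerian_velocity_near.
by rewrite phit (covariant_acceleration_near _ cphi) (eulerian_velocity_near cphi).
Qed.

Lemma rinv_field_surj q v : exists w, @rinv_field _ _ G w q = v.
Proof.
have [c [sc c0 cv]] := velocity_surj G q v.
exists (eulerian_velocity c 0).
pose d s := (c s * q^-1)%g.
have sd : msmooth_curve G d by exact: msmooth_curve_mulr.
have d0 : d 0 = 1%g by rewrite /d c0 mulgV.
have dv : velocity G d 0 = eulerian_velocity c 0.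
  by rewrite eulerian_velocityE // /velocity d0 c0.
have := trtrans_velocity q 0 sd; rewrite d0 dv /rinv_field => ->.
by have -> : (fun s => (d s * q)%g) = c by apply/funext => s; rewrite /d mulgVK.
Qed.

Lemma right_invariant_rinv (m : G -> E -> E -> R) c t w : right_invariant m ->
  msmooth_curve G c ->
  m (c t) (velocity G c t) (rinv_field w (c t)) = m 1%g (eulerian_velocity c t) w.
Proof.
move=> im sc; have [h [sh h0 hv]] := velocity_surj G (1%g : G) w.
have shc : msmooth_curve G (fun e => (h e * c t)%g) by exact: msmooth_curve_mulr.
have e0 : c t = (h 0 * c t)%g by rewrite h0 mul1g.
have -> : rinv_field w (c t) = velocity G (fun e => (h e * c t)%g) 0.
  by have := trtrans_velocity (c t) 0 sh; rewrite h0 hv /rinv_field.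
rewrite (right_invariant_velocity im sc shc e0) -eulerian_velocityE //; congr (m _ _ _).
rewrite -hv /velocity h0; apply: eq_cderive => e.
by rewrite mulgK.
Qed.

(** The vector [v] is itself the value at [q] of a right-invariant field, so it may be paired with
    itself; positivity does the rest. *)
Lemma metric_rinv_eq0 g q v : riemannian_metric G g ->
  (forall w, g q v (rinv_field w q) = 0) -> v = 0.
Proof.
move=> [_ _ pos] gv; have [w wv] := rinv_field_surj q v; have := gv w; rewrite wv => vv.
by apply/eqP; apply: contraT => /pos -/(_ q); rewrite vv ltxx.
Qed.

Lemma metric_linear1 g q s x y w : riemannian_metric G g ->
  g q (s *: x + y) w = s * g q x w + g q y w.
Proof. by move=> [[H _ _] _ _]; exact: (H q w s x y). Qed.

End EulerArnold.

Section Projection.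
Context {R : realType} {E F : tvsType R} (G : lie_group E) (H : lie_group F).
Variable f : H -> G.
Hypotheses (mf : {morph f : x y / (x * y)%g}) (sf : msmooth H G f).

Lemma morph_group1 : f 1%g = 1%g.
Proof. by apply: (mulgI (f 1%g)); rewrite -mf !mulg1. Qed.

Lemma morph_groupV x : f (x^-1)%g = (f x)^-1%g.
Proof. by apply: (mulgI (f x)); rewrite -mf !mulgV morph_group1. Qed.

(** A homomorphism sends c(s) c(t)^-1 to f(c(s)) f(c(t))^-1, so it intertwines the right
    translations in the definition of the Eulerian velocity. *)
Lemma eulerian_velocity_morph (c : R -> H) t : msmooth_curve H c ->
  eulerian_velocity (fun s => f (c s)) t = tangent_map H G f 1%g (eulerian_velocity c t).
Proof.
move=> sc; pose d s := (c s * (c t)^-1)%g.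
have sd : msmooth_curve H d by exact: msmooth_curve_mulr.
have dt : d t = 1%g by rewrite /d mulgV.
have dv : velocity H d t = eulerian_velocity c t.
  by rewrite eulerian_velocityE // /velocity dt.
have := tangent_map_velocity sf t sd; rewrite dt dv => ->.
rewrite eulerian_velocityE; last exact: sf.
rewrite /velocity dt morph_group1; apply: eq_cderive => s.
by rewrite /d mf morph_groupV.
Qed.

Lemma msmooth_curve_on_map (J : set R) (c : R -> H) : open J -> msmooth_curve_on H J c ->
  msmooth_curve_on G J (fun t => f (c t)).
Proof.
move=> oJ sc p t Jt pt; have [phi [sphi phi_id phiJ]] := localize oJ Jt.
have sc' := msmooth_curve_comp oJ sc sphi phiJ.
have phit : phi t = t by exact: nbhs_singleton phi_id.
have pt' : dom G p (f (c (phi t))) by rewrite phit.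
have [V [oV Vt Vp sV]] := sf sc' (fun=> I) I pt'.
have : nbhs t (V `&` [set s | phi s = s]) by apply: filterI => //; apply: open_nbhs_nbhs.
rewrite nbhsE => -[W [oW Wt] WV]; exists W; split => //.
  by move=> s /WV[/Vp /= + es]; rewrite es.
have hE := manifold_hausdorff G; apply/smooth_curve_onP => //.
move: sV => /smooth_curve_onP - /(_ hE oV) sV.
apply: csmooth_eq (csmooth_sub _ sV) => // [s /WV[_ /= ->]//|s /WV[]//].
Qed.

End Projection.

Lemma cderive0_interval_cst {R : realType} (J : set R) (a : R -> R^o) : is_interval J ->
  (forall t, J t -> is_cderive a t 0) -> forall s t, J s -> J t -> a s = a t.
Proof.
move=> iJ da; suff le s t : J s -> J t -> s <= t -> a s = a t.
  move=> s t Js Jt; have [st|/ltW ts] := leP s t; [exact: le|symmetry; exact: le].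
move=> Js Jt st; symmetry; apply/eqP; rewrite -subr_eq0 -normr_le0.
rewrite -(mul0r (t - s)); apply: (@mean_value _ _ a (fun=> 0) (fun x => `|x|)) => // [|x xst|x _].
- exact: norm_cseminorm.
- by apply: da; exact: iJ xst.
- by rewrite normr0.
Qed.

Theorem corollary3p4 (R : realType) (E : tvsType R) (G : lie_group E)
    (metric sigma : G -> E -> E -> R)
    (nabla : G -> E -> E -> E -> E) (Y : G -> E -> E)
    (Hsys : right_invariant_magnetic_system metric sigma nabla Y)
    (HadT : ad_transpose_exists metric)
    (Eh : tvsType R) (Gh : lie_group Eh) (Z : lie_group R^o)
    (iota : Z -> Gh) (pi : Gh -> G) (Hext : central_extension1 iota pi)
    (Phi : E * R^o -> Eh) (HPhi : lie_algebra_semidirect pi sigma Phi)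
    (metrich : Gh -> Eh -> Eh -> R)
    (Hmetrich : riemannian_metric Gh metrich)
    (Hmetrich_inv : right_invariant metrich)
    (Hmetrich1 : forall u v a b,
      metrich 1%g (Phi (u, a)) (Phi (v, b)) = metric 1%g u v + a * b)
    (nablah : Gh -> Eh -> Eh -> Eh -> Eh)
    (Hnablah : levi_civita Gh metrich nablah)
    (J : set R) (HJopen : open J) (HJ : is_interval J)
    (gammah : R -> Gh) (Hgammah : msmooth_curve_on Gh J gammah)
    (u : R -> E) (a : R -> R)
    (Hua : forall t, J t -> eulerian_velocity gammah t = Phi (u t, a t)) :
  geodesic Gh nablah J gammah <->
  exists s : R, (forall t, J t -> a t = s) /\
    magnetic_geodesic G nabla Y s J (fun t => pi (gammah t)).
Proof.
have [_ [rg ig] [_ isg] lc lY] := Hsys.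
have [[_ mpi] [_ spi] _ _ _] := Hext.
have [[lPhi [Psi PhiK PsiK]] smPhi brPhi tpi] := HPhi.
have hE := manifold_hausdorff G; have hEh := manifold_hausdorff Gh.
have hR := @realo_hausdorff R.
pose gamma t := pi (gammah t).
have Phi0 x b : Phi (x, b) = Phi (x, 0) + Phi (0, b).
  have := lPhi 1 (x, 0) (0, b); rewrite !scale1r => <-; congr Phi.
  by rewrite [RHS]surjective_pairing /= addr0 add0r.
have lin1 : linear (fun x => Phi (x, 0)).
  move=> r x y; rewrite -lPhi; congr Phi.
  by rewrite [RHS]surjective_pairing /= scaler0 addr0.
have lin2 : linear (fun b : R^o => Phi (0, b)).
  move=> r x y; rewrite -lPhi; congr Phi.
  by rewrite [RHS]surjective_pairing /= scaler0 addr0.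
have sm1 (x : R -> E) : csmooth setT x -> csmooth setT (fun t => Phi (x t, 0)).
  move=> sx; apply/smooth_curveP => //; apply/smPhi.
  by split; apply/smooth_curveP => //; exact: csmooth_cst.
have sm2 (b : R -> R^o) : csmooth setT b -> csmooth setT (fun t => Phi (0, b t)).
  move=> sb; apply/smooth_curveP => //; apply/smPhi.
  by split; apply/smooth_curveP => //; exact: csmooth_cst.
(* Here (u', a') is the derivative of the Eulerian velocity at [t]. The weak equations on [Gh] and
   on [G] involve the same u', and this couples the two accelerations. *)
have at_point t : J t -> exists u' a', [/\ @is_cderive _ R^o a t a',
    forall w b, metrich (gammah t) (covariant_acceleration Gh nablah gammah t) (rinv_field (Phi
      (w, b)) (gammah t)) =
      metric 1%g u' w + a' * b - (metric 1%g (u t) (bracket G (u t) w) + a t * sigma 1%g (u t) w),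
    forall w, metric (gamma t) (covariant_acceleration G nabla gamma t) (rinv_field w (gamma t)) =
      metric 1%g u' w - metric 1%g (u t) (bracket G (u t) w) &
    forall w, sigma (gamma t) (velocity G gamma t) (rinv_field w (gamma t)) = sigma 1%g (u t) w].
  move=> Jt; have [phi [sphi phi_id phiJ]] := localize HJopen Jt.
  pose c s := gammah (phi s).
  have sc : msmooth_curve Gh c by exact: msmooth_curve_comp Hgammah sphi phiJ.
  have cg : \forall s \near t, c s = gammah s by apply: filterS phi_id => s; rewrite /c => ->.
  pose U s := Psi (eulerian_velocity c s).
  have PhiU s : Phi ((U s).1, (U s).2) = eulerian_velocity c s by rewrite -surjective_pairing PsiK.
  (* The functions [u] and [a] come without any smoothness; near [t] they are the components of the
     smooth Eulerian velocity of [c], which [smPhi] shows to be smooth. *)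
  have [su sa] : smooth_curve (fun s => (U s).1) /\ smooth_curve (fun s => (U s).2).
    apply/smPhi; rewrite (funext PhiU); apply/smooth_curveP => //.
    exact: eulerian_velocity_csmooth.
  have {}su := (smooth_curveP _ hE).1 su; have {}sa := (smooth_curveP _ hR).1 sa.
  have Uua : \forall s \near t, (U s).1 = u s /\ (U s).2 = a s.
    have nJ : nbhs t J by apply: open_nbhs_nbhs.
    move/nbhs_interior: (cg); apply: filterS2 nJ => s Js cs.
    have := PhiU s; rewrite (eulerian_velocity_near cs) Hua // => /(congr1 Psi).
    by rewrite !PhiK => -[].
  have [ut at_] := nbhs_singleton Uua.
  exists (cderive (fun s => (U s).1) t), (cderive (fun s => (U s).2) t).
  have dU : cderive (eulerian_velocity c) t = Phi (cderive (fun s =>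
    (U s).1) t, cderive (fun s => (U s).2) t).
    have H1 := is_cderive_linear (t := t) hE hEh lin1 sm1 su.
    have H2 := is_cderive_linear (t := t) hR hEh lin2 sm2 sa.
    rewrite Phi0; apply: (cderive_val hEh); apply: is_cderive_ext (is_cderiveD H1 H2) => s.
    by rewrite -PhiU [in RHS]Phi0.
  have gc : \forall s \near t, gamma s = pi (c s) by apply: filterS cg => s; rewrite /gamma => ->.
  have spc : msmooth_curve G (fun s => pi (c s)) by exact: spi.
  have eg s : eulerian_velocity (fun s => pi (c s)) s = (U s).1.
    by rewrite (eulerian_velocity_morph mpi spi) // -PhiU tpi.
  split.
  - have := cderive_csmooth (t := t) sa; apply: is_cderive_near.
    by apply: filterS Uua => s [].
  - move=> w b; rewrite -(nbhs_singleton cg) -(covariant_acceleration_near _ cg).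
    rewrite (euler_arnold _ _ Hmetrich Hmetrich_inv Hnablah sc) dU -PhiU brPhi !Hmetrich1.
    by rewrite ut at_.
  - move=> w; rewrite (nbhs_singleton gc) (covariant_acceleration_near _ gc).
    by rewrite (euler_arnold _ _ rg ig lc spc) (funext eg) ut.
  - move=> w; rewrite (velocity_near gc) (nbhs_singleton gc) (right_invariant_rinv _ _ isg spc).
    by rewrite eg ut.
split.
- move=> [_ geo].
  have key t : J t -> @is_cderive _ R^o a t 0 /\
      covariant_acceleration G nabla gamma t = a t *: Y (gamma t) (velocity G gamma t).
    move=> Jt; have [u' [a' [da eqh eqg eqs]]] := at_point t Jt.
    have eqh0 w b : metric 1%g u' w + a' * b = metric 1%g (u t) (bracket G (u t) w)
      + a t * sigma 1%g (u t) w.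
      have := eqh w b; rewrite geo //.
      have := metric_linear1 (gammah t) (-1) 0 0 (rinv_field (Phi (w, b)) (gammah t)) Hmetrich.
      by rewrite scaler0 addr0; lra.
    (* The instances b = 0 and b = 1 at w = 0 differ exactly by a'. *)
    have a'0 : a' = 0 by have := eqh0 0 0; have := eqh0 0 1; lra.
    split; first by rewrite -a'0.
    apply/eqP; rewrite -subr_eq0; apply/eqP; apply: (metric_rinv_eq0 (q := gamma t) rg) => w.
    rewrite addrC -scaleNr metric_linear1 // lY eqs eqg.
    by have := eqh0 w 0; lra.
  have sgamma := msmooth_curve_on_map spi HJopen Hgammah.
  (* The strength is the value of [a] at any time in [J]; if [J] is empty, any number will do. *)
  have [[t1 Jt1]|noJ] := pselect (exists t, J t).
    have acst t : J t -> a t = a t1.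
      by move=> Jt; apply: (cderive0_interval_cst HJ) => // s /key[].
    exists (a t1); split => //; split => // t Jt.
    by have [_ ->] := key t Jt; rewrite acst.
  by exists 0; split; [|split] => // t Jt; case: noJ; exists t.
- move=> [s [as_ [_ geo]]]; split => // t Jt.
  have [u' [a' [da eqh eqg eqs]]] := at_point t Jt.
  (* Openness of [J] makes [a] constant on a neighbourhood of [t], not only at [t]. *)
  have a'0 : a' = 0.
    apply: (is_cderive_unique hR da); apply: is_cderive_near (is_cderive_cst (s : R^o) t).
    have : nbhs t J by apply: open_nbhs_nbhs.
    by apply: filterS => r /as_.
  apply: (metric_rinv_eq0 (q := gammah t) Hmetrich) => W.
  (* Each Lie algebra vector is some Phi (w, b). With a' = 0 its pairing no longer involves [b] and
     reduces to the weak magnetic equation tested against [w]. *)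
  rewrite -(PsiK W) (surjective_pairing (Psi W)) eqh a'0 as_ //.
  have := eqg (Psi W).1; rewrite geo // -[X in metric _ X]addr0 metric_linear1 // lY eqs.
  have := metric_linear1 (gamma t) (-1) 0 0 (rinv_field (Psi W).1 (gamma t)) rg.
  by rewrite scaler0 addr0; lra.
Qed.
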